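(* Let $K\subset\mathbb{R}^n$ ($n\ge 1$) be a convex body and $C=K\times\mathbb{R}\subset\mathbb{R}^{n+1}$. Then there is a constant $v_0>0$ such that the slabs $K\times I$, where $I\subset\mathbb{R}$ is a compact interval, are (up to sets of measure zero) the only isoperimetric regions in $C$ of volume larger than or equal to $v_0$. In particular, $I_C(v)=2H^n(K)$ for all $v\ge v_0$.
   Context: A convex body is a compact convex set with non-empty interior. $H^n$ is $n$-dimensional Hausdorff measure. For measurable $E\subset C$, $|E|$ denotes the $(n+1)$-dimensional Hausdorff (Lebesgue) measure, called volume. The relative perimeter of $E$ in the interior of $C$ is $P_C(E)=\sup\{\int_E \operatorname{div}\xi\, dH^{n+1} : \xi \text{ smooth vector field with compact support in } \operatorname{int}(C),\ |\xi|\le 1\}$. The isoperimetric profile is $I_C(v)=\inf\{P_C(E): E\subset C,\ |E|=v\}$, and $E\subset C$ is an isoperimetric region if $P_C(E)=I_C(|E|)$. *)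

(* Defs.v *)
From HB Require Import structures.
From mathcomp Require Import all_boot all_order all_algebra.
From mathcomp Require Import all_classical all_reals all_analysis.

Set Implicit Arguments.
Unset Strict Implicit.
Unset Printing Implicit Defensive.

Import Order.TTheory GRing.Theory Num.Theory.
Import numFieldNormedType.Exports.

Local Open Scope classical_set_scope.
Local Open Scope ring_scope.

(* The identification of R^m x R with R^(m+1), (y, t) |-> (y_1, ..., y_m, t). *)
Definition snoc_rV {R : realType} {m : nat} (p : 'rV[R]_m * R) : 'rV[R]_m.+1 :=
  \row_(i < m.+1) oapp (p.1 0) p.2 (unlift ord_max i).

(* K x I, seen inside R^(m+1). *)
Definition cyl {R : realType} {m : nat} (K : set 'rV[R]_m) (I : set R) :
  set 'rV[R]_m.+1 := snoc_rV @` (K `*` I).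

Section lebesgue.
Variable R : realType.

Definition coord_sets (m : nat) : set (set 'rV[R]_m) :=
  [set A | exists i, exists2 B : set (measurableTypeR R),
    measurable B & A = (fun x : 'rV[R]_m => x 0 i) @^-1` B].

(* R^m with its Borel sets, presented as the product sigma-algebra. *)
Local Notation borel_rV m := (g_sigma_algebraType (@coord_sets m)).

Section snoc_measure.
Variables (m : nat) (mu : {measure set (borel_rV m) -> \bar R}).

Let snoc (p : borel_rV m * measurableTypeR R) : borel_rV m.+1 := snoc_rV p.

Lemma measurable_snoc : measurable_fun [set: borel_rV m * measurableTypeR R] snoc.
Proof.
apply: (@measurability _ _ (borel_rV m * measurableTypeR R)%type (borel_rV m.+1)
  setT snoc (@coord_sets m.+1)); first by reflexivity.
move=> _ [_ [i [B mB ->]] <-]; rewrite setTI.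
case: (unliftP ord_max i) => [j|] ->.
- rewrite (_ : _ @^-1` _ = (fun x : 'rV[R]_m => x 0 j) @^-1` B `*` setT).
    apply: measurableX => //.
    by apply: sub_sigma_algebra; exists j, B.
  by apply/seteqP; split=> p; rewrite /snoc /snoc_rV /= mxE liftK //= => -[].
- rewrite (_ : _ @^-1` _ = setT `*` B); first exact: measurableX.
  by apply/seteqP; split=> p; rewrite /snoc /snoc_rV /= mxE unlift_none //= => -[].
Qed.

Definition snoc_measure : set (borel_rV m.+1) -> \bar R :=
  pushforward (mu \x lebesgue_measure)%E snoc.

Let snoc_measure0 : snoc_measure set0 = 0%E.
Proof. by rewrite /snoc_measure /pushforward preimage_set0 measure0. Qed.

Let snoc_measure_ge0 A : (0 <= snoc_measure A)%E.
Proof. rewrite /snoc_measure. apply: measure_ge0. exact: measurable_snoc. Qed.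

Let snoc_measure_sigma_additive : semi_sigma_additive snoc_measure.
Proof.
rewrite /snoc_measure.
apply: measure_semi_sigma_additive; exact: measurable_snoc.
Qed.

HB.instance Definition _ := isMeasure.Build _ _ _ snoc_measure
  snoc_measure0 snoc_measure_ge0 snoc_measure_sigma_additive.

End snoc_measure.

Fixpoint borel_lebesgue (m : nat) : {measure set (borel_rV m) -> \bar R} :=
  match m with
  | 0 => \d_(0 : borel_rV 0)
  | m'.+1 => snoc_measure (borel_lebesgue m')
  end.

(* Lebesgue measure on R^m is the completion of the product measure; its
   measurable sets, the Lebesgue measurable ones, are the Caratheodory
   measurable sets of the associated outer measure. On subsets of R^m the
   m-dimensional Hausdorff measure H^m, normalized as usual by the volume of
   the unit ball, is this measure. *)
Definition lebesgue_rV (m : nat) :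
    {measure set (caratheodory_type (borel_lebesgue m)^*%mu) -> \bar R} :=
  @completed_measure_extension _ _ _ (borel_lebesgue m).

Definition lebesgue_measurable (m : nat) (E : set 'rV[R]_m) : Prop :=
  (borel_lebesgue m)^*%mu.-cara.-measurable E.

End lebesgue.

Section isoperimetry.
Context {R : realType}.

Definition convex_body (n : nat) (K : set 'rV[R]_n) : Prop :=
  [/\ compact K, convex_set (K : set (convex_lmodType 'rV[R]_n)) & K° !=set0].

Fixpoint class_C (k m : nat) (f : 'rV[R]_m -> R) : Prop :=
  continuous f /\
  match k with
  | 0 => True
  | k'.+1 => forall i : 'I_m, (forall x, derivable f x (delta_mx 0 i)) /\
      class_C k' (fun x => 'D_(delta_mx 0 i) f x)
  end.

Definition smooth (m : nat) (f : 'rV[R]_m -> R) : Prop := forall k, class_C k f.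

(* The library norm on 'rV[R]_m is the sup norm; this is the Euclidean one. *)
Definition enorm (m : nat) (x : 'rV[R]_m) : R := Num.sqrt (\sum_i x 0 i ^+ 2).

Definition divergence (m : nat) (xi : 'rV[R]_m -> 'rV[R]_m) (x : 'rV[R]_m) : R :=
  \sum_i 'D_(delta_mx 0 i) (fun y => xi y 0 i) x.

Definition test_field (m : nat) (U : set 'rV[R]_m) (xi : 'rV[R]_m -> 'rV[R]_m) :
    Prop :=
  [/\ forall i, smooth (fun x => xi x 0 i),
      compact (closure [set x | xi x != 0]),
      closure [set x | xi x != 0] `<=` U &
      forall x, enorm (xi x) <= 1].

Definition perimeter (m : nat) (C E : set 'rV[R]_m) : \bar R :=
  ereal_sup [set (\int[lebesgue_rV R m]_(x in E) (divergence xi x)%:E)%E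
            | xi in test_field C°].

Definition profile (m : nat) (C : set 'rV[R]_m) (v : R) : \bar R :=
  ereal_inf [set perimeter C E | E in
    [set E | [/\ lebesgue_measurable E, E `<=` C & lebesgue_rV R m E = v%:E]]].

(* An isoperimetric region has finite volume, the profile being a function of
   real volumes. *)
Definition isoperimetric_region (m : nat) (C E : set 'rV[R]_m) : Prop :=
  [/\ lebesgue_measurable E, E `<=` C &
    exists2 v : R, lebesgue_rV R m E = v%:E & perimeter C E = profile C v].

End isoperimetry.

(* Main.v *)
Require Import Defs.
From HB Require Import structures.
From mathcomp Require Import all_boot all_order all_algebra.
From mathcomp Require Import all_classical all_reals all_analysis.
From mathcomp Require Import measurable_realfun.
From mathcomp Require Import ring lra.

Set Implicit Arguments.
Unset Strict Implicit.
Unset Printing Implicit Defensive.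

Import Order.TTheory GRing.Theory Num.Theory.
Import numFieldNormedType.Exports.

Local Open Scope classical_set_scope.
Local Open Scope ring_scope.

(** Write kap for the measure of K. A slab has relative perimeter at most 2 kap: the vertical
    component of a test field is integrated along the generators of the cylinder by the fundamental
    theorem of calculus, and the horizontal components integrate to zero ([perimeter_slab]).
    Everything else follows from a rigidity statement, [borel_rigidity]: if a set of large volume
    has all its test integrals bounded by some P <= 2 kap, then P >= 2 kap and the set is a slab up
    to a null set. By [borel_competitor] it suffices to treat a Borel set B inside the cylinder over
    the interior of K, and the whole argument is carried by the slice volumes g(t), which lie in
    [0, kap].

    B is tested against fields with a horizontal and a vertical component. Averaging over horizontal
    translations shows that some horizontal field detects the slices that are neither empty nor
    full: with a constant cc > 0 depending only on K, it contributes cc times the integral of g (kap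
    - g) over ]p, q[ ([horizontal_field]). A vertical component a(t) contributes the integral of a'
    g. The two may be combined with weights b and gam on ]p, q[ as soon as gam^2 + b^2 <= 1
    ([one_field]). Letting a tend to a step function with jumps at Lebesgue points of g gives
    [four_point]. Since g is integrable, the two outer jumps can be put where g is almost zero, and
    there remains [two_point]: for 0 <= x <= 1, 2 kap - P + x cc (integral of g (kap - g) between t0
    and t1) <= 2 (kap - g t0) + x^2 (kap - g t1). The gain is linear in x and the cost is quadratic,
    which is the source of all that follows.

    Large volume forces slices that are almost full ([exists_near_full]). Otherwise the deficit kap
    - g has a positive infimum del, and t0 can be chosen with deficit at most 2 del. Optimizing x
    bounds the square of the gain between t0 and t by 64 del (kap - g t). Hence the deficit
    quadruples each time the measure of {g >= kap / 2} crossed since t0 reaches the next term of a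
    convergent geometric sequence ([growth]). The deficit being at most kap, the set {g >= kap / 2}
    has measure bounded independently of del ([high_set_le]), while the volume outside it is
    controlled by the integral of g (kap - g) ([volume_le]). So the volume is at most 262 / cc, a
    contradiction.

    Once slices are almost full, x = 0 gives P >= 2 kap ([two_kap_le]), and small x shows that the
    integral of g (kap - g) vanishes ([mix_eq0]), so that g is almost everywhere 0 or kap. An empty
    slice between two full ones would cost perimeter 3 kap; hence the full slices fill an interval
    ([profile_slab]). *)

Definition pushmeasure d d' (T1 : measurableType d) (T2 : measurableType d')
    (R : realType) (m : {measure set T1 -> \bar R}) (f : T1 -> T2)
    (mf : measurable_fun setT f) : {measure set T2 -> \bar R} :=
  measure_function_pushforward__canonical__measure_function_Measure m mf.

Notation borel_rV R m := (g_sigma_algebraType (@coord_sets R m)).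

(** * Borel structure and Lebesgue measure on R^m, scaling and translation *)

Section borel_rV_theory.
Context {R : realType}.

Lemma measurable_coord m (i : 'I_m) :
  measurable_fun setT (fun x : borel_rV R m => (x : 'rV[R]_m) 0 i).
Proof.
move=> _ B mB; rewrite setTI; apply: sub_sigma_algebra; exists i, B => //.
Qed.

Lemma measurable_fun_rV d (T : measurableType d) m (D : set T)
    (f : T -> borel_rV R m) : measurable D ->
  (forall i, measurable_fun D (fun t => (f t : 'rV[R]_m) 0 i)) ->
  measurable_fun D f.
Proof.
move=> mD mf.
apply: (@measurability _ _ T (borel_rV R m) D f (@coord_sets R m)) => //.
by move=> _ [_ [i [B mB ->]] <-]; exact: mf.
Qed.

Lemma measurable_affine m (r : R) (u : 'rV[R]_m) :
  measurable_fun setT (fun x : borel_rV R m => r *: x + u : borel_rV R m).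
Proof.
apply: measurable_fun_rV => // i.
under eq_fun do rewrite !mxE.
apply: measurable_funD => //; apply: measurable_funM => //.
exact: measurable_coord.
Qed.

Lemma measurable_snoc_rV m : measurable_fun setT
  (fun p : borel_rV R m * measurableTypeR R => snoc_rV p : borel_rV R m.+1).
Proof. exact: measurable_snoc. Qed.

(** A copy of [borel_lebesgue] under a name of its own, to which the sigma-finite structure required
    by products and Fubini is attached below. *)
Definition leb m : set (borel_rV R m) -> \bar R := borel_lebesgue R m.
Arguments leb : clear implicits.
HB.instance Definition _ m := Measure.copy (leb m) (borel_lebesgue R m).

Definition box m (M : R) : set (borel_rV R m) :=
  [set x : 'rV[R]_m | forall i, `|x 0 i| <= M].

Lemma measurable_box m (M : R) : measurable (@box m M).
Proof.
have -> : @box m M = \bigcap_(i in [set: 'I_m])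
    (fun x : borel_rV R m => (x : 'rV[R]_m) 0 i) @^-1` `[-M, M].
  apply/seteqP; split => [x Hx i _|x Hx i] /=.
    by rewrite in_itv /= -ler_norml; exact: Hx.
  by have /= := Hx i I; rewrite in_itv /= -ler_norml.
apply: fin_bigcap_measurable => // i _.
by rewrite -[X in measurable X]setTI; exact: measurable_coord.
Qed.

Lemma snoc_rV_last m (p : 'rV[R]_m * R) : snoc_rV p 0 ord_max = p.2.
Proof. by rewrite mxE unlift_none. Qed.

Lemma snoc_rV_lift m (p : 'rV[R]_m * R) (i : 'I_m) :
  snoc_rV p 0 (lift ord_max i) = p.1 0 i.
Proof. by rewrite mxE liftK. Qed.

Lemma snoc_preimage_box m (M : R) :
  @snoc_rV R m @^-1` box M = (box M : set (borel_rV R m)) `*` `[-M, M].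
Proof.
apply/seteqP; split => [[y t] /= H|[y t] /= [H1 H2] i].
- split=> [i|]; first by have := H (lift ord_max i); rewrite snoc_rV_lift.
  by have := H ord_max; rewrite snoc_rV_last /= in_itv /= ler_norml.
- case: (unliftP ord_max i) => [j|] ->; first by rewrite snoc_rV_lift.
  by rewrite snoc_rV_last /=; move: H2; rewrite in_itv /= -ler_norml.
Qed.

Lemma leb_snoc m (A : set (borel_rV R m.+1)) :
  leb m.+1 A = (leb m \x lebesgue_measure)%E (@snoc_rV R m @^-1` A).
Proof. by []. Qed.

Lemma leb_box_fin m (M : R) : (leb m (box M) < +oo)%E.
Proof.
elim: m => [|m IH].
  by rewrite /leb /= /dirac /= ltry.
rewrite leb_snoc snoc_preimage_box product_measure1E//; last first.
  exact: measurable_box.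
apply: lte_mul_pinfty => //.
  by rewrite ge0_fin_numE.
change (lebesgue_measure `[(- M)%R, M]%classic < +oo)%E.
by rewrite lebesgue_measure_itv /=; case: ifP => // _; rewrite -EFinB ltry.
Qed.

Lemma bigcup_box m : \bigcup_k @box m k%:R = setT.
Proof.
apply/seteqP; split => // x _; exists (Num.trunc (\sum_i `|(x : 'rV[R]_m) 0 i|)).+1 => // i.
apply: le_trans (ltW (truncnS_gt _)).
by rewrite (bigD1 i)//= lerDl sumr_ge0.
Qed.

Lemma sigma_finite_leb m : sigma_finite [set: borel_rV R m] (leb m).
Proof.
exists (fun k => @box m k%:R); first by rewrite bigcup_box.
by move=> k; split; [exact: measurable_box|exact: leb_box_fin].
Qed.

HB.instance Definition _ m := @Measure_isSigmaFinite.Build _ _ _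
  (leb m) (@sigma_finite_leb m).

(** The suitably rescaled pushforward agrees with Lebesgue measure on half-open intervals, and
    uniqueness does the rest. *)
Lemma lebesgue_measure_affine (r s : R) (A : set (measurableTypeR R)) : 0 < r ->
  measurable A ->
  lebesgue_measure ((fun t => r * t + s) @^-1` A) = (r^-1%:E * lebesgue_measure A)%E.
Proof.
move=> r0 mA.
have mf : measurable_fun setT (fun t : measurableTypeR R => r * t + s : measurableTypeR R).
  by apply: measurable_funD => //; exact: mulrl_measurable.
have -> : lebesgue_measure A =
    mscale (NngNum (ltW r0)) (pushmeasure lebesgue_measure mf) A.
  apply: lebesgue_measure_unique => //= _ [[a b]] _ <-.
  rewrite /mscale /= /pushforward /=.
  have -> : (fun t : R => r * t + s) @^-1` `]a, b] = `](a - s) / r, (b - s) / r]%classic.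
    apply/seteqP; split => t /=; rewrite !in_itv /= ler_pdivlMr// ltr_pdivrMr//;
    by rewrite ltrBlDr lerBrDr mulrC.
  rewrite !lebesgue_measure_itv /= !lte_fin ltr_pM2r ?invr_gt0// ltrD2r.
  case: ifP => _; last by rewrite mule0.
  rewrite -!EFinB -EFinM; congr EFin; field; exact: lt0r_neq0.
by rewrite /mscale /= muleA -EFinM mulVf ?lt0r_neq0// mul1e.
Qed.

Lemma affine_snoc m (r : R) (u : 'rV[R]_m.+1) (p : 'rV[R]_m * R) :
  r *: snoc_rV p + u = snoc_rV (r *: p.1 + \row_i u 0 (lift ord_max i),
                                r * p.2 + u 0 ord_max).
Proof.
apply/rowP => i; case: (unliftP ord_max i) => [j|] ->.
  by rewrite snoc_rV_lift !mxE liftK /=.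
by rewrite snoc_rV_last !mxE unlift_none.
Qed.

Lemma leb_affine m (r : R) (u : 'rV[R]_m) (A : set (borel_rV R m)) : 0 < r ->
  measurable A ->
  leb m ((fun x : 'rV[R]_m => r *: x + u) @^-1` A) = ((r^-1 ^+ m)%:E * leb m A)%E.
Proof.
move=> r0; elim: m u A => [|m IH] u A mA.
  rewrite expr0 mul1e; congr (leb _ _).
  by apply/seteqP; split => x; rewrite /= (_ : r *: x + u = x)//; apply/rowP => -[].
rewrite !leb_snoc.
set F := fun p : borel_rV R m * measurableTypeR R =>
  (r *: (p.1 : 'rV[R]_m) + \row_i u 0 (lift ord_max i) : borel_rV R m,
   r * p.2 + u 0 ord_max : measurableTypeR R).
have mF : measurable_fun setT F.
  apply/measurable_fun_pairP; split.
    apply: (measurableT_comp (@measurable_affine m r _)) => //.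
  rewrite /comp /=; apply: measurable_funD => //.
  by apply: measurable_funM => //; exact: measurable_snd.
have -> : @snoc_rV R m @^-1` ((fun x : 'rV[R]_m.+1 => r *: x + u) @^-1` A) =
   F @^-1` (@snoc_rV R m @^-1` A).
  by apply/seteqP; split => p; rewrite /= affine_snoc.
have mA' : measurable ((fun p => snoc_rV p : borel_rV R m.+1) @^-1` A
     : set (borel_rV R m * measurableTypeR R)).
  by rewrite -[X in measurable X]setTI; exact: measurable_snoc_rV.
(* The affine map acts separately on the first m coordinates and on the last one, so by induction
   its rescaled pushforward agrees with the product measure on rectangles; uniqueness of product
   measures concludes. *)
pose m' : {measure set (borel_rV R m * measurableTypeR R) -> \bar R} :=
  mscale (NngNum (exprn_ge0 m.+1 (ltW r0))) (pushmeasure (leb m \x lebesgue_measure)%E mF).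
have H := @product_measure_unique _ _ _ _ R (leb m : {sigma_finite_measure set (borel_rV R m) -> \bar R})
  (lebesgue_measure : {sigma_finite_measure set (measurableTypeR R) -> \bar R}) m'.
rewrite [in RHS]H//=.
  by rewrite /mscale /= /pushforward /= muleA -EFinM -exprMn mulVf ?lt0r_neq0// expr1n mul1e.
move=> A1 B1 mA1 mB1.
have mg : measurable_fun setT
    (fun t : measurableTypeR R => r * t + u 0 ord_max : measurableTypeR R).
  by apply: measurable_funD => //; exact: mulrl_measurable.
rewrite /mscale /= /pushforward /=.
have -> : F @^-1` (A1 `*` B1) = ((fun x : 'rV[R]_m => r *: x + \row_i u 0 (lift ord_max i)) @^-1` A1)
    `*` ((fun t => r * t + u 0 ord_max) @^-1` B1) by [].
rewrite product_measure1E//; first last.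
- rewrite -[X in measurable X]setTI.
  exact: mg.
- by rewrite -[X in measurable X]setTI; exact: (@measurable_affine m r).
rewrite [X in (_ * (X * _))%E](IH _ _ mA1).
rewrite [X in (_ * (_ * X))%E](lebesgue_measure_affine _ r0 mB1).
have E1 : ((r^-1 ^+ m)%:E * (r^-1)%:E = (r^-1 ^+ m.+1)%:E)%E.
  by rewrite -EFinM -exprSr.
have E2 : ((r ^+ m.+1)%:E * (r^-1 ^+ m.+1)%:E = 1)%E.
  by rewrite -EFinM -exprMn mulfV ?lt0r_neq0// expr1n.
rewrite muleACA [X in (_ * (X * _))%E = _]E1 muleA [X in (X * _)%E = _]E2.
by rewrite mul1e.
Qed.

End borel_rV_theory.
Arguments leb {R} m _ : simpl never.

(** * Comparison of Lebesgue measurable sets and integrals with Borel ones *)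

Section completion.
Context {R : realType}.

Lemma lebesgue_rV_leb m (A : set (borel_rV R m)) : measurable A ->
  lebesgue_rV R m A = leb m A.
Proof. exact: measurable_mu_extE. Qed.

Lemma lebesgue_measurable_borel m (A : set (borel_rV R m)) : measurable A ->
  lebesgue_measurable A.
Proof. exact: caratheodory_measurable_mu_ext. Qed.

Lemma lebesgue_rV_le m (A B : set 'rV[R]_m) : A `<=` B ->
  (lebesgue_rV R m A <= lebesgue_rV R m B)%E.
Proof. by move=> AB; exact: le_mu_ext. Qed.

Lemma lebesgue_rV_ge0 m (A : set 'rV[R]_m) : (0 <= lebesgue_rV R m A)%E.
Proof. exact: mu_ext_ge0. Qed.

Lemma lebesgue_rVU_le m (A B : set 'rV[R]_m) :
  (lebesgue_rV R m (A `|` B) <= lebesgue_rV R m A + lebesgue_rV R m B)%E.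
Proof.
exact: (@outer_measureU2 _ _ (measure_extension_mu_ext__canonical__measure_extension_OuterMeasure (borel_lebesgue R m))).
Qed.

(** The outer measure is an infimum over countable Borel covers: intersect the unions of covers that
    are optimal up to 1 / (k + 1). *)
Lemma borel_hull m (E : set 'rV[R]_m) : lebesgue_rV R m E \is a fin_num ->
  exists B : set (borel_rV R m),
    [/\ measurable B, E `<=` B & leb m B = lebesgue_rV R m E].
Proof.
move=> Efin.
have H k : exists F : set (borel_rV R m), [/\ measurable F, E `<=` F &
    (leb m F <= lebesgue_rV R m E + k.+1%:R^-1%:E)%E].
  have : (lebesgue_rV R m E < lebesgue_rV R m E + k.+1%:R^-1%:E)%E.
    by rewrite lteDl// lte_fin invr_gt0.
  rewrite {1}/lebesgue_rV /= /completed_measure_extension /mu_ext.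
  move=> /ereal_inf_lt[_ [F [mF EF] <-] lF].
  exists (\bigcup_k F k); split => //; first exact: bigcupT_measurable.
  apply: le_trans (ltW lF).
  apply: (@measure_sigma_subadditive _ _ _ (leb m)) => //.
  exact: bigcupT_measurable.
have [F HF] := choice H.
exists (\bigcap_k F k).
have mB : measurable (\bigcap_k F k : set (borel_rV R m)).
  by apply: bigcapT_measurable => k; have [] := HF k.
have EB : E `<=` \bigcap_k F k by move=> x Ex k _; have [_ + _] := HF k; exact.
split => //; apply/eqP; rewrite eq_le; apply/andP; split; last first.
  by rewrite -lebesgue_rV_leb//; exact: lebesgue_rV_le.
apply/lee_addgt0Pr => _/posnumP[e].
have [k ke] : exists k, (k.+1%:R^-1 : R) < e%:num.
  exists (Num.trunc e%:num^-1).
  by rewrite invf_plt ?posrE// truncnS_gt.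
have [mFk _ lFk] := HF k.
apply: (@le_trans _ _ (leb m (F k))).
  by apply: le_measure; rewrite ?inE//; exact: bigcap_inf.
by apply: le_trans lFk _; rewrite leeD2l// lee_fin ltW.
Qed.

Lemma lebesgue_rV_borel m (E : set 'rV[R]_m) : lebesgue_measurable E ->
    lebesgue_rV R m E \is a fin_num ->
  exists B : set (borel_rV R m), [/\ measurable B, E `<=` B,
    leb m B = lebesgue_rV R m E & lebesgue_rV R m (B `\` E) = 0%E].
Proof.
move=> mE Efin; have [B [mB EB lB]] := borel_hull Efin.
exists B; split => //.
have lB' : lebesgue_rV R m B = lebesgue_rV R m E by rewrite lebesgue_rV_leb.
rewrite (@measureD _ _ _ (lebesgue_rV R m) B E (lebesgue_measurable_borel mB) mE).
  by rewrite (setIidr EB) [X in (X - _)%E]lB' subee.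
by rewrite [X in (X < _)%E]lB' ltey_eq Efin.
Qed.

Lemma borel_measurable_fun_completion m (D : set (borel_rV R m))
    (f : 'rV[R]_m -> \bar R) : measurable D ->
  measurable_fun (D : set (borel_rV R m)) (f : borel_rV R m -> \bar R) ->
  measurable_fun (D : set (caratheodory_type (borel_lebesgue R m)^*%mu)) f.
Proof.
move=> mD mf _ Y mY.
exact: (lebesgue_measurable_borel (mf mD Y mY)).
Qed.

(** The identity is measurable from the completed sigma-algebra to the Borel one and pushes the
    completed measure forward to [leb]. *)
Lemma integral_lebesgue_rV m (B : set (borel_rV R m)) (f : 'rV[R]_m -> \bar R) :
  measurable B -> measurable_fun B (f : borel_rV R m -> \bar R) ->
  (\int[lebesgue_rV R m]_(x in B) f x = \int[leb m]_(x in B) f x)%E.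
Proof.
move=> mB mf.
have mid : measurable_fun setT (id : caratheodory_type (borel_lebesgue R m)^*%mu -> borel_rV R m).
  by move=> _ Y mY; rewrite setTI; exact: lebesgue_measurable_borel.
have H (g : 'rV[R]_m -> \bar R) : measurable_fun B (g : borel_rV R m -> \bar R) -> (forall x, 0 <= g x)%E ->
  (\int[lebesgue_rV R m]_(x in B) g x = \int[leb m]_(x in B) g x)%E.
  move=> mg g0.
  rewrite -(@eq_measure_integral _ _ _ _ (leb m)
     (pushmeasure (lebesgue_rV R m) mid)); last first.
    by move=> A mA _; exact: lebesgue_rV_leb.
  by rewrite ge0_integral_pushforward.
rewrite integralE [RHS]integralE !H//.
- exact: measurable_funeneg.
- exact: measurable_funepos.
Qed.

Lemma integral_lebesgue_rV_null m (A B : set 'rV[R]_m) (f : 'rV[R]_m -> \bar R) :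
  lebesgue_measurable A -> lebesgue_measurable B ->
  measurable_fun setT (f : borel_rV R m -> \bar R) ->
  lebesgue_rV R m (A `+` B) = 0%E ->
  (\int[lebesgue_rV R m]_(x in A) f x = \int[lebesgue_rV R m]_(x in B) f x)%E.
Proof.
move=> mA mB mf AB0.
have mf' := borel_measurable_fun_completion measurableT mf.
rewrite integral_mkcond [RHS]integral_mkcond.
apply: ae_eq_integral => //.
- by apply/(measurable_restrictT _ mA); exact: measurable_funS mf'.
- by apply/(measurable_restrictT _ mB); exact: measurable_funS mf'.
exists (A `+` B); split => //.
  by apply: measurableU; apply: measurableD.
move=> x /= /not_implyP[_]; rewrite /patch; case: ifPn => [/set_mem xA|xA].
  case: ifPn => // xB _; left; split => //.
  by move=> Bx; rewrite mem_set in xB.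
case: ifPn => // /set_mem xB _; right; split => //.
by move=> Ax; rewrite mem_set in xA.
Qed.

End completion.

(** * Topology of R^m, cylinders, and the null boundary of a convex body *)

Section rV_topology.
Context {R : realType}.

Lemma ball_rV m (x y : 'rV[R]_m) (e : R) : 0 < e ->
  ball x e y <-> forall i, `|x 0 i - y 0 i| < e.
Proof.
move=> e0; split => [[_ H] i|H]; first exact: (H 0 i).
by split => // i j; rewrite (ord1 i); exact: H.
Qed.

Lemma open_rVP m (U : set 'rV[R]_m) (x : 'rV[R]_m) : open U -> U x ->
  exists2 e, 0 < e & forall y : 'rV[R]_m, (forall i, `|x 0 i - y 0 i| < e) -> U y.
Proof.
move=> oU Ux; have /nbhs_ballP[e /= e0 H] := open_nbhs_nbhs (conj oU Ux).
by exists e => // y Hy; apply: H; apply/ball_rV.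
Qed.

Lemma interior_rVP m (A : set 'rV[R]_m) (x : 'rV[R]_m) :
  A° x <-> exists2 e, 0 < e &
    forall y : 'rV[R]_m, (forall i, `|x 0 i - y 0 i| < e) -> A y.
Proof.
split => [/nbhs_ballP[e /= e0 H]|[e e0 H]].
  by exists e => // y Hy; apply: H; apply/ball_rV.
by apply/nbhs_ballP; exists e => //= y /(ball_rV _ _ e0); exact: H.
Qed.

Lemma continuous_rV (T : topologicalType) m (f : T -> 'rV[R]_m) :
  (forall i, continuous (fun t => f t 0 i)) -> continuous f.
Proof.
move=> cf t; apply/cvg_ballP => e e0.
have : \forall s \near t, forall i, `|f t 0 i - f s 0 i| < e.
  apply: filter_forall => i.
  by have /cvgrPdist_lt/(_ _ e0) := cf i t.
by apply: filterS => s Hs; apply/ball_rV.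
Qed.

Definition cube m (c : 'rV[R]_m) (r : R) : set 'rV[R]_m :=
  [set y | forall i, `|c 0 i - y 0 i| < r].

Definition ccube m (c : 'rV[R]_m) (r : R) : set 'rV[R]_m :=
  [set y | forall i, `|c 0 i - y 0 i| <= r].

Lemma measurable_cube m (c : 'rV[R]_m) (r : R) :
  measurable (cube c r : set (borel_rV R m)).
Proof.
have -> : cube c r = \bigcap_(i in [set: 'I_m])
    (fun x : borel_rV R m => (x : 'rV[R]_m) 0 i) @^-1` (ball (c 0 i : R) r).
  by apply/seteqP; split => [y Hy i _|y Hy i]; [exact: Hy|exact: (Hy i I)].
apply: fin_bigcap_measurable => // i _; rewrite -[X in measurable X]setTI.
by apply: measurable_coord => //; exact: measurable_ball.
Qed.

Lemma compact_ccube m (c : 'rV[R]_m) (r : R) : compact (ccube c r).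
Proof.
have -> : ccube c r = [set v : 'rV[R]_m | forall i,
    (fun i => `[c 0 i - r, c 0 i + r]%classic) i (v ord0 i)].
  apply/seteqP; split => v Hv i /=; have /= := Hv i;
  by rewrite in_itv /= distrC ler_distl.
apply: (@rV_compact R m (fun i => `[c 0 i - r, c 0 i + r]%classic)) => i.
exact: segment_compact.
Qed.

(** The cubes have rational centres and radii 1 / (k + 1), enumerated through [unpickle]. The closed
    cubes are required to lie in U so that functions supported in them are compactly supported in
    U. *)
Lemma open_bigcup_cube m (U : set 'rV[R]_m) : open U ->
  exists G : nat -> set 'rV[R]_m, U = \bigcup_k G k /\
    forall k, G k = set0 \/ exists c r, G k = cube c r /\ ccube c r `<=` U.
Proof.
move=> oU.
pose C (qk : 'rV[rat]_m * nat) := cube (map_mx ratr qk.1 : 'rV[R]_m) qk.2.+1%:R^-1.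
pose D (qk : 'rV[rat]_m * nat) := ccube (map_mx ratr qk.1 : 'rV[R]_m) qk.2.+1%:R^-1.
exists (fun k => if @unpickle ('rV[rat]_m * nat)%type k is Some qk then
  (if `[< D qk `<=` U >] then C qk else set0) else set0); split; last first.
  move=> k; case: unpickle => [qk|]; last by left.
  by case: asboolP => H; [right; exists (map_mx ratr qk.1), qk.2.+1%:R^-1|left].
apply/seteqP; split => [x Ux|x [k _]]; last first.
  case: unpickle => [qk|//]; case: asboolP => // H Cx; apply: H => i.
  exact: ltW (Cx i).
have [e e0 He] := open_rVP oU Ux.
pose k := Num.trunc (2 / e).
have ke : (k.+1%:R^-1 : R) < e / 2.
  by rewrite invf_plt ?posrE ?divr_gt0// invf_div truncnS_gt.
have H i : exists q : rat, `|ratr q - x 0 i| < k.+1%:R^-1.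
  have lt1 : x 0 i - k.+1%:R^-1 < x 0 i + k.+1%:R^-1.
    by rewrite ltrD2l gt0_cp// invr_gt0.
  have [q] := rat_in_itvoo lt1; rewrite in_itv /= => /andP[q1 q2].
  by exists q; rewrite ltr_distl q1 q2.
have [q Hq] := choice H.
exists (pickle (\row_i q i, k)) => //; rewrite pickleK.
case: asboolP => [_ i|]; first by rewrite !mxE.
case=> y Hy; apply: He => i.
rewrite (splitr e) -(subrKA (ratr (q i))) (le_lt_trans (ler_normD _ _))//.
rewrite ltrD//; last by apply: le_lt_trans ke; have := Hy i; rewrite !mxE.
by rewrite distrC (lt_trans (Hq i)).
Qed.

Lemma open_measurable_rV m (U : set 'rV[R]_m) : open U ->
  measurable (U : set (borel_rV R m)).
Proof.
move=> /open_bigcup_cube[G [-> HG]].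
apply: bigcupT_measurable => k; case: (HG k) => [->//|[c [r [-> _]]]].
exact: measurable_cube.
Qed.

Lemma closed_measurable_rV m (A : set 'rV[R]_m) : closed A ->
  measurable (A : set (borel_rV R m)).
Proof.
by move=> cA; rewrite -(setCK A); apply: measurableC; apply: open_measurable_rV; exact: closed_openC.
Qed.

Lemma continuous_measurable_rV m (f : 'rV[R]_m -> R) : continuous f ->
  measurable_fun setT (f : borel_rV R m -> R).
Proof.
move=> cf; apply: (measurability _ (RGenOInfty.measurableE R)) => //.
move=> /= _ [_ [a ->] <-]; rewrite setTI.
apply: open_measurable_rV; apply: open_comp => // x _; exact: cf.
Qed.

Definition rinit m (x : 'rV[R]_m.+1) : 'rV[R]_m := \row_i x 0 (lift ord_max i).
Definition rlast m (x : 'rV[R]_m.+1) : R := x 0 ord_max.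

Lemma snoc_rVK m (p : 'rV[R]_m * R) : (rinit (snoc_rV p), rlast (snoc_rV p)) = p.
Proof.
case: p => y t; rewrite /rlast snoc_rV_last; congr pair.
by apply/rowP => i; rewrite mxE snoc_rV_lift.
Qed.

Lemma rinit_snoc m (y : 'rV[R]_m) t : rinit (snoc_rV (y, t)) = y.
Proof. by have [] := snoc_rVK (y, t). Qed.

Lemma rlast_snoc m (y : 'rV[R]_m) t : rlast (snoc_rV (y, t)) = t.
Proof. by have [] := snoc_rVK (y, t). Qed.

Lemma rinitK m (x : 'rV[R]_m.+1) : snoc_rV (rinit x, rlast x) = x.
Proof.
apply/rowP => i; case: (unliftP ord_max i) => [j|] ->.
  by rewrite snoc_rV_lift mxE.
by rewrite snoc_rV_last.
Qed.

Lemma cylE m (K : set 'rV[R]_m) (I : set R) :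
  cyl K I = [set x | K (rinit x) /\ I (rlast x)].
Proof.
apply/seteqP; split => [_ [[y t] [/= Ky It] <-]|x [Kx Ix]] /=.
  by rewrite rinit_snoc rlast_snoc.
by exists (rinit x, rlast x) => //; exact: rinitK.
Qed.

Lemma continuous_rinit m : continuous (@rinit m).
Proof.
apply: continuous_rV => i x.
under eq_fun do rewrite mxE.
exact: coord_continuous.
Qed.

Lemma continuous_rlast m : continuous (@rlast m).
Proof. exact: coord_continuous. Qed.

Lemma continuous_snoc m : continuous (@snoc_rV R m).
Proof.
apply: continuous_rV => i; case: (unliftP ord_max i) => [j|] ->.
  under eq_fun do rewrite snoc_rV_lift.
  move=> p; apply: (@continuous_comp _ _ _ fst (fun y : 'rV[R]_m => y 0 j)).
    exact: cvg_fst.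
  exact: coord_continuous.
under eq_fun do rewrite snoc_rV_last.
move=> p; exact: cvg_snd.
Qed.

Lemma compact_cyl m (K : set 'rV[R]_m) (I : set R) : compact K -> compact I ->
  compact (cyl K I).
Proof.
move=> cK cI; apply: continuous_compact; last exact: compact_setX.
apply: continuous_subspaceT; exact: continuous_snoc.
Qed.

Lemma open_cyl m (U : set 'rV[R]_m) (I : set R) : open U -> open I ->
  open (cyl U I).
Proof.
move=> oU oI; rewrite cylE; apply: openI.
  by apply: open_comp => // x _; exact: continuous_rinit.
by apply: open_comp => // x _; exact: continuous_rlast.
Qed.

Lemma compact_measurable_rV m (A : set 'rV[R]_m) : compact A ->
  measurable (A : set (borel_rV R m)).
Proof. by move=> cA; apply: closed_measurable_rV; exact: compact_closed. Qed.

Lemma compact_box m (A : set 'rV[R]_m) : compact A -> exists2 M, 0 < M & A `<=` box M.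
Proof.
move=> /compact_bounded [M [_ HM]].
exists (`|M| + 1); first by rewrite ltr_wpDl.
move=> x Ax i.
have /HM/(_ x Ax) : M < `|M| + 1 by rewrite (le_lt_trans (ler_norm M))// ltrDl.
apply: le_trans.
rewrite -[leRHS]/(mx_norm x) mx_normrE; by apply/bigmax_geP; right; exists (0, i).
Qed.

Lemma leb_compact_fin m (A : set 'rV[R]_m) : compact A -> (leb m A < +oo)%E.
Proof.
move=> cA; have [M _ AM] := compact_box cA.
apply: le_lt_trans (leb_box_fin m M); apply: le_measure => //; rewrite ?inE.
  exact: compact_measurable_rV.
exact: measurable_box.
Qed.

Lemma convex_setP m (K : set 'rV[R]_m) :
  convex_set (K : set (convex_lmodType 'rV[R]_m)) ->
  forall x y s, 0 <= s -> s <= 1 -> K x -> K y -> K (s *: x + (1 - s) *: y).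
Proof.
move=> cK x y s s0 s1 Kx Ky.
by have := cK x y (Itv01 s0 s1) (mem_set Kx) (mem_set Ky) => /set_mem.
Qed.

(** A point near the combination is the same combination of y with a point near x, and the latter is
    still in K. *)
Lemma convex_interior m (K : set 'rV[R]_m) (x y : 'rV[R]_m) s :
  convex_set (K : set (convex_lmodType 'rV[R]_m)) ->
  0 < s -> s <= 1 -> K° x -> K y -> K° (s *: x + (1 - s) *: y).
Proof.
move=> cK s0 s1 /interior_rVP[e e0 He] Ky; apply/interior_rVP.
exists (s * e); first exact: mulr_gt0.
move=> z Hz.
have -> : z = s *: (s^-1 *: (z - (1 - s) *: y)) + (1 - s) *: y.
  by rewrite scalerA mulfV ?lt0r_neq0// scale1r subrK.
apply: convex_setP => //; first exact: ltW.
apply: He => i; rewrite !mxE.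
have := Hz i; rewrite !mxE.
have -> : s * x 0 i + (1 - s) * y 0 i - z 0 i =
    s * (x 0 i - s^-1 * (z 0 i - (1 - s) * y 0 i)).
  by field; exact: lt0r_neq0.
by rewrite normrM gtr0_norm// ltr_pM2l.
Qed.

Lemma convex_interior_segment m (K : set 'rV[R]_m) (x w : 'rV[R]_m) s :
  convex_set (K : set (convex_lmodType 'rV[R]_m)) ->
  0 <= s -> s <= 1 -> K° x -> K° (x + w) -> K° (x + s *: w).
Proof.
move=> cK s0 s1 Kx Kxw.
have -> : x + s *: w = (1 - s) *: x + (1 - (1 - s)) *: (x + w).
  by rewrite opprB addrCA subrr addr0 scalerDr addrA -scalerDl subrK scale1r.
have [->|sn1] := eqVneq s 1.
  by rewrite subrr scale0r subr0 scale1r add0r.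
apply: convex_interior => //; last exact: (interior_subset Kxw).
  by rewrite subr_gt0 lt_neqAle sn1.
by rewrite gerBl.
Qed.

(** For r < 1 the homothety of ratio r centred at an interior point maps K into its interior, so r^m
    |K| <= |K°|; let r tend to 1. *)
Lemma leb_convex_interior m (K : set 'rV[R]_m) : convex_body K ->
  leb m K° = leb m K.
Proof.
move=> [cK cvK [x0 Kx0]].
have mK := compact_measurable_rV cK.
have mK0 := open_measurable_rV (@open_interior _ K).
apply/eqP; rewrite eq_le; apply/andP; split.
  by apply: le_measure; rewrite ?inE//; exact: interior_subset.
have finK : leb m K \is a fin_num by rewrite ge0_fin_numE// leb_compact_fin.
have finK0 : leb m K° \is a fin_num.
  rewrite ge0_fin_numE//; apply: le_lt_trans (leb_compact_fin cK).
  by apply: le_measure; rewrite ?inE//; exact: interior_subset.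
have H (r : R) : 0 < r -> r < 1 -> r ^+ m * fine (leb m K) <= fine (leb m K°).
  move=> r0 r1; rewrite -ler_pdivlMl ?exprn_gt0//.
  rewrite -lee_fin EFinM !fineK// -exprVn -(leb_affine ((1 - r) *: x0))//.
  apply: le_measure; rewrite ?inE//.
    by rewrite -[X in measurable X]setTI; exact: (@measurable_affine R m r).
  move=> y Ky /=.
  rewrite addrC (_ : r = 1 - (1 - r)); last by rewrite subKr.
  rewrite [in X in X *: x0]subKr.
  apply: convex_interior => //; first by rewrite subr_gt0.
  by rewrite gerBl ltW.
rewrite -(fineK finK) -(fineK finK0) lee_fin.
have cv : (r ^+ m * fine (leb m K)) @[r --> 1^'-] --> 1 ^+ m * fine (leb m K).
  apply: cvg_at_left_filter; apply: cvgM; last exact: cvg_cst.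
  exact: exprn_continuous.
rewrite -[leLHS]mul1r -(expr1n _ m).
apply: (cvgr_to_le cv).
near=> r; apply: H; near: r; [|exact: nbhs_left_lt].
exact: nbhs_left_gt.
Unshelve. all: by end_near. Qed.

(** A small homothetic copy of the unit box around x fits in U, and the unit box has positive
    measure by induction on the dimension. *)
Lemma leb_open_gt0 m (U : set 'rV[R]_m) x : open U -> U x -> (0 < leb m U)%E.
Proof.
move=> oU Ux; have [e e0 He] := open_rVP oU Ux.
have mU := open_measurable_rV oU.
have mT : measurable ((fun y : 'rV[R]_m => (e / 2) *: y + x) @^-1` U : set (borel_rV R m)).
  by rewrite -[X in measurable X]setTI; exact: (@measurable_affine R m (e / 2)).
have : (0 < leb m ((fun y : 'rV[R]_m => ((e / 2) *: y + x)%R) @^-1` U))%E.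
  apply: (@lt_le_trans _ _ (leb m (box 1))); last first.
    apply: le_measure; rewrite ?inE//; first exact: measurable_box.
    move=> y /= Hy; apply: He => i; rewrite !mxE opprD addrCA subrr addr0 normrN normrM.
    rewrite gtr0_norm ?divr_gt0// (@le_lt_trans _ _ (e / 2 * 1))//.
      by rewrite ler_wpM2l// divr_ge0// ltW.
    by rewrite mulr1 ltr_pdivrMr// mulr_natr mulr2n ltrDl.
  clear; elim: m => [|m IH].
    by rewrite /leb /= diracE mem_set ?lte01// => -[].
  rewrite leb_snoc snoc_preimage_box product_measure1E//; last exact: measurable_box.
  rewrite mule_gt0//.
  change (0 < lebesgue_measure `[(- 1)%R, 1%R : R]%classic)%E.
  rewrite lebesgue_measure_itv /= lte_fin ifT; last by rewrite -subr_gt0; lra.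
  by rewrite -EFinB lte_fin; lra.
by rewrite leb_affine ?divr_gt0// pmule_rgt0// lte_fin exprn_gt0// invr_gt0 divr_gt0.
Qed.

End rV_topology.

(** * Smooth functions of one variable: exp(-1/x) and a smooth step *)

Section smooth1.
Context {R : realType}.
Implicit Types (f g : R -> R).

Fixpoint D1 k f := if k is k'.+1 then
  exists2 f', (forall x : R, is_derive x 1 f (f' x)) & D1 k' f' else True.

Definition smooth1 f := forall k, D1 k f.

Lemma is_derive_uniq f (x a b : R) : is_derive x 1 f a -> is_derive x 1 f b -> a = b.
Proof. by move=> [_ <-] [_ <-]. Qed.

Lemma D1S k f : D1 k.+1 f -> D1 k f.
Proof. by elim: k f => // k IH f [f' df /IH]; exists f'. Qed.

Lemma smooth1_derivative f : smooth1 f ->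
  exists2 f', (forall x : R, is_derive x 1 f (f' x)) & smooth1 f'.
Proof.
move=> sf; have [f' df _] := sf 1%N; exists f' => // k.
have [f'' df'' Df''] := sf k.+1.
by have -> : f' = f'' by apply/funext => x; exact: is_derive_uniq (df x) (df'' x).
Qed.

Lemma smooth1_cst c : smooth1 (cst c).
Proof.
move=> k; elim: k c => // k IH c; exists (cst 0) => // x.
exact: is_derive_cst.
Qed.

Lemma D1D k f g : D1 k f -> D1 k g -> D1 k (f \+ g).
Proof.
elim: k f g => // k IH f g [f' df Df] [g' dg Dg]; exists (f' \+ g'); last exact: IH.
by move=> x; exact: is_deriveD.
Qed.

Lemma D1M k f g : D1 k f -> D1 k g -> D1 k (f \* g).
Proof.
elim: k f g => // k IH f g Df Dg.
have Df1 := D1S Df; have Dg1 := D1S Dg.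
move: Df Dg => [f' df Df] [g' dg Dg].
exists ((f \* g') \+ (g \* f')); last by apply: D1D; exact: IH.
by move=> x; exact: is_deriveM.
Qed.

Lemma smooth1D f g : smooth1 f -> smooth1 g -> smooth1 (f \+ g).
Proof. by move=> sf sg k; exact: D1D. Qed.

Lemma smooth1M f g : smooth1 f -> smooth1 g -> smooth1 (f \* g).
Proof. by move=> sf sg k; exact: D1M. Qed.

Lemma is_derive_affine (r s x : R) : is_derive x 1 (fun x => r * x + s) r.
Proof.
have -> : (fun x => r * x + s) = (cst r * id + cst s : R -> R) by [].
apply: is_derive_eq; rewrite /GRing.scale /= /cst.
ring.
Qed.

Lemma smooth1_affine (r s : R) f : smooth1 f -> smooth1 (fun x => f (r * x + s)).
Proof.
move=> sf k; elim: k f sf => // k IH f sf.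
have [f' df sf'] := smooth1_derivative sf.
exists (fun x => f' (r * x + s) * r) => [x|].
  by apply: is_derive1_comp => //; exact: is_derive_affine.
apply: (@D1M _ _ (cst r)); first exact: IH.
exact: smooth1_cst.
Qed.

Lemma smooth1V f : (forall x, f x != 0) -> smooth1 f -> smooth1 (fun x => (f x)^-1).
Proof.
move=> f0 sf; elim => // k IH.
have [f' df sf'] := smooth1_derivative sf.
exists (fun x => -1 * ((f x)^-1 * (f x)^-1 * f' x)) => [x|].
  apply: (is_derive_eq (is_deriveV (f0 x) (df x))).
  by rewrite /GRing.scale /= mulN1r mulNr -exprVn expr2.
apply: (@D1M _ (cst (-1))); first exact: smooth1_cst.
apply: D1M; last exact: sf'.
exact: D1M.
Qed.

(* the derivative of [p(1/x) exp(-1/x)] is [q(1/x) exp(-1/x)], [q = X^2 (p - p')] *)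
Definition flat (p : {poly R}) (x : R) : R :=
  if 0 < x then p.[x^-1] * expR (- x^-1) else 0.

Lemma is_derive_quadratic f (C : R) : (forall h, `|f h| <= C * h ^+ 2) ->
  is_derive (0 : R) 1 f 0.
Proof.
move=> Hb.
have f0 : f 0 = 0 by apply/normr0_eq0/le_anti; rewrite normr_ge0 andbT (le_trans (Hb 0))// expr0n mulr0.
have C0 : 0 <= C by have := Hb 1; rewrite expr1n mulr1; apply: le_trans.
have cv : h^-1 *: ((f \o shift 0) (h *: (1 : R)) - f 0) @[h --> 0^'] --> (0 : R).
  apply/cvgr0Pnorm_lt => e e0; near=> h.
  have h0 : h != 0 by near: h; exact: nbhs_dnbhs_neq.
  rewrite f0 subr0 /= addr0 /GRing.scale /= mulr1 normrM normfV.
  rewrite ltr_pdivrMl ?normr_gt0//.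
  apply: le_lt_trans (Hb h) _.
  rewrite -real_normK ?num_real// expr2 mulrCA ltr_pM2l ?normr_gt0//.
  apply: (@le_lt_trans _ _ ((C + 1) * `|h|)); first by rewrite ler_wpM2r// lerDl.
  rewrite -ltr_pdivlMl ?ltr_wpDl// mulrC.
  near: h; apply: dnbhs0_lt; rewrite divr_gt0// ltr_wpDl//.
apply: DeriveDef; first by apply/cvg_ex; exists 0.
exact/cvg_lim.
Unshelve. all: by end_near. Qed.

(** Each monomial satisfies y^k <= k! exp y for y >= 0. *)
Lemma horner_le_expR (p : {poly R}) :
  exists2 C, 0 <= C & forall y, 0 <= y -> `|p.[y]| <= C * expR y.
Proof.
suff mono (c : R) k : exists C, 0 <= C /\ forall y, 0 <= y -> `|c * y ^+ k| <= C * expR y.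
  have [C HC] := choice (fun i : 'I_(size p) => mono p`_i i).
  exists (\sum_i C i); first by apply: sumr_ge0 => i _; case: (HC i).
  move=> y y0; rewrite horner_coef (le_trans (ler_norm_sum _ _ _))// mulr_suml.
  by apply: ler_sum => i _; case: (HC i) => _; exact.
exists (`|c| * k`!%:R); split => [|y y0]; first by rewrite mulr_ge0.
rewrite normrM -mulrA ler_wpM2l// ger0_norm ?exprn_ge0//.
case: k => [|k]; first by rewrite expr0 fact0 mul1r (le_trans _ (expR_ge1Dx y))// lerDl.
have := expR_ge1Dxn k y0; set e := expR y.
rewrite -ler_pdivrMl ?ltr0n ?fact_gt0// mulrC => H.
by apply: le_trans H; rewrite lerDr.
Qed.

Lemma is_derive_flat (p : {poly R}) (x : R) :
  is_derive x 1 (flat p) (flat ('X ^+ 2 * (p - p^`())) x).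
Proof.
rewrite {2}/flat; case: (ltgtP 0 x) => [x0|x0|x0].
- apply: (@near_eq_is_derive _ _ _ ((fun y => p.[y^-1]) * (fun y => expR (- y^-1)))).
    near=> y; rewrite /flat ifT//; near: y; exact: lt_nbhsr.
  have dV : is_derive x 1 (fun y : R => y^-1) (- x ^- 2).
    apply: (is_derive_eq (@is_deriveV _ id _ 1 1 (lt0r_neq0 x0) _)).
    by rewrite /GRing.scale /= mulr1.
  have dN : is_derive x 1 (fun y : R => - y^-1) (x ^- 2).
    by apply: is_derive_eq; rewrite opprK.
  have dp : is_derive x 1 (fun y : R => p.[y^-1]) (p^`().[x^-1] * - x ^- 2).
    exact: (@is_derive1_comp _ (horner p) (fun y => y^-1)).
  have de : is_derive x 1 (fun y : R => expR (- y^-1)) (expR (- x^-1) * x ^- 2).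
    exact: (@is_derive1_comp _ expR (fun y => - y^-1)).
  apply: is_derive_eq; rewrite !(hornerE, hornerXn) -exprVn.
  transitivity (p.[x^-1] * (expR (- x^-1) * x^-1 ^+ 2)
    + expR (- x^-1) * (p^`().[x^-1] * - x^-1 ^+ 2)); first by [].
  ring.
- apply: (@near_eq_is_derive _ _ _ (cst 0)).
  near=> y; rewrite /flat ifF//; apply/negbTE; rewrite -leNgt ltW//.
  near: y; exact: lt_nbhsl.
(* At 0, the domination of y^2 p(y) by exp y, read at y = 1/h, says that [flat p h] is O(h^2), so
   the derivative there is 0. *)
- have [C C0 HC] := horner_le_expR ('X ^+ 2 * p).
  have Hb h : `|flat p h| <= C * h ^+ 2.
    rewrite /flat; case: ifPn => [h0|_]; last by rewrite normr0 mulr_ge0// sqr_ge0.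
    have hV : 0 <= h^-1 by rewrite invr_ge0 ltW.
    have := HC _ hV; rewrite !(hornerE, hornerXn) normrM ger0_norm ?exprn_ge0//.
    rewrite normrM expRN (ger0_norm (_ : 0 <= (expR _)^-1)) ?invr_ge0 ?expR_ge0//.
    rewrite ler_pdivrMr ?expR_gt0// -ler_pdivlMl ?exprn_gt0 ?invr_gt0// => H.
    apply: le_trans H _; rewrite exprVn invrK.
    suff : h ^+ 2 * (C * expR h^-1) <= C * h * h * expR h^-1 by [].
    by have -> : h ^+ 2 * (C * expR h^-1) = C * h * h * expR h^-1 by ring.
  by rewrite -x0; exact: (@is_derive_quadratic _ C).
Unshelve. all: by end_near. Qed.

Lemma smooth1_flat p : smooth1 (flat p).
Proof.
move=> k; elim: k p => // k IH p.
by exists (flat ('X ^+ 2 * (p - p^`()))) => // x; exact: is_derive_flat.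
Qed.

Definition ramp (x : R) : R := flat 1 x.

Lemma rampE x : 0 < x -> ramp x = expR (- x^-1).
Proof. by move=> x0; rewrite /ramp /flat x0 hornerC mul1r. Qed.

Lemma ramp_le0 x : x <= 0 -> ramp x = 0.
Proof. by move=> x0; rewrite /ramp /flat ltNge x0. Qed.

Lemma ramp_ge0 x : 0 <= ramp x.
Proof.
by case: (leP x 0) => x0; [rewrite ramp_le0|rewrite rampE// expR_ge0].
Qed.

Lemma ramp_gt0 x : 0 < x -> 0 < ramp x.
Proof. by move=> x0; rewrite rampE// expR_gt0. Qed.

Lemma ramp_le1 x : ramp x <= 1.
Proof.
case: (leP x 0) => x0; first by rewrite ramp_le0.
by rewrite rampE// -expR0 ler_expR oppr_le0 invr_ge0 ltW.
Qed.

Lemma smooth1_ramp : smooth1 ramp.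
Proof. exact: smooth1_flat. Qed.

Lemma cvg_ramp x : 0 < x -> ramp (k.+1%:R * x) @[k --> \oo] --> (1 : R).
Proof.
move=> x0.
have -> : (fun k => ramp (k.+1%:R * x)) = (fun k => expR (- (x^-1 * k.+1%:R^-1))).
  by apply/funext => k; rewrite rampE ?mulr_gt0// invfM mulrC.
rewrite -[X in _ --> X]expR0 -[X in _ --> expR X]oppr0.
apply: continuous_cvg; first exact: continuous_expR.
 apply: cvgN; rewrite -[X in _ --> X](mulr0 x^-1).
by apply: cvgM; [exact: cvg_cst|exact: cvg_harmonic].
Qed.

(* a smooth function equal to 0 on [x <= 0] and to 1 on [x >= 1] *)
Definition step (x : R) : R := ramp x * (ramp x + ramp (1 - x))^-1.

Lemma step_den_gt0 x : 0 < ramp x + ramp (1 - x).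
Proof.
case: (ltP 0 x) => x0; first by rewrite ltr_pwDl ?ramp_gt0// ramp_ge0.
by rewrite ltr_pwDr ?ramp_ge0// ramp_gt0//; lra.
Qed.

Lemma smooth1_step : smooth1 step.
Proof.
apply: smooth1M; first exact: smooth1_ramp.
apply: smooth1V => [x|]; first exact: lt0r_neq0 (step_den_gt0 x).
apply: smooth1D; first exact: smooth1_ramp.
have -> : (fun x => ramp (1 - x)) = (fun x => ramp (-1 * x + 1)).
  by apply/funext => x; rewrite mulN1r addrC.
by apply: smooth1_affine; exact: smooth1_ramp.
Qed.

Lemma step_le0 x : x <= 0 -> step x = 0.
Proof. by move=> x0; rewrite /step ramp_le0// mul0r. Qed.

Lemma step_ge1 x : 1 <= x -> step x = 1.
Proof.
move=> x1; rewrite /step (ramp_le0 (_ : 1 - x <= 0)) ?subr_le0// addr0 mulfV//.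
by rewrite gt_eqF// ramp_gt0//; lra.
Qed.

Lemma step_ge0 x : 0 <= step x.
Proof. by rewrite /step divr_ge0// ?ramp_ge0// ltW// step_den_gt0. Qed.

Lemma step_le1 x : step x <= 1.
Proof. by rewrite /step ler_pdivrMr ?step_den_gt0// mul1r lerDl ramp_ge0. Qed.

End smooth1.

(** * A class of smooth functions on R^m generated by functions of one coordinate *)

Section pol.
Context {R : realType}.

(* The subalgebra of smooth functions generated by the functions of one
   coordinate: total differentiability is immediate in it. *)
Inductive pol m : ('rV[R]_m -> R) -> Prop :=
| pol_coord i f : smooth1 f -> pol (fun x => f (x 0 i))
| pol_cst c : pol (cst c)
| polD f g : pol f -> pol g -> pol (f + g)
| polM f g : pol f -> pol g -> pol (f * g).

Lemma pol_eq m (f g : 'rV[R]_m -> R) : pol f -> f =1 g -> pol g.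
Proof. by move=> pf /funext <-. Qed.

Lemma polZ m c (f : 'rV[R]_m -> R) : pol f -> pol (fun x => c * f x).
Proof. by move=> pf; exact: (polM (pol_cst m c)). Qed.

Lemma polB m (f g : 'rV[R]_m -> R) : pol f -> pol g -> pol (fun x => f x - g x).
Proof.
move=> pf pg; apply: (pol_eq (polD pf (polZ (-1) pg))) => x.
by rewrite -[in RHS]mulN1r.
Qed.

Lemma pol_translate m (u : 'rV[R]_m) f : pol f -> pol (fun x => f (x + u)).
Proof.
elim => {f} [i f sf|c|f g _ pf _ pg|f g _ pf _ pg].
- apply: (@pol_eq _ (fun x => f (1 * x 0 i + u 0 i))) => [|x]; last by rewrite mxE mul1r.
  by apply: (pol_coord i (f := fun t => f (1 * t + u 0 i))); exact: smooth1_affine.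
- exact: pol_cst.
- exact: (polD pf pg).
- exact: (polM pf pg).
Qed.

Lemma differentiable_pol m (f : 'rV[R]_m -> R) x : pol f -> differentiable f x.
Proof.
elim => {f} [i f sf|c|f g _ pf _ pg|f g _ pf _ pg].
- have [f' df _] := smooth1_derivative sf.
  apply: (@differentiable_comp _ _ _ _ (fun x : 'rV[R]_m => x 0 i) f).
    exact: differentiable_coord.
  by apply/derivable1_diffP; have [] := df (x 0 i).
- exact: differentiable_cst.
- exact: differentiableD.
- exact: differentiableM.
Qed.

Lemma derivable_pol m (f : 'rV[R]_m -> R) x v : pol f -> derivable f x v.
Proof. by move=> pf; apply: diff_derivable; exact: differentiable_pol. Qed.

Lemma continuous_pol m (f : 'rV[R]_m -> R) : pol f -> continuous f.
Proof.
by move=> pf x; apply: differentiable_continuous; exact: differentiable_pol.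
Qed.

Lemma derive_coord m (f f' : R -> R) (x v : 'rV[R]_m) i :
  (forall t : R, is_derive t 1 f (f' t)) ->
  'D_v (fun x : 'rV[R]_m => f (x 0 i)) x = f' (x 0 i) * v 0 i.
Proof.
move=> df; have dif : differentiable f (x 0 i).
  by apply/derivable1_diffP; have [] := df (x 0 i).
rewrite (_ : (fun x : 'rV[R]_m => f (x 0 i)) = f \o (fun x : 'rV[R]_m => x 0 i))//.
have dc : differentiable (fun x : 'rV[R]_m => x 0 i : R) x by exact: differentiable_coord.
rewrite deriveE; last exact: differentiable_comp.
rewrite diff_comp//= -!deriveE//.
have -> : 'D_v (fun x : 'rV[R]_m => x 0 i) x = v 0 i.
  rewrite deriveE//.
  have lin : linear (fun x : 'rV[R]_m => x 0 i : R).
    by move=> a u w; rewrite !mxE.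
  pose L : {linear 'rV[R]_m -> R} := HB.pack (fun x : 'rV[R]_m => x 0 i : R)
    (GRing.isLinear.Build _ _ _ _ _ lin).
  by rewrite (@diff_lin _ _ _ L)//; exact: coord_continuous.
have [_ dv] := df (x 0 i).
rewrite deriveE// -[v 0 i in LHS]mulr1 -[_ * _ in LHS]/(v 0 i *: (1 : R)).
by rewrite linearZ /= -deriveE// dv mulrC.
Qed.

Lemma pol_derive m (v : 'rV[R]_m) f : pol f -> pol (fun x => 'D_v f x).
Proof.
elim => {f} [i f sf|c|f g pf0 pf pg0 pg|f g pf0 pf pg0 pg].
- have [f' df sf'] := smooth1_derivative sf.
  apply: (@pol_eq _ (fun x => v 0 i * f' (x 0 i))) => [|x].
    by apply: polZ; exact: pol_coord.
  by rewrite (derive_coord _ _ _ df) mulrC.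
- apply: (@pol_eq _ (cst 0)) => [|x]; first exact: pol_cst.
  by rewrite derive_cst.
- apply: (pol_eq (polD pf pg)) => x.
  by rewrite deriveD//; exact: derivable_pol.
- apply: (pol_eq (polD (polM pf0 pg) (polM pg0 pf))) => x.
  by rewrite deriveM//; exact: derivable_pol.
Qed.

(** [pol] consists of continuous functions and is stable under directional derivatives, so every C^k
    class follows by induction on k. *)
Lemma smooth_pol m (f : 'rV[R]_m -> R) : pol f -> smooth f.
Proof.
move=> pf k; elim: k f pf => [|k IH] f pf; split => //; try exact: continuous_pol.
move=> i; split => [x|]; first exact: derivable_pol.
by apply: IH; exact: pol_derive.
Qed.

Lemma derive_sum_coord m (f : 'rV[R]_m -> R) x v : pol f ->
  'D_v f x = \sum_i v 0 i * 'D_(delta_mx 0 i) f x.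
Proof.
move=> pf; have df := differentiable_pol x pf.
rewrite deriveE// {1}(row_sum_delta v) linear_sum /=.
by apply: eq_bigr => i _; rewrite linearZ /= -deriveE.
Qed.

Lemma derive0_out m (f : 'rV[R]_m -> R) (Q : set 'rV[R]_m) v x :
  closed Q -> (forall y, ~ Q y -> f y = 0) -> ~ Q x -> 'D_v f x = 0.
Proof.
move=> cQ Hf nQx.
transitivity ('D_v (cst 0 : 'rV[R]_m -> R) x); last by rewrite derive_cst.
apply: near_eq_derive.
have : nbhs x (~` Q) by apply: open_nbhs_nbhs; split => //; exact: closed_openC.
by apply: filterS => y nQy; rewrite Hf.
Qed.

Lemma compact_support_bounded m (f : 'rV[R]_m -> R) (Q : set 'rV[R]_m) :
  continuous f -> compact Q -> (forall y, ~ Q y -> f y = 0) ->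
  exists2 M, 0 <= M & forall x, `|f x| <= M.
Proof.
move=> cf cQ Hf.
have : compact (f @` Q).
  by apply: continuous_compact => //; exact: continuous_subspaceT.
move=> /compact_bounded[M [_ HM]]; exists (`|M| + 1); first by rewrite addr_ge0.
move=> x; have [Qx|nQx] := pselect (Q x); last by rewrite Hf// normr0 addr_ge0.
have lt1 : M < `|M| + 1 by rewrite (le_lt_trans (ler_norm M))// ltrDl.
by apply: (HM _ lt1); exists x.
Qed.

Lemma measurable_pol m (f : 'rV[R]_m -> R) : pol f ->
  measurable_fun setT (f : borel_rV R m -> R).
Proof. by move=> pf; apply: continuous_measurable_rV; exact: continuous_pol. Qed.

End pol.

(** * Integrability criteria *)

Section integrability.
Context d (T : measurableType d) (R : realType) (mu : {measure set T -> \bar R}).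

Lemma integral_indicT (A : set T) : measurable A ->
  (\int[mu]_x (\1_A x : R)%:E = mu A)%E.
Proof. by move=> mA; rewrite integral_indic// setIT. Qed.

Lemma integrable_indic_fin (A : set T) : measurable A -> (mu A < +oo)%E ->
  mu.-integrable setT (EFin \o (\1_A : T -> R)).
Proof.
move=> mA fA; apply/integrableP; split.
  by apply/measurable_EFinP; exact: measurable_indic.
under eq_integral do rewrite /= ger0_norm//.
by rewrite integral_indic// setIT.
Qed.

Lemma integrable_bounded_support (f : T -> R) (A : set T) (M : R) :
  measurable_fun setT f -> measurable A -> (mu A < +oo)%E ->
  (forall x, `|f x| <= M) -> (forall x, ~ A x -> f x = 0) ->
  mu.-integrable setT (EFin \o f).
Proof.
move=> mf mA fA fM f0.
apply: (@le_integrable _ _ _ _ _ _ _ (fun x => (M%:E * (\1_A x : R)%:E)%E)) => //.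
- exact/measurable_EFinP.
- move=> x _ /=; rewrite lee_fin normrM (ger0_norm (_ : 0 <= \1_A x))//.
  rewrite indicE; have [xA|/f0->] := pselect (A x); last by rewrite normr0 mulr_ge0.
  by rewrite mem_set// mulr1 (le_trans (fM x))// ler_norm.
- by apply: integrableZl => //; exact: integrable_indic_fin.
Qed.

Lemma Rintegral_indicl (D : set T) (f : T -> R) :
  (\int[mu]_(x in D) f x = \int[mu]_x (\1_D x * f x))%R.
Proof.
rewrite Rintegral_mkcond; apply: eq_Rintegral => x _.
by rewrite patchE indicE; case: ifPn => _; rewrite ?mul1r// mul0r.
Qed.

Lemma integrable_indicl (D : set T) (f : T -> R) : measurable D ->
  mu.-integrable setT (EFin \o f) ->
  mu.-integrable setT (EFin \o (fun x => \1_D x * f x)).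
Proof.
move=> mD intf; have [/measurable_EFinP mf _] := integrableP _ _ _ intf.
apply: (@le_integrable _ _ _ _ _ measurableT _ (EFin \o f)) => //.
  by apply/measurable_EFinP; apply: measurable_funM => //; exact: measurable_indic.
move=> x _ /=; rewrite lee_fin normrM indicE.
by case: (_ \in _); rewrite /= ?normr1 ?mul1r// normr0 mul0r.
Qed.

End integrability.

Lemma cvge0_lt {R : realType} (T : Type) (F : set_system T) {FF : Filter F}
    (f : T -> \bar R) (e : R) : f @ F --> (0 : \bar R)%E -> 0 < e ->
  \forall x \near F, (f x < e%:E)%E.
Proof.
move=> cf e0.
have h : nbhs (0 : \bar R)%E [set y : \bar R | (y < e%:E)%E].
  by apply: open_ereal_lt'; rewrite lte_fin.
exact: cf h.
Qed.

(** * L^1 approximation of indicators of Borel sets by test functions *)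

Section approximation.
Context {R : realType}.

Definition testf m (U : set 'rV[R]_m) (phi : 'rV[R]_m -> R) :=
  [/\ pol phi, forall x, 0 <= phi x <= 1 &
      exists Q, [/\ compact Q, Q `<=` U & forall x, ~ Q x -> phi x = 0]].

Lemma testf_le m (U V : set 'rV[R]_m) phi : U `<=` V -> testf U phi -> testf V phi.
Proof.
move=> UV [pp p01 [Q [cQ QU HQ]]]; split => //; exists Q; split => //.
exact: subset_trans UV.
Qed.

Lemma testf_out m (U : set 'rV[R]_m) phi x : testf U phi -> ~ U x -> phi x = 0.
Proof. by move=> [_ _ [Q [_ QU HQ]]] nUx; apply: HQ => /QU. Qed.

Lemma testf0 m (U : set 'rV[R]_m) : testf U (cst 0).
Proof.
split; [exact: pol_cst|by move=> x; rewrite lexx ler01|].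
by exists set0; split => //; exact: compact0.
Qed.

Lemma testfM m (U : set 'rV[R]_m) f g : testf U f -> pol g ->
  (forall x, 0 <= g x <= 1) -> testf U (f * g).
Proof.
move=> [pf f01 [Q [cQ QU HQ]]] pg g01; split; [exact: polM| |].
  move=> x; have /andP[f0 f1] := f01 x; have /andP[g0 g1] := g01 x.
  by rewrite mulr_ge0//= mulr_ile1.
exists Q; split => // x nQ.
transitivity (f x * g x) => //; by rewrite HQ// mul0r.
Qed.

Lemma testfU m (U : set 'rV[R]_m) f g : testf U f -> testf U g ->
  testf U (fun x => 1 - (1 - f x) * (1 - g x)).
Proof.
move=> [pf f01 [Q [cQ QU HQ]]] [pg g01 [S [cS SU HS]]]; split.
- apply: (polB (pol_cst _ 1)); apply: polM; exact: (polB (pol_cst _ 1)).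
- move=> x; have /andP[f0 f1] := f01 x; have /andP[g0 g1] := g01 x.
  apply/andP; split; last by rewrite gerBl mulr_ge0// subr_ge0.
  by rewrite subr_ge0 mulr_ile1 ?subr_ge0// gerBl.
exists (Q `|` S); split; [exact: compactU|by move=> x [/QU|/SU]|].
move=> x nQS; rewrite HQ ?HS ?subr0 ?mulr1 ?subrr//.
  by move=> Sx; apply: nQS; right.
by move=> Qx; apply: nQS; left.
Qed.

(** The inclusion in U matters as much as the L^1 closeness: the approximants must be admissible in
    a test field supported in U. *)
Definition approx m (U : set 'rV[R]_m) (A : set (borel_rV R m)) :=
  [/\ measurable A, A `<=` U & forall e : R, 0 < e -> exists2 phi, testf U phi &
    (\int[leb m]_x `|\1_A x - phi x|%:E < e%:E)%E].

Variables (m : nat) (U : set 'rV[R]_m).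
Hypothesis oU : open U.
Hypothesis finU : (leb m U < +oo)%E.

Let mU : measurable (U : set (borel_rV R m)) := open_measurable_rV oU.

Lemma measurable_testf V (phi : 'rV[R]_m -> R) : testf V phi ->
  measurable_fun setT (phi : borel_rV R m -> R).
Proof. by case=> pp _ _; exact: measurable_pol. Qed.

(** Dominated convergence, with the indicator of U as dominating function; it is integrable since U
    has finite measure. *)
Lemma approx_lim (A : set (borel_rV R m)) (phi : nat -> 'rV[R]_m -> R) :
  measurable A -> A `<=` U -> (forall k, testf U (phi k)) ->
  (forall x, phi k x @[k --> \oo] --> (\1_A x : R)) -> approx U A.
Proof.
move=> mA AU tphi cphi; split => // e e0.
pose F k (x : borel_rV R m) : \bar R := `|\1_A x - phi k x|%:E.
have mF k : measurable_fun setT (F k).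
  apply/measurable_EFinP; apply: measurableT_comp => //.
  by apply: measurable_funB; [exact: measurable_indic|exact: measurable_testf (tphi k)].
have cF x : F k x @[k --> \oo] --> (0 : \bar R)%E.
  rewrite /F; apply: cvg_EFin; first exact: nearW.
  rewrite [fine \o _](_ : _ = (fun k => `|\1_A x - phi k x|))//.
  have := cvg_norm (cvgB (cvg_cst (\1_A x : R)) (cphi x)).
  by rewrite subrr normr0; apply; exact: _.
have FU k x : setT x -> (`|F k x| <= (\1_U x)%:E)%E.
  move=> _; rewrite /F /= normr_id lee_fin.
  have [Ux|nUx] := pselect (U x); last first.
    rewrite (testf_out (tphi k) nUx) !indicE memNset ?subr0 ?normr0//.
    by move=> /AU.
  rewrite !indicE (mem_set Ux); have [_ /(_ x)/andP[p0 p1] _] := tphi k.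
  by rewrite ?mulr1n; case: (_ \in _); rewrite ?mulr1n ?mulr0n ler_norml; apply/andP; split; lra.
have iU : (leb m).-integrable setT (EFin \o (\1_U : borel_rV R m -> R)).
  exact: integrable_indic_fin.
have [_ _] := @dominated_convergence _ _ _ (leb m) setT measurableT F (cst 0)
  (EFin \o (\1_U : borel_rV R m -> R)) mF (measurable_cst _) (aeW _ (fun x _ => cF x)) iU
  (aeW _ (fun x k Tx => FU k x Tx)).
rewrite integral_cst// mul0e => cI.
have : \forall k \near \oo, (\int[leb m]_x F k x < e%:E)%E.
  exact: cvge0_lt cI e0.
by move=> /filter_ex [k Hk]; exists (phi k).
Qed.

Let tri (a b c d : R) : 0 <= a -> 0 <= b -> a <= 1 -> b <= 1 -> 0 <= c -> 0 <= d ->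
  c <= 1 -> d <= 1 -> `|a * b - c * d| <= `|a - c| + `|b - d|.
Proof.
move=> a0 b0 a1 b1 c0 d0 c1 d1.
have -> : a * b - c * d = (a - c) * b + c * (b - d) by ring.
apply: le_trans (ler_normD _ _) _; rewrite !normrM lerD//.
  by rewrite ler_piMr// ger0_norm.
by rewrite ler_piMl// ger0_norm.
Qed.

(** A common frame for union and difference: it is enough to combine approximants of A and B into
    one of D whose pointwise error is at most the sum of the two errors. *)
Lemma approx2 (A B D : set (borel_rV R m)) : approx U A -> approx U B ->
  measurable D -> D `<=` U ->
  (forall f g, testf U f -> testf U g -> exists2 h, testf U h &
    forall x, `|(\1_D x : R) - h x| <= `|\1_A x - f x| + `|\1_B x - g x|) ->
  approx U D.
Proof.
move=> [mA AU HA] [mB BU HB] mD DU H; split => // e e0.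
have e20 : 0 < e / 2 by rewrite divr_gt0.
have [f tf If] := HA _ e20; have [g tg Ig] := HB _ e20.
have [h th Hh] := H f g tf tg; exists h => //.
have mfun X k : measurable X -> testf U k ->
    measurable_fun setT (fun x : borel_rV R m => `|\1_X x - k x|%:E).
  move=> mX tk; apply/measurable_EFinP; apply: measurableT_comp => //.
  by apply: measurable_funB; [exact: measurable_indic|exact: measurable_testf tk].
apply: (@le_lt_trans _ _ (\int[leb m]_x (`|\1_A x - f x|%:E + `|\1_B x - g x|%:E))%E).
  apply: ge0_le_integral => //.
  - exact: (mfun _ _ mD th).
  - exact: emeasurable_funD (mfun _ _ mA tf) (mfun _ _ mB tg).
  - by move=> x _; rewrite -EFinD lee_fin.
rewrite ge0_integralD//; first by rewrite (splitr e) EFinD lteD.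
  exact: mfun.
exact: mfun.
Qed.

Lemma approx_setU (A B : set (borel_rV R m)) : approx U A -> approx U B ->
  approx U (A `|` B).
Proof.
move=> aA aB; have [mA AU _] := aA; have [mB BU _] := aB.
apply: (approx2 aA aB); [exact: measurableU|by move=> x [/AU|/BU]|].
move=> f g tf tg; exists (fun x => 1 - (1 - f x) * (1 - g x)); first exact: testfU.
move=> x; have [_ /(_ x)/andP[f0 f1] _] := tf; have [_ /(_ x)/andP[g0 g1] _] := tg.
have -> : (\1_(A `|` B) x : R) = 1 - (1 - \1_A x) * (1 - \1_B x).
  rewrite !indicE in_setU; case: (x \in A); case: (x \in B); rewrite /=; ring.
have i01 X : 0 <= (\1_X x : R) <= 1.
  by rewrite indicE; case: (_ \in _); rewrite /= ?lexx ler01.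
have /andP[A0 A1] := i01 A; have /andP[B0 B1] := i01 B.
have -> : 1 - (1 - \1_A x) * (1 - \1_B x) - (1 - (1 - f x) * (1 - g x)) =
  (1 - f x) * (1 - g x) - (1 - \1_A x) * (1 - \1_B x) :> R by ring.
apply: le_trans (tri _ _ _ _ _ _ _ _) _; rewrite ?subr_ge0 ?gerBl//.
have E (a b : R) : 1 - a - (1 - b) = b - a by ring.
by rewrite !E.
Qed.

Lemma approx_setD (A B : set (borel_rV R m)) : approx U A -> approx U B ->
  approx U (A `\` B).
Proof.
move=> aA aB; have [mA AU _] := aA; have [mB BU _] := aB.
apply: (approx2 aA aB); [exact: measurableD|by move=> x [/AU]|].
move=> f g tf tg.
have [pg g01 _] := tg.
exists (f * (fun x => 1 - g x)).
  apply: testfM => //; first exact: (polB (pol_cst _ 1)).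
  by move=> x; have /andP[g0 g1] := g01 x; rewrite subr_ge0 g1 gerBl.
move=> x; have [_ /(_ x)/andP[f0 f1] _] := tf; have /andP[g0 g1] := g01 x.
have -> : (\1_(A `\` B) x : R) = \1_A x * (1 - \1_B x).
  rewrite !indicE in_setD; case: (x \in A); case: (x \in B); rewrite /=; ring.
have i01 X : 0 <= (\1_X x : R) <= 1.
  by rewrite indicE; case: (_ \in _); rewrite /= ?lexx ler01.
have /andP[A0 A1] := i01 A; have /andP[B0 B1] := i01 B.
apply: le_trans (tri _ _ _ _ _ _ _ _) _; rewrite ?subr_ge0 ?gerBl//.
have E (a b : R) : 1 - a - (1 - b) = - (a - b) by ring.
by rewrite E normrN.
Qed.

Lemma approx_set0 : approx U set0.
Proof.
apply: (approx_lim (phi := fun=> cst 0)) => //.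
  by move=> _; exact: testf0.
by move=> x; rewrite indic0; exact: cvg_cst.
Qed.

Lemma approx_close (A : set (borel_rV R m)) : measurable A -> A `<=` U ->
  (forall e : R, 0 < e -> exists2 B, approx U B & B `<=` A /\ (leb m (A `\` B) < e%:E)%E) ->
  approx U A.
Proof.
move=> mA AU H; split => // e e0.
have e20 : 0 < e / 2 by rewrite divr_gt0.
have [B [mB BU HB] [BA lB]] := H _ e20.
have [f tf If] := HB _ e20; exists f => //.
have mAB : measurable (A `\` B) by exact: measurableD.
have mf1 : measurable_fun setT (fun x : borel_rV R m => `|\1_B x - f x|%:E).
  apply/measurable_EFinP; apply: measurableT_comp => //.
  by apply: measurable_funB; [exact: measurable_indic|exact: measurable_testf tf].
have mf2 : measurable_fun setT (fun x : borel_rV R m => (\1_(A `\` B) x : R)%:E).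
  by apply/measurable_EFinP; exact: measurable_indic.
apply: (@le_lt_trans _ _ (\int[leb m]_x ((\1_(A `\` B) x : R)%:E + `|\1_B x - f x|%:E))%E).
  apply: ge0_le_integral => //.
  - apply/measurable_EFinP; apply: measurableT_comp => //.
    by apply: measurable_funB; [exact: measurable_indic|exact: measurable_testf tf].
  - exact: emeasurable_funD.
  move=> x _; rewrite -EFinD lee_fin.
  have -> : \1_A x - f x = \1_(A `\` B) x + (\1_B x - f x) :> R.
    rewrite addrA; congr (_ - _); rewrite !indicE in_setD.
    case: (boolP (x \in B)) => [/set_mem/BA xA|_]; first by rewrite mem_set// add0r.
    by rewrite andbT addr0.
  by apply: le_trans (ler_normD _ _) _; rewrite ger0_norm.
rewrite ge0_integralD//.
by rewrite (splitr e) EFinD lteD// integral_indic// setIT.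
Qed.

(** Finite unions are approximable, and because U has finite measure the part of the union that they
    miss has measure tending to 0. *)
Lemma approx_bigcup (A : nat -> set (borel_rV R m)) : (forall k, approx U (A k)) ->
  approx U (\bigcup_k A k).
Proof.
move=> aA; pose B k := \big[setU/set0]_(i < k) A i.
have aB k : approx U (B k).
  rewrite /B; elim: k => [|k IH]; first by rewrite big_ord0; exact: approx_set0.
  by rewrite big_ord_recr /=; exact: approx_setU.
have mA : measurable (\bigcup_k A k) by apply: bigcupT_measurable => k; case: (aA k).
have mB k : measurable (B k) by case: (aB k).
have AU : \bigcup_k A k `<=` U by move=> x [k _]; case: (aA k) => _ + _; exact.
have BA k : B k `<=` \bigcup_k A k.
  by rewrite /B -bigcup_mkord; apply: bigcup_sub => i _; exact: bigcup_sup.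
have fA : (leb m (\bigcup_k A k) < +oo)%E.
  by apply: le_lt_trans finU; apply: le_measure; rewrite ?inE.
apply: approx_close => // e e0.
have cv : leb m ((\bigcup_k A k) `\` B k) @[k --> \oo] --> (0 : \bar R)%E.
  rewrite -[X in _ --> X](measure0 (leb m)).
  have <- : \bigcap_k ((\bigcup_k A k) `\` B k) = set0.
    apply/seteqP; split => // x H; have [[i _ Ai] _] := H 0%N I.
    have [_] := H i.+1 I; apply.
    by rewrite /B -bigcup_mkord; exists i => //=.
  apply: (@nonincreasing_cvg_mu _ _ _ (leb m)) => //.
  - by apply: le_lt_trans fA; apply: le_measure; rewrite ?inE//; exact: measurableD.
  - by move=> k; exact: measurableD.
  - by apply: bigcapT_measurable => k; exact: measurableD.
  - move=> i j ij; apply/subsetPset; apply: setDS.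
    by rewrite /B; exact: subset_bigsetU.
have : \forall k \near \oo, (leb m ((\bigcup_k A k) `\` B k) < e%:E)%E.
  exact: cvge0_lt cv e0.
by move=> /filter_ex [k Hk]; exists (B k).
Qed.

Lemma approx_cube (c : 'rV[R]_m) r : ccube c r `<=` U -> approx U (cube c r).
Proof.
move=> cU.
have ccc : cube c r `<=` ccube c r by move=> x Hx i; exact: ltW.
(* A product of two ramps vanishing outside the i-th side of the cube and tending to 1 inside it;
   the product over i is supported in the closed cube and tends pointwise to the indicator of the
   open one. *)
pose q k i (t : R) := ramp (k.+1%:R * (t - c 0 i + r)) * ramp (k.+1%:R * (c 0 i + r - t)).
have q01 k i t : 0 <= q k i t <= 1.
  by rewrite mulr_ge0 ?ramp_ge0//= mulr_ile1 ?ramp_ge0// ramp_le1.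
have sq k i : smooth1 (q k i).
  apply: smooth1M.
    have -> : (fun t => ramp (k.+1%:R * (t - c 0 i + r))) =
        (fun t => ramp (k.+1%:R * t + (k.+1%:R * (r - c 0 i)))).
      by apply/funext => t; congr ramp; ring.
    by apply: smooth1_affine; exact: smooth1_ramp.
  have -> : (fun t => ramp (k.+1%:R * (c 0 i + r - t))) =
      (fun t => ramp (- k.+1%:R * t + (k.+1%:R * (r + c 0 i)))).
    by apply/funext => t; congr ramp; ring.
  by apply: smooth1_affine; exact: smooth1_ramp.
pose phi k (x : 'rV[R]_m) := \prod_i q k i (x 0 i).
apply: (@approx_lim _ phi); first exact: measurable_cube.
- exact: subset_trans cU.
- move=> k; split.
  + rewrite /phi; elim: (index_enum _) => [|i s IH].
      apply: (pol_eq (pol_cst _ 1)) => x; by rewrite big_nil.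
    apply: (pol_eq (polM (pol_coord i (sq k i)) IH)) => x.
    by rewrite big_cons.
  + move=> x; apply/andP; split; last by apply: prodr_ile1 => i _; exact: q01.
    by apply: prodr_ge0 => i _; case/andP: (q01 k i (x 0 i)).
  + exists (ccube c r); split => //; first exact: compact_ccube.
    move=> x /existsNP[i /negP]; rewrite -ltNge => Hi.
    rewrite /phi (bigD1 i)//= /q; move: Hi; rewrite real_ltr_normr ?num_real//.
    case/orP => Hi.
      rewrite (ramp_le0 (_ : _ * (x 0 i - _ + r) <= 0)) ?mul0r// pmulr_rle0//; lra.
    rewrite (ramp_le0 (_ : _ * (c 0 i + r - x 0 i) <= 0)) ?(mulr0,mul0r)// pmulr_rle0//; lra.
- move=> x; have [Hx|Hx] := pselect (cube c r x); last first.
    rewrite indicE memNset//= [X in X @ _ --> _](_ : _ = cst 0); first exact: cvg_cst.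
    apply/funext => k; move/existsNP: Hx => [i /negP]; rewrite -leNgt => Hi.
    rewrite /phi (bigD1 i)//= /q; move: Hi; rewrite real_ler_normr ?num_real//.
    case/orP => Hi.
      rewrite (ramp_le0 (_ : _ * (x 0 i - _ + r) <= 0)) ?mul0r// pmulr_rle0//; lra.
    rewrite (ramp_le0 (_ : _ * (c 0 i + r - x 0 i) <= 0)) ?(mulr0,mul0r)// pmulr_rle0//; lra.
  rewrite indicE mem_set//= /phi.
  have cq i : q k i (x 0 i) @[k --> \oo] --> (1 : R).
    have := Hx i; rewrite ltr_distl => /andP[h1 h2].
    rewrite -[X in _ --> X](mulr1 1); apply: cvgM; apply: cvg_ramp; lra.
  elim: (index_enum _) => [|i s IH].
    by under eq_fun do rewrite big_nil; exact: cvg_cst.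
  have -> : (fun k => \prod_(j <- i :: s) q k j (x 0 j)) =
      (fun k => q k i (x 0 i) * \prod_(j <- s) q k j (x 0 j)).
    by apply/funext => k; rewrite big_cons.
  by rewrite -[X in _ --> X](mulr1 1); exact: cvgM.
Qed.

Lemma approx_open (V : set 'rV[R]_m) : open V -> V `<=` U -> approx U V.
Proof.
move=> /open_bigcup_cube[G [-> HG]] VU; apply: approx_bigcup => k.
case: (HG k) => [->|[c [r [-> crV]]]]; first exact: approx_set0.
by apply: approx_cube; exact: subset_trans VU.
Qed.

(** The sets whose trace on U is approximable form a sigma-algebra, and they include the preimages
    of open rays under coordinates, whose traces are open. These generate the Borel sets. *)
Lemma approx_borel (A : set (borel_rV R m)) : measurable A -> A `<=` U -> approx U A.
Proof.
move=> mA AU; rewrite -(setIidl AU).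
suff H : @coord_sets R m `<=` [set A | approx U (A `&` U)] /\
   sigma_algebra setT [set A : set 'rV[R]_m | approx U (A `&` U)].
  by case: H => H1 H2; exact: (smallest_sub H2 H1 mA).
have aU : approx U U by exact: approx_open.
have HC X : approx U (X `&` U) -> approx U (~` X `&` U).
  move=> aX; have -> : ~` X `&` U = U `\` (X `&` U).
    by rewrite setDIr setDv setU0 setIC.
  exact: approx_setD.
have HU (F : nat -> set 'rV[R]_m) : (forall k, approx U (F k `&` U)) ->
    approx U ((\bigcup_k F k) `&` U).
  by move=> aF; rewrite setI_bigcupl; exact: approx_bigcup.
have S0 : approx U (set0 `&` U) by rewrite set0I; exact: approx_set0.
split; last by split => // B aB; rewrite setTD; exact: HC.
move=> _ [i [B mB ->]] /=.
have mB' : (@RGenOInfty.G R).-sigma.-measurable B.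
  by rewrite -RGenOInfty.measurableE.
suff H : (@RGenOInfty.G R).-sigma.-measurable `<=`
    [set B | approx U ((fun x : 'rV[R]_m => x 0 i) @^-1` B `&` U)] by exact: H mB'.
apply: smallest_sub; first split => //.
- by move=> X /= aX; rewrite setTD preimage_setC; exact: HC.
- by move=> F /= aF; rewrite preimage_bigcup; exact: HU.
move=> _ [a ->] /=; apply: approx_open; last exact: subIsetr.
apply: openI => //; apply: open_comp; last exact: itv_open_ends_open.
by move=> x _; exact: coord_continuous.
Qed.

End approximation.

(** * Fubini on R^n x R, translations, and derivatives of translated integrals *)

Section fubini_snoc.
Context {R : realType}.
Variable n : nat.
Local Notation lam := (@lebesgue_measure R).
Implicit Type f : borel_rV R n.+1 -> \bar R.

Lemma measurable_comp_snoc f : measurable_fun setT f ->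
  measurable_fun setT (fun p : borel_rV R n * measurableTypeR R => f (snoc_rV p)).
Proof.
by move=> mf; apply: (measurableT_comp mf); exact: measurable_snoc_rV.
Qed.

Lemma measurable_snocl t : measurable_fun setT
  (fun y : borel_rV R n => snoc_rV (y : 'rV[R]_n, t) : borel_rV R n.+1).
Proof.
apply: (measurableT_comp (@measurable_snoc_rV R n)).
exact: (measurable_fun_pair (@measurable_id _ _ _) (measurable_cst _)).
Qed.

Lemma ge0_integral_snoc f : measurable_fun setT f -> (forall x, 0 <= f x)%E ->
  (\int[leb n.+1]_x f x = \int[leb n \x lam]_p f (snoc_rV p))%E.
Proof.
move=> mf f0.
exact: (@ge0_integral_pushforward _ _ _ _ R _ (@measurable_snoc_rV R n)
  (leb n \x lam)%E setT f measurableT mf (fun x _ => f0 x)).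
Qed.

Lemma tonelli_snoc1 f : measurable_fun setT f -> (forall x, 0 <= f x)%E ->
  (\int[leb n.+1]_x f x = \int[leb n]_y \int[lam]_t f (snoc_rV (y, t)))%E.
Proof.
move=> mf f0; rewrite ge0_integral_snoc//.
exact: (fubini_tonelli1 _ (measurable_comp_snoc mf) (fun p => f0 _)).
Qed.

Lemma tonelli_snoc f : measurable_fun setT f -> (forall x, 0 <= f x)%E ->
  (\int[leb n.+1]_x f x = \int[lam]_t \int[leb n]_y f (snoc_rV (y, t)))%E.
Proof.
move=> mf f0; rewrite ge0_integral_snoc//.
exact: (fubini_tonelli2 _ (measurable_comp_snoc mf) (fun p => f0 _)).
Qed.

Lemma integrable_snoc f : (leb n.+1).-integrable setT f ->
  (leb n \x lam)%E.-integrable setT (fun p => f (snoc_rV p)).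
Proof.
move=> /integrableP[mf fi]; apply/integrableP; split; first exact: measurable_comp_snoc.
rewrite ge0_integral_snoc// in fi; exact: measurableT_comp.
Qed.

Lemma integral_snoc f : (leb n.+1).-integrable setT f ->
  (\int[leb n.+1]_x f x = \int[leb n \x lam]_p f (snoc_rV p))%E.
Proof.
move=> intf; have [mf _] := integrableP _ _ _ intf.
exact: (@integral_pushforward _ _ _ _ R _ (@measurable_snoc_rV R n)
  (leb n \x lam)%E setT f mf (integrable_snoc intf) measurableT).
Qed.

Lemma fubini_snoc1 f : (leb n.+1).-integrable setT f ->
  (\int[leb n.+1]_x f x = \int[leb n]_y \int[lam]_t f (snoc_rV (y, t)))%E.
Proof.
move=> intf; rewrite integral_snoc//.
exact/esym/(integral12_prod_meas1 (integrable_snoc intf)).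
Qed.

Lemma fubini_snoc f : (leb n.+1).-integrable setT f ->
  (\int[leb n.+1]_x f x = \int[lam]_t \int[leb n]_y f (snoc_rV (y, t)))%E.
Proof.
move=> intf; rewrite integral_snoc//.
exact/esym/(integral21_prod_meas1 (integrable_snoc intf)).
Qed.

End fubini_snoc.

Section translation.
Context {R : realType}.
Variables (m : nat) (u : 'rV[R]_m).

Let T (x : borel_rV R m) : borel_rV R m := (x : 'rV[R]_m) + u.

Let mT : measurable_fun setT T.
Proof.
have := @measurable_affine R m 1 u.
by under eq_fun do rewrite scale1r.
Qed.

Lemma leb_translate (A : set (borel_rV R m)) : measurable A ->
  leb m ((fun x : 'rV[R]_m => x + u) @^-1` A) = leb m A.
Proof.
move=> mA; have := leb_affine u ltr01 mA.
rewrite invr1 expr1n mul1e => <-; congr (leb m _).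
by apply/seteqP; split => x; rewrite /= scale1r.
Qed.

Lemma measurable_translate (f : borel_rV R m -> \bar R) : measurable_fun setT f ->
  measurable_fun setT (fun x : borel_rV R m => f ((x : 'rV[R]_m) + u)).
Proof. by move=> mf; exact: (measurableT_comp mf mT). Qed.

Lemma ge0_integral_translate (f : borel_rV R m -> \bar R) : measurable_fun setT f ->
  (forall x, 0 <= f x)%E ->
  (\int[leb m]_x f ((x : 'rV[R]_m) + u)%R = \int[leb m]_x f x)%E.
Proof.
move=> mf f0.
have <- := @ge0_integral_pushforward _ _ _ _ R _ mT (leb m) setT f measurableT mf (fun x _ => f0 x).
apply: (@eq_measure_integral _ _ _ _ (leb m) (pushmeasure (leb m) mT)) => A mA _.
exact: leb_translate.
Qed.

Lemma integral_translate (f : borel_rV R m -> \bar R) : (leb m).-integrable setT f ->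
  (\int[leb m]_x f ((x : 'rV[R]_m) + u)%R = \int[leb m]_x f x)%E.
Proof.
move=> /integrableP[mf fi].
have iT : (leb m).-integrable setT (f \o T).
  apply/integrableP; split; first exact: measurable_translate.
  rewrite (@ge0_integral_translate (abse \o f))//; first exact: measurableT_comp.
  by move=> x; exact: abse_ge0.
have <- := @integral_pushforward _ _ _ _ R _ mT (leb m) setT f mf iT measurableT.
apply: (@eq_measure_integral _ _ _ _ (leb m) (pushmeasure (leb m) mT)) => A mA _.
exact: leb_translate.
Qed.

End translation.

Lemma continuous_translate (R : realType) m (w : 'rV[R]_m) :
  continuous (fun x : 'rV[R]_m => x + w).
Proof.
move=> x; apply: (@cvgD _ _ _ (nbhs x) _ idfun (cst w) x w); first exact: cvg_id.
exact: cvg_cst.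
Qed.

Lemma continuous_shift (R : realType) m (f : 'rV[R]_m -> R) (w : 'rV[R]_m) :
  continuous f -> continuous (fun x : 'rV[R]_m => f (x + w)).
Proof.
by move=> cf x; apply: continuous_comp; [exact: continuous_translate|exact: cf].
Qed.

Section derive_translate.
Context {R : realType}.
Variables (m : nat) (phi : 'rV[R]_m -> R) (Q : set 'rV[R]_m) (v : 'rV[R]_m).
Hypotheses (cphi : continuous phi) (dphi : forall x, derivable phi x v)
  (cD : continuous (fun x => 'D_v phi x)).
Hypotheses (cQ : compact Q) (phiQ : forall x, ~ Q x -> phi x = 0).

Lemma is_derive_along (x : 'rV[R]_m) (r : R) :
  is_derive r 1 (fun r : R => phi (x + r *: v)) ('D_v phi (x + r *: v)).
Proof.
have E : (fun h : R => h^-1 *: (((fun r => phi (x + r *: v)) \o shift r) (h *: (1 : R))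
      - phi (x + r *: v))) =
    (fun h : R => h^-1 *: ((phi \o shift (x + r *: v)) (h *: v) - phi (x + r *: v))).
  apply/funext => h /=; congr (_ *: (phi _ - _)).
  by rewrite [h *: 1]mulr1 scalerDl addrCA.
by apply: DeriveDef; [rewrite /derivable E; exact: dphi|rewrite /derive E].
Qed.

Lemma is_derive_line (x : 'rV[R]_m) (s : R) :
  is_derive s 1 (fun s : R => phi (x - s *: v)) (- 'D_v phi (x - s *: v)).
Proof.
have := @is_derive1_comp _ _ _ s _ _ (is_derive_along x (- s)) (is_deriveNid s 1).
rewrite mulrN1 scaleNr; congr is_derive.
by apply/funext => r /=; rewrite scaleNr.
Qed.

Lemma integrable_line (B : set (borel_rV R m)) (s : R) : measurable B ->
  (leb m).-integrable B (EFin \o (fun x => phi (x - s *: v))).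
Proof.
move=> mB; apply: (@integrableS _ _ _ _ setT) => //.
have [M M0 HM] := compact_support_bounded cphi cQ phiQ.
have [N N0 QN] := compact_box cQ.
apply: (@integrable_bounded_support _ _ _ _ _ (box (N + `|s| * \sum_i `|v 0 i|)) M) => //.
- exact: (continuous_measurable_rV (continuous_shift (w := - (s *: v)) cphi)).
- exact: measurable_box.
- exact: leb_box_fin.
- move=> x nx; apply: phiQ => /QN Hx; apply: nx => i.
  have := Hx i; rewrite !mxE => H.
  rewrite -[x in `|x|](subrK (s * v 0 i)) (le_trans (ler_normD _ _))// lerD//.
  by rewrite normrM ler_wpM2l// (bigD1 i)//= lerDl sumr_ge0.
Qed.

(** Differentiation under the integral sign. Compact support yields the integrable majorant. *)
Lemma is_derive_integral_line (B : set (borel_rV R m)) (s : R) : measurable B ->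
  is_derive s 1 (fun s : R => \int[leb m]_(x in B) phi ((x : 'rV[R]_m) - s *: v))
    (- \int[leb m]_(x in B) 'D_v phi ((x : 'rV[R]_m) - s *: v)).
Proof.
move=> mB.
have DQ x : ~ Q x -> 'D_v phi x = 0.
  by apply: (derive0_out _ (compact_closed _ cQ)) => //; exact: norm_hausdorff.
have [M M0 HM] := compact_support_bounded cD cQ DQ.
have [N N0 QN] := compact_box cQ.
(* For t within distance 1 of s, every translate of Q by t v stays in the box of radius [r], so [G]
   dominates the derivative uniformly in t. *)
pose r := N + (`|s| + 1) * \sum_i `|v 0 i|.
pose G (x : borel_rV R m) : R := M * \1_(box r) x.
have dline (t : R) (y : borel_rV R m) : partial1of2 (fun s (x : borel_rV R m) => phi ((x : 'rV[R]_m) - s *: v)) t y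
    = - 'D_v phi ((y : 'rV[R]_m) - t *: v).
  by rewrite partial1of2E; have [_ ->] := is_derive_line y t.
have Is : s \in `]s - 1, s + 1[ by rewrite in_itv /=; apply/andP; split; lra.
have intG : (leb m).-integrable B (EFin \o G).
  apply: (@integrableS _ _ _ _ setT) => //.
  apply: (@integrable_bounded_support _ _ _ _ _ (box r) M) => //.
  - by apply: measurable_funM => //; apply: measurable_indic; exact: measurable_box.
  - exact: measurable_box.
  - exact: leb_box_fin.
  - move=> x; rewrite /G indicE normrM ger0_norm// ger0_norm//.
    by case: (_ \in _); rewrite /= ?mulr1// mulr0.
  - by move=> x nx; rewrite /G indicE memNset// mulr0.
have G0 y : 0 <= G y by rewrite /G mulr_ge0.
have GB (t : R) (y : borel_rV R m) : `]s - 1, s + 1[%classic t -> B y ->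
   `|partial1of2 (fun s (x : borel_rV R m) => phi ((x : 'rV[R]_m) - s *: v)) t y| <= G y.
  rewrite /= in_itv /= => /andP[t1 t2] _; rewrite dline normrN /G indicE.
  have [by_|nby] := pselect (box r y); first by rewrite mem_set// mulr1.
  rewrite DQ ?normr0 ?mulr_ge0// => /QN H; apply: nby => i.
  have := H i; rewrite !mxE => Hi.
  rewrite -[(y : 'rV[R]_m) 0 i](subrK (t * v 0 i)) (le_trans (ler_normD _ _))// lerD//.
  rewrite normrM ler_pM//; last by rewrite (bigD1 i)//= lerDl sumr_ge0.
  rewrite ler_norml; have := ler_norm s; have := ler_norm (- s); rewrite normrN.
  by move=> h1 h2; apply/andP; split; lra.
have der (t : R) (y : borel_rV R m) : `]s - 1, s + 1[%classic t -> B y ->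
    derivable (fun s : R => phi ((y : 'rV[R]_m) - s *: v)) t 1.
  by move=> _ _; have [+ _] := is_derive_line y t.
have dd := @derivable_under_integral R _ _ (leb m) _ B mB s (s - 1) (s + 1) Is
  (fun t _ => @integrable_line B t mB) der G G0 intG GB.
have de := @differentiation_under_integral R _ _ (leb m) _ B mB s (s - 1) (s + 1) Is
  (fun t _ => @integrable_line B t mB) der G G0 intG GB.
apply: DeriveDef => //; rewrite -derive1E de.
under eq_Rintegral do rewrite dline.
have iD : (leb m).-integrable B (EFin \o (fun x : borel_rV R m => 'D_v phi ((x : 'rV[R]_m) - s *: v))).
  apply: (@le_integrable _ _ _ _ _ mB _ (EFin \o G)) => //.
    apply/measurable_EFinP; apply: measurable_funTS.
    exact: (continuous_measurable_rV (continuous_shift (w := - (s *: v)) cD)).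
  move=> y By /=; rewrite lee_fin [leRHS]ger0_norm//.
  by have := GB s y Is By; rewrite dline normrN.
rewrite -[RHS]mulN1r -RintegralZl//.
by apply: eq_Rintegral => y _; rewrite mulN1r.
Qed.

End derive_translate.

(** * Slices at fixed height and horizontal translations *)

Section slice.
Context {R : realType}.
Variable n : nat.

Lemma snoc_rVD (y w : 'rV[R]_n) (t s : R) :
  snoc_rV (y, t) + snoc_rV (w, s) = snoc_rV (y + w, t + s).
Proof.
apply/rowP => i; rewrite [LHS]mxE; case: (unliftP ord_max i) => [j|] ->.
  by rewrite !snoc_rV_lift mxE.
by rewrite !snoc_rV_last.
Qed.

Lemma snoc_rVZ (y : 'rV[R]_n) (t s : R) :
  s *: snoc_rV (y, t) = snoc_rV (s *: y, s * t).
Proof.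
apply/rowP => i; rewrite [LHS]mxE; case: (unliftP ord_max i) => [j|] ->.
  by rewrite !snoc_rV_lift mxE.
by rewrite !snoc_rV_last.
Qed.

Definition slice (B : set 'rV[R]_n.+1) (t : R) : set (borel_rV R n) :=
  [set y : 'rV[R]_n | B (snoc_rV (y, t))].

Lemma sliceC B t : slice (~` B) t = ~` slice B t.
Proof. by []. Qed.

Lemma measurable_slice (B : set (borel_rV R n.+1)) t : measurable B ->
  measurable (slice B t).
Proof.
by move=> mB; rewrite -[X in measurable X]setTI; exact: (measurable_snocl (n := n) t).
Qed.

Lemma measurable_leb_slice (B : set (borel_rV R n.+1)) : measurable B ->
  measurable_fun setT (fun t : measurableTypeR R => leb n (slice B t)).
Proof.
move=> mB.
have mA' : measurable ((fun p => snoc_rV p : borel_rV R n.+1) @^-1` B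
     : set (borel_rV R n * measurableTypeR R)).
  by rewrite -[X in measurable X]setTI; exact: measurable_snoc_rV.
have := @measurable_fun_ysection _ _ _ _ R (leb n : {sigma_finite_measure set (borel_rV R n) -> \bar R}) _ mA'.
congr measurable_fun; apply/funext => t; rewrite /=; congr (leb n _).
by apply/seteqP; split => y; rewrite /ysection /= inE.
Qed.

Lemma leb_slice (B : set (borel_rV R n.+1)) : measurable B ->
  leb n.+1 B = (\int[lebesgue_measure]_t leb n (slice B t))%E.
Proof.
move=> mB; transitivity (\int[leb n.+1]_x (\1_B x : R)%:E)%E.
  by rewrite integral_indic// setIT.
have mI : measurable_fun setT (fun x : borel_rV R n.+1 => (\1_B x : R)%:E).
  by apply/measurable_EFinP; exact: measurable_indic.
have I0 (x : borel_rV R n.+1) : (0 <= (\1_B x : R)%:E)%E by rewrite lee_fin.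
rewrite (tonelli_snoc mI I0).
apply: eq_integral => t _.
transitivity (\int[leb n]_y (\1_(slice B t) y : R)%:E)%E; first by [].
by rewrite integral_indic ?setIT//; exact: measurable_slice.
Qed.

End slice.

Section horizontal.
Context {R : realType}.
Variables (n : nat) (K : set 'rV[R]_n).
Hypothesis K_body : convex_body K.
Variable M : R.
Hypotheses (M0 : 0 < M) (KM : K `<=` box M).
Variable B : set (borel_rV R n.+1).
Hypotheses (mB : measurable B) (BK : B `<=` cyl K° setT).
Variables (p q : R).
Local Notation lam := (@lebesgue_measure R).

Let mK : measurable (K° : set (borel_rV R n)) := open_measurable_rV (@open_interior _ K).

Lemma open_cyl_interior : open (cyl K° `]p, q[).
Proof.
by apply: open_cyl; [exact: open_interior|exact: itv_open_ends_open].
Qed.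

Lemma leb_cyl_interior_fin : (leb n.+1 (cyl K° `]p, q[) < +oo)%E.
Proof.
have cK : compact K by case: K_body.
have cC := compact_cyl cK (@segment_compact R p q).
apply: le_lt_trans (leb_compact_fin cC).
apply: le_measure; rewrite ?inE.
- exact: open_measurable_rV open_cyl_interior.
- exact: compact_measurable_rV.
rewrite !cylE => x [/interior_subset Kx px]; split => //.
exact: subset_itv_oo_cc px.
Qed.

(* the points of [B] that leave [B], but not the cylinder, when translated by
   the horizontal vector [w] *)
Definition exitset (w : 'rV[R]_n) : set (borel_rV R n.+1) :=
  [set x : 'rV[R]_n.+1 | [/\ B x, `]p, q[%classic (rlast x), K° (rinit x + w) &
     ~ B (x + snoc_rV (w, 0))]].

Let A : set (borel_rV R n * borel_rV R n.+1) := [set z | exitset z.1 z.2].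

Let mfst : measurable_fun setT (fun z : borel_rV R n * borel_rV R n.+1 => z.1).
Proof. exact: measurable_fst. Qed.

Let msnd : measurable_fun setT (fun z : borel_rV R n * borel_rV R n.+1 => z.2).
Proof. exact: measurable_snd. Qed.

Lemma measurable_exit : measurable A.
Proof.
have m1 : measurable_fun setT (fun z : borel_rV R n * borel_rV R n.+1 =>
    rlast z.2 : measurableTypeR R).
  by apply: (measurableT_comp (@measurable_coord R n.+1 ord_max) msnd).
have m2 : measurable_fun setT (fun z : borel_rV R n * borel_rV R n.+1 =>
    (rinit (z.2 : 'rV[R]_n.+1) + (z.1 : 'rV[R]_n)) : borel_rV R n).
  apply: measurable_fun_rV => // i.
  under eq_fun do rewrite !mxE.
  apply: measurable_funD.
    exact: (measurableT_comp (@measurable_coord R n.+1 (lift ord_max i)) msnd).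
  exact: (measurableT_comp (@measurable_coord R n i) mfst).
have m3 : measurable_fun setT (fun z : borel_rV R n * borel_rV R n.+1 =>
    ((z.2 : 'rV[R]_n.+1) + snoc_rV (z.1 : 'rV[R]_n, 0)) : borel_rV R n.+1).
  apply: measurable_fun_rV => // i.
  under eq_fun do rewrite mxE.
  apply: measurable_funD.
    exact: (measurableT_comp (@measurable_coord R n.+1 i) msnd).
  case: (unliftP ord_max i) => [j|] ->.
    under eq_fun do rewrite snoc_rV_lift.
    exact: (measurableT_comp (@measurable_coord R n j) mfst).
  under eq_fun do rewrite snoc_rV_last.
  exact: measurable_cst.
have -> : A = ((fun z => z.2) @^-1` B `&` (fun z => rlast z.2) @^-1` `]p, q[%classic) `&`
    ((fun z => (rinit (z.2 : 'rV[R]_n.+1) + (z.1 : 'rV[R]_n))) @^-1` K° `&`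
     (fun z => ((z.2 : 'rV[R]_n.+1) + snoc_rV (z.1 : 'rV[R]_n, 0))) @^-1` (~` B)).
  by apply/seteqP; split => [[w x] [? ? ? ?]|[w x] [[? ?] [? ?]]]; [split; split|split].
apply: measurableI; apply: measurableI.
- by rewrite -[X in measurable X]setTI; exact: msnd.
- by rewrite -[X in measurable X]setTI; exact: m1.
- by rewrite -[X in measurable X]setTI; exact: m2.
- by rewrite -[X in measurable X]setTI; apply: m3 => //; exact: measurableC.
Qed.

Lemma measurable_exitset w : measurable (exitset w).
Proof.
have := @measurable_xsection _ _ _ _ A w measurable_exit.
congr measurable; apply/seteqP; split => x; by rewrite /xsection /= inE.
Qed.

(** Exchange the order of integration: for fixed x, count the vectors w that move x out of B within
    the cylinder. *)
Lemma integral_leb_exitset :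
  (\int[leb n]_w leb n.+1 (exitset w) =
   \int[lam]_(t in `]p, q[) (leb n (slice B t) * leb n (K° `\` slice B t)))%E.
Proof.
have mA := measurable_exit.
have mIA : measurable_fun setT (fun z => (\1_A z : R)%:E).
  by apply/measurable_EFinP; exact: measurable_indic.
transitivity (\int[leb n]_w \int[leb n.+1]_x (\1_A (w, x) : R)%:E)%E.
  apply: eq_integral => w _.
  transitivity (\int[leb n.+1]_x (\1_(exitset w) x : R)%:E)%E.
    by rewrite integral_indic ?setIT//; exact: measurable_exitset.
  by apply: eq_integral => x _; rewrite !indicE; congr ((_ : bool)%:R%:E); apply/idP/idP => /set_mem H; apply/mem_set.
rewrite (@fubini_tonelli _ _ _ _ R (leb n) (leb n.+1) (fun z => (\1_A z : R)%:E))//.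
pose D := ((fun x : borel_rV R n.+1 => rlast x) @^-1` `]p, q[%classic) `&` B.
have mD : measurable D.
  apply: measurableI => //; rewrite -[X in measurable X]setTI.
  by apply: (@measurable_coord R n.+1 ord_max) => //; exact: measurable_itv.
pose h (t : R) := leb n (K° `\` slice B t).
have mh : measurable_fun setT (fun t : measurableTypeR R => h t).
  have mC : measurable ((cyl K° setT : set (borel_rV R n.+1)) `\` B).
    apply: measurableD => //; apply: open_measurable_rV.
    by apply: open_cyl; [exact: open_interior|exact: openT].
  have := measurable_leb_slice mC; congr measurable_fun; apply/funext => t.
  congr (leb n _); rewrite /slice cylE; apply/seteqP; split => y /=.
    by rewrite rinit_snoc => -[[]].
  by rewrite rinit_snoc => -[].
(* For fixed x in [D], the admissible w form a translate, by the horizontal part of x, of the part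
   of the interior of K missed by the slice through x; its measure therefore depends only on the
   height. *)
transitivity (\int[leb n.+1]_x ((\1_D x : R)%:E * h (rlast x)))%E.
  apply: eq_integral => x _.
  have [Dx|nDx] := pselect (D x); last first.
    rewrite [in RHS]indicE (memNset nDx) mul0e integral0_eq// => w _.
    by rewrite indicE memNset// => -[Bx px _ _]; apply: nDx.
  rewrite [in RHS]indicE (mem_set Dx) mul1e.
  rewrite /h -(leb_translate (rinit x)); last first.
    by apply: measurableD => //; exact: measurable_slice.
  set S := (_ @^-1` _); have mS : measurable (S : set (borel_rV R n)).
    rewrite -[X in measurable X]setTI.
    have := @measurable_affine R n 1 (rinit x); under eq_fun do rewrite scale1r.
    by apply => //; apply: measurableD => //; exact: measurable_slice.
  transitivity (\int[leb n]_w (\1_S w : R)%:E)%E; last exact: integral_indicT.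
  apply: eq_integral => w _; congr EFin; rewrite !indicE; congr ((_ : bool)%:R).
  apply/idP/idP => /set_mem H; apply/mem_set; move: H.
    case=> /= _ _ Kx nB; split; first by rewrite addrC.
    move=> Bx; apply: nB; move: Bx; rewrite /slice /=; congr (B _).
    by rewrite -[x in RHS](rinitK x) snoc_rVD addr0 addrC.
  case=> /= Kx nB; case: Dx => px Bx; split => //; first by rewrite addrC.
  move=> Bxw; apply: nB; move: Bxw; rewrite /slice /=; congr (B _).
  by rewrite -[x in LHS](rinitK x) snoc_rVD addr0 addrC.
have mI : measurable_fun setT (fun x : borel_rV R n.+1 => ((\1_D x : R)%:E * h (rlast x))%E).
  apply: emeasurable_funM; first by apply/measurable_EFinP; exact: measurable_indic.
  exact: (measurableT_comp mh (@measurable_coord R n.+1 ord_max)).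
have I0 (x : borel_rV R n.+1) : (0 <= (\1_D x : R)%:E * h (rlast x))%E.
  by rewrite mule_ge0// lee_fin.
rewrite (tonelli_snoc mI I0).
rewrite [RHS]integral_mkcond; apply: eq_integral => t _.
under eq_integral do rewrite rlast_snoc.
have E (y : 'rV[R]_n) : (\1_D (snoc_rV (y, t)) : R) = \1_(`]p, q[%classic) t * \1_(slice B t) y.
  rewrite !indicE -natrM mulnb; congr (_%:R); congr nat_of_bool.
  apply/idP/andP => [/set_mem[]|[/set_mem h1 /set_mem h2]].
    by rewrite /= rlast_snoc => h1 h2; split; apply/mem_set.
  by apply/mem_set; split => //; rewrite /= rlast_snoc.
under eq_integral do rewrite E.
rewrite patchE; case: ifPn => tpq; last first.
  by rewrite integral0_eq// => y _; rewrite indicE (negbTE tpq) mul0r mul0e.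
under eq_integral do rewrite indicE tpq mul1r.
have mS := measurable_slice t mB.
rewrite ge0_integralZr//; first by rewrite integral_indicT.
by apply/measurable_EFinP; exact: measurable_indic.
Qed.


Lemma exitset_out (w : 'rV[R]_n) : ~ box (2 * M) w -> exitset w = set0.
Proof.
move=> nw; apply/seteqP; split => // x [Bx _ Kxw _]; apply: nw => i.
have := KM (interior_subset Kxw) i; rewrite mxE => h1.
have := BK Bx; rewrite cylE => -[/interior_subset/KM/(_ i) h2 _].
rewrite -[w 0 i](addKr (rinit x 0 i)) mulr_natl mulr2n addrC.
by rewrite (le_trans (ler_normD _ _))// lerD// normrN.
Qed.

Let G := (\int[lam]_(t in `]p, q[) (leb n (slice B t) * leb n (K° `\` slice B t)))%E.
Let W := leb n (box (2 * M)).

Lemma exists_exitset : (0 < G)%E -> exists2 w, box (2 * M) w &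
  (G <= 2%:E * W * leb n.+1 (exitset w))%E.
Proof.
move=> G0; apply: contrapT => /forall2NP H.
have GE : G = (\int[leb n]_(w in box (2 * M)) leb n.+1 (exitset w))%E.
  rewrite /G -integral_leb_exitset [RHS]integral_mkcond; apply: eq_integral => w _.
  rewrite patchE; case: ifPn => // /negP nw.
  by rewrite exitset_out ?measure0// => bw; apply: nw; rewrite inE.
have W0 : (0 < W)%E.
  have [_ _ [x0 Kx0]] := K_body.
  apply: lt_le_trans (leb_open_gt0 (@open_interior _ K) Kx0) _.
  apply: le_measure; rewrite ?inE//; first exact: measurable_box.
  move=> x /interior_subset/KM Hx i; apply: le_trans (Hx i) _.
  by rewrite mulr_natl mulr2n lerDl ltW.
have Wfin : W \is a fin_num by rewrite (ge0_fin_numE (ltW W0)); exact: leb_box_fin.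
have mE : measurable_fun (box (2 * M) : set (borel_rV R n)) (fun w => leb n.+1 (exitset w)).
  apply: measurable_funTS.
  have := @measurable_fun_xsection _ _ _ _ R (leb n.+1 : {sigma_finite_measure set (borel_rV R n.+1) -> \bar R}) _ measurable_exit.
  congr measurable_fun; apply/funext => w /=; congr (leb n.+1 _).
  by apply/seteqP; split => x; rewrite /xsection /= inE.
have mbox := @measurable_box R n (2 * M).
have Gfin : G \is a fin_num.
  rewrite ge0_fin_numE ?ltW// GE.
  apply: (@le_lt_trans _ _ (\int[leb n]_(w in box (2 * M)) leb n.+1 (cyl K° `]p, q[))%E).
    apply: ge0_le_integral => // w bw; apply: le_measure; rewrite ?inE.
    - exact: measurable_exitset.
    - exact: open_measurable_rV open_cyl_interior.
    move=> x [Bx px _ _]; rewrite cylE; split => //.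
    by have := BK Bx; rewrite cylE => -[].
  have Vfin : leb n.+1 (cyl K° `]p, q[) \is a fin_num.
    by rewrite ge0_fin_numE ?measure_ge0 ?leb_cyl_interior_fin.
  rewrite integral_cst//; exact: (lte_mul_pinfty (measure_ge0 _ _) Vfin (leb_box_fin n (2 * M))).
(* If every w fell short of half the average, integrating over the box would give 2 W G <= W G,
   which is absurd as W and G are positive and finite. The factor 2 is there to make the
   contradiction strict. *)
have : (2%:E * W * G <= W * G)%E.
  rewrite {1}GE -ge0_integralZl//; last by apply: mule_ge0; [rewrite lee_fin|exact: ltW].
  apply: (@le_trans _ _ (\int[leb n]_(w in box (2 * M)) G)%E); last first.
    by rewrite integral_cst// muleC.
  apply: ge0_le_integral => //.
  - by move=> w _; apply: mule_ge0 => //; apply: mule_ge0; [rewrite lee_fin|exact: ltW].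
  - exact: (measurable_funeM _ mE).
  - by move=> w bw; case: (H w) => // /negP; rewrite -ltNge => /ltW.
move: W0 G0; rewrite -(fineK Wfin) -(fineK Gfin) -!EFinM !lte_fin lee_fin => W0 G0.
by apply/negP; rewrite -ltNge -mulrA ltr_pMl ?mulr_gt0// ltr1n.
Qed.

Lemma derive_shift m (f : 'rV[R]_m -> R) (u v x : 'rV[R]_m) :
  'D_v (fun y => f (y + u)) x = 'D_v f (x + u).
Proof.
have E : (fun h : R => h^-1 *: (((fun y => f (y + u)) \o shift x) (h *: v) - f (x + u)))
    = (fun h : R => h^-1 *: ((f \o shift (x + u)) (h *: v) - f (x + u))).
  by apply/funext => h /=; rewrite addrA.
by rewrite /derive E.
Qed.

(** Translating a bump function concentrated on the exit set by w decreases its integral over B; by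
    the mean value theorem, at some intermediate translate the derivative in direction w has a large
    integral over B. *)
Lemma horizontal_field : exists w phi,
  [/\ box (2 * M) w, testf (cyl K° `]p, q[) phi &
   (G <= 4%:E * W * (\int[leb n.+1]_(x in B) 'D_(snoc_rV (w, 0)) phi x)%R%:E)%E].
Proof.
have Gge0 : (0 <= G)%E by rewrite /G; apply: integral_ge0 => t _; rewrite mule_ge0.
move: Gge0; rewrite le_eqVlt => /orP[/eqP G0|/exists_exitset[w bw Gw]].
  exists 0, (cst 0); split; [|exact: testf0|].
    by move=> i; rewrite mxE normr0 mulr_ge0// ltW.
  rewrite -G0; under eq_Rintegral do rewrite derive_cst.
  by rewrite /Rintegral integral0 mule0.
set v := snoc_rV (w, 0).
(* Base points that remain in the interior of K after translation by w. By convexity the whole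
   segment between the two positions stays in the interior, which keeps the intermediate translates
   of the bump function admissible. *)
pose Kw := [set y : 'rV[R]_n | K° y /\ K° (y + w)].
pose U := cyl Kw `]p, q[.
have oU : open U.
  apply: open_cyl; last exact: itv_open_ends_open.
  apply: openI; first exact: open_interior.
  apply: open_comp; last exact: open_interior.
  by move=> x _; exact: continuous_translate.
have EU : exitset w `<=` U.
  move=> x [Bx px Kxw _]; rewrite /U cylE; split => //; split => //.
  by have := BK Bx; rewrite cylE => -[].
have UK : U `<=` cyl K° `]p, q[.
  by rewrite /U !cylE => x [[]].
have finU : (leb n.+1 U < +oo)%E.
  apply: le_lt_trans leb_cyl_interior_fin.
  apply: le_measure; rewrite ?inE//; apply: open_measurable_rV => //.
  exact: open_cyl_interior.
have mE := measurable_exitset w.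
set Ex := exitset w in EU mE Gw.
have mU := open_measurable_rV oU.
have fA : (leb n.+1 Ex < +oo)%E.
  by apply: le_lt_trans finU; apply: le_measure; rewrite ?inE.
have [_ _ HA] := approx_borel oU finU mE EU.
have Afin : leb n.+1 Ex \is a fin_num by rewrite ge0_fin_numE ?measure_ge0.
have [A0|A0] := eqVneq (leb n.+1 Ex) 0%E.
  exists 0, (cst 0); split; [|exact: testf0|].
    by move=> i; rewrite mxE normr0 mulr_ge0// ltW.
  apply: (le_trans Gw); rewrite A0 mule0.
  under eq_Rintegral do rewrite derive_cst.
  by rewrite /Rintegral integral0 mule0.
have a0 : 0 < fine (leb n.+1 Ex).
  by rewrite fine_gt0// lt0e A0 measure_ge0 fA.
(* An L^1 error of half the measure of the exit set still leaves half of it as a gain. *)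
have [|phi tphi Iphi] := HA (fine (leb n.+1 Ex) / 2); first by rewrite divr_gt0.
have [pphi phi01 [Q [cQ QU HQ]]] := tphi.
pose J (s : R) := \int[leb n.+1]_(x in B) phi ((x : 'rV[R]_n.+1) - s *: v).
have dJ (s : R) : is_derive s 1 J (- \int[leb n.+1]_(x in B) 'D_v phi ((x : 'rV[R]_n.+1) - s *: v)).
  exact: (is_derive_integral_line (continuous_pol pphi) (fun x => @derivable_pol R _ phi x v pphi)
    (continuous_pol (pol_derive v pphi)) cQ HQ s mB).
have [|s s01 HJ] := @MVT R J _ 0 1 ltr01 (fun x _ => dJ x).
  apply: continuous_subspaceT => s; apply: differentiable_continuous.
  by apply/derivable1_diffP; have [] := dJ s.
have mphi : measurable_fun setT (phi : borel_rV R n.+1 -> R) by exact: measurable_pol.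
have iphi : (leb n.+1).-integrable setT (EFin \o (phi : borel_rV R n.+1 -> R)).
  apply: (integrable_bounded_support (M := 1) mphi mU finU).
    by move=> x; have /andP[p0 p1] := phi01 x; rewrite ger0_norm.
  by move=> x nU; exact: testf_out tphi nU.
have iA := integrable_indic_fin mE fA.
pose dd (x : borel_rV R n.+1) : R := \1_B x - \1_B ((x : 'rV[R]_n.+1) + v).
have iJ0 : (leb n.+1).-integrable setT (EFin \o (fun x : borel_rV R n.+1 => \1_B x * phi x)).
  exact: integrable_indicl.
pose Bv : set (borel_rV R n.+1) := (fun x : 'rV[R]_n.+1 => x + v) @^-1` B.
have mBv : measurable Bv.
  rewrite -[X in measurable X]setTI; have := @measurable_affine R n.+1 1 v.
  by under eq_fun do rewrite scale1r; exact.
have iJ1 : (leb n.+1).-integrable setT (EFin \o (fun x : borel_rV R n.+1 => \1_Bv x * phi x)).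
  exact: integrable_indicl.
have J0E : J 0 = \int[leb n.+1]_x (\1_B x * phi x).
  rewrite /J Rintegral_indicl; apply: eq_Rintegral => x _.
  by rewrite scale0r subr0.
have J1E : J 1 = \int[leb n.+1]_x (\1_Bv x * phi x).
  rewrite /J Rintegral_indicl /Rintegral; congr fine.
  rewrite -(@integral_translate _ _ v); last first.
    apply: (@integrable_indicl _ _ _ _ B (fun x : borel_rV R n.+1 => phi ((x : 'rV[R]_n.+1) - 1 *: v)) mB).
    exact: (integrable_line v (continuous_pol pphi) cQ HQ 1 measurableT).
  by apply: eq_integral => x _; rewrite scale1r addrK.
have iabs : (leb n.+1).-integrable setT
    (EFin \o (fun x : borel_rV R n.+1 => `|\1_Ex x - phi x|)).
  apply: (@integrable_norm _ _ _ (leb n.+1) setT (fun x => \1_Ex x - phi x)).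
  exact: (integrableB measurableT iA iphi).
(* After a change of variable, [J 0 - J 1] integrates phi against 1_B - 1_B(. + v). This difference
   is 1 on the exit set and at most 1 in absolute value everywhere, so replacing the indicator of
   the exit set by phi costs at most the L^1 error. *)
have JJ : fine (leb n.+1 Ex) / 2 <= J 0 - J 1.
  rewrite J0E J1E -RintegralB//.
  apply: (@le_trans _ _ (\int[leb n.+1]_x (\1_Ex x - `|\1_Ex x - phi x|))); last first.
    apply: le_Rintegral => //.
    - exact: (integrableB measurableT iA iabs).
    - exact: (integrableB measurableT iJ0 iJ1).
    move=> x _; rewrite -mulrBl.
    have : (\1_Ex x : R) = \1_Ex x * (\1_B x - \1_Bv x).
      rewrite !indicE; case: (boolP (x \in Ex)) => [/set_mem Ax|_]; last by rewrite mul0r.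
      by case: Ax => Bx _ _ nB; rewrite (mem_set Bx) memNset// subr0 mulr1.
    have : `|\1_B x - \1_Bv x| <= (1 : R).
      rewrite !indicE; case: (_ \in _); case: (_ \in _); rewrite /= ?subrr ?subr0 ?sub0r ?normrN ?normr1 ?normr0//.
    set d := \1_B x - _; set i := \1_Ex x => d1 id.
    rewrite [X in X - _]id lerBlDl -lerBlDr.
    have -> : i * d - d * phi x = d * (i - phi x) by ring.
    by rewrite (le_trans (ler_norm _))// normrM ler_piMl.
  rewrite RintegralB// /Rintegral integral_indicT//.
  have Ifin : (\int[leb n.+1]_x `|\1_Ex x - phi x|%:E)%E \is a fin_num by exact: integrable_fin_num iabs.
  move: Iphi; rewrite -(fineK Ifin) lte_fin => Iphi.
  by move: Iphi; rewrite /=; set z := fine _; set y := fine _; lra.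
move: HJ; rewrite subr0 mulr1 => HJ.
(* The bump function translated by the intermediate value s of the mean value theorem. *)
exists w, (fun x => phi (x - s *: v)); split => //.
- split; first exact: (pol_translate (- (s *: v))).
    by move=> x; exact: phi01.
  exists ((fun x => x + s *: v) @` Q); split.
  + apply: continuous_compact => //; apply: continuous_subspaceT.
    exact: continuous_translate.
  + move=> _ [x Qx <-]; have := QU _ Qx; rewrite /U !cylE /v => -[[K1 K2] px].
    have -> : x + s *: snoc_rV (w, 0) = snoc_rV (rinit x + s *: w, rlast x).
      by rewrite -[x in LHS]rinitK snoc_rVZ snoc_rVD mulr0 addr0.
    rewrite /= rinit_snoc rlast_snoc; split => //.
    move: s01; rewrite in_itv /= => /andP[/ltW s0 /ltW s1].
    by apply: convex_interior_segment => //; case: K_body.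
  + move=> x nQ; apply: HQ => Qx; apply: nQ; exists (x - s *: v) => //.
    by rewrite subrK.
- under eq_Rintegral do rewrite derive_shift.
  apply: (le_trans Gw); rewrite -(fineK Afin).
  have Wge0 : (0 <= W)%E by exact: measure_ge0.
  have -> : (4%:E = 2%:E * 2%:E :> \bar R)%E by rewrite -EFinM; congr EFin; ring.
  rewrite -!muleA lee_pmul2l ?lte_fin// [leRHS]muleCA lee_wpmul2l//.
  rewrite -EFinM lee_fin -ler_pdivrMl// mulrC.
  by apply: (le_trans JJ); rewrite -opprB HJ opprK.
Qed.

End horizontal.

(** * Smoothed jumps and convergence at Lebesgue points *)

Section step_kernel.
Context {R : realType}.
Local Notation lam := (@lebesgue_measure R).

Lemma lebesgue_measure_itv_fin b1 b2 (p q : R) :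
  (lam [set` Interval (BSide b1 p) (BSide b2 q)] < +oo)%E.
Proof. by rewrite lebesgue_measure_itv /=; case: ifP => _; rewrite -?EFinB ltry. Qed.

Definition dstep : R -> R := (@step R)^`()%classic.

Lemma is_derive_step (x : R) : is_derive x 1 step (dstep x).
Proof.
have [f df _] := smooth1_derivative (@smooth1_step R).
by rewrite /dstep derive1E; have [d ->] := df x; exact: df.
Qed.

Lemma smooth1_dstep : smooth1 dstep.
Proof.
have [f df sf] := smooth1_derivative (@smooth1_step R).
have -> // : dstep = f.
by apply/funext => x; exact: is_derive_uniq (is_derive_step x) (df x).
Qed.

Lemma continuous_smooth1 (f : R -> R) : smooth1 f -> continuous f.
Proof.
move=> sf x; have [f' df _] := smooth1_derivative sf.
apply: differentiable_continuous.
by apply/derivable1_diffP; have [] := df x.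
Qed.

Lemma measurable_smooth1 (f : R -> R) : smooth1 f -> measurable_fun setT (f : measurableTypeR R -> R).
Proof. by move=> sf; apply: continuous_measurable_fun; exact: continuous_smooth1. Qed.

Lemma dstep_out (x : R) : x < 0 \/ 1 < x -> dstep x = 0.
Proof.
move=> H; apply: (is_derive_uniq (is_derive_step x)).
case: H => x0.
  apply: (@near_eq_is_derive _ _ _ (cst 0)).
  near=> y; rewrite step_le0//; apply: ltW; near: y; exact: lt_nbhsl.
apply: (@near_eq_is_derive _ _ _ (cst (1 : R))).
near=> y; rewrite step_ge1//; apply: ltW; near: y; exact: lt_nbhsr.
Unshelve. all: by end_near. Qed.

Lemma bounded_compact_itv (f : R -> R) a b : continuous f ->
  exists2 C, 0 < C & forall x, a <= x <= b -> `|f x| <= C.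
Proof.
move=> cf; have : compact (f @` `[a, b]).
  by apply: continuous_compact; [exact: continuous_subspaceT|exact: segment_compact].
move=> /compact_bounded[M [_ HM]]; exists (`|M| + 1); first by rewrite ltr_wpDl.
move=> x xab; have lt1 : M < `|M| + 1 by rewrite (le_lt_trans (ler_norm M))// ltrDl.
by apply: (HM _ lt1); exists x.
Qed.

Lemma dstep_bounded : exists2 C, 0 < C & forall x, `|dstep x| <= C.
Proof.
have [C C0 HC] := bounded_compact_itv 0 1 (continuous_smooth1 smooth1_dstep).
exists C => // x; case: (ltP x 0) => x0.
  by rewrite dstep_out ?normr0 ?ltW//; left.
case: (ltP 1 x) => x1; first by rewrite dstep_out ?normr0 ?ltW//; right.
by apply: HC; rewrite x0.
Qed.

(* smooth approximations of the Heaviside function at [c] and of the Dirac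
   mass at [c] *)
Definition rstep (c r t : R) := step (r^-1 * t + - (r^-1 * c)).
Definition drstep (c r t : R) := r^-1 * dstep (r^-1 * t + - (r^-1 * c)).

Lemma is_derive_rstep c r (t : R) : is_derive t 1 (rstep c r) (drstep c r t).
Proof.
rewrite /drstep mulrC.
apply: (@is_derive1_comp _ step (fun t => r^-1 * t + - (r^-1 * c))).
  exact: is_derive_step.
exact: is_derive_affine.
Qed.

Lemma smooth1_rstep c r : smooth1 (rstep c r).
Proof. by apply: smooth1_affine; exact: smooth1_step. Qed.

Lemma smooth1_drstep c r : smooth1 (drstep c r).
Proof.
apply: (@smooth1M _ (cst r^-1)); first exact: smooth1_cst.
by apply: smooth1_affine; exact: smooth1_dstep.
Qed.

Lemma rstep_arg (c r t : R) : r^-1 * t + - (r^-1 * c) = r^-1 * (t - c).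
Proof. ring. Qed.

Lemma rstep_le c r t : 0 < r -> t <= c -> rstep c r t = 0.
Proof.
move=> r0 tc; rewrite /rstep rstep_arg step_le0// pmulr_rle0 ?invr_gt0//.
by rewrite subr_le0.
Qed.

Lemma rstep_ge c r t : 0 < r -> c + r <= t -> rstep c r t = 1.
Proof.
move=> r0 tc; rewrite /rstep rstep_arg step_ge1// mulrC ler_pdivlMr// mul1r.
by rewrite lerBrDl.
Qed.

Lemma rstep01 c r t : 0 <= rstep c r t <= 1.
Proof. by rewrite /rstep step_ge0 step_le1. Qed.

Lemma drstep_out c r t : 0 < r -> t < c \/ c + r < t -> drstep c r t = 0.
Proof.
move=> r0 H; rewrite /drstep rstep_arg dstep_out ?mulr0//.
case: H => H; first by left; rewrite pmulr_rlt0 ?invr_gt0// subr_lt0.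
by right; rewrite mulrC ltr_pdivlMr// mul1r ltrBrDl.
Qed.

Lemma integrable_smooth_itv (k : R -> R) (g : R -> R) (a b N : R) :
  smooth1 k -> (forall t, t < a \/ b < t -> k t = 0) ->
  measurable_fun setT (g : measurableTypeR R -> R) -> (forall t, `|g t| <= N) ->
  lam.-integrable setT (EFin \o (fun t => k t * g t)).
Proof.
move=> sk k0 mg gN.
have [C C0 HC] := bounded_compact_itv a b (continuous_smooth1 sk).
have mk : measurable_fun setT (fun t : measurableTypeR R => k t * g t).
  by apply: measurable_funM => //; exact: measurable_smooth1.
have mI : measurable (`[a, b]%classic : set (measurableTypeR R)) by exact: measurable_itv.
have fI : (lam `[a, b]%classic < +oo)%E.
  by rewrite lebesgue_measure_itv /=; case: ifP => _; rewrite ?ltry// -EFinB ltry.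
apply: (integrable_bounded_support (M := C * N) mk mI fI).
- have N0 : 0 <= N by exact: le_trans (gN 0).
  move=> t; rewrite normrM; case: (ltP t a) => ta.
    by rewrite k0 ?normr0 ?mul0r ?mulr_ge0 ?(ltW C0)//; left.
  case: (ltP b t) => tb; first by rewrite k0 ?normr0 ?mul0r ?mulr_ge0 ?(ltW C0)//; right.
  by rewrite ler_pM// HC// ta.
- move=> t; rewrite /= in_itv /= => /negP; rewrite negb_and -!ltNge => /orP H.
  by rewrite k0 ?mul0r.
Qed.

Lemma integral_drstep c r : 0 < r -> \int[lam]_t drstep c r t = 1.
Proof.
move=> r0.
have crr : c < c + r by rewrite ltrDl.
have -> : \int[lam]_t drstep c r t = \int[lam]_(t in `[c, c + r]) drstep c r t.
  rewrite [RHS]Rintegral_indicl; apply: eq_Rintegral => t _; rewrite indicE.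
  case: (boolP (t \in _)) => [_|/negP nt]; first by rewrite mul1r.
  rewrite mul0r drstep_out//; apply/orP; rewrite -[_ || _]negbK negb_or -!leNgt.
  by apply/negP => H; apply: nt; rewrite inE /= in_itv.
have cs := continuous_smooth1 (smooth1_rstep c r).
rewrite /Rintegral (@continuous_FTC2 _ (drstep c r) (rstep c r))//.
- rewrite rstep_ge// rstep_le// -EFinB /= subr0 //.
- by apply: continuous_subspaceT; exact: continuous_smooth1 (smooth1_drstep c r).
- split.
  + by move=> t _; have [] := is_derive_rstep c r t.
  + by apply: cvg_at_right_filter; exact: cs.
  + by apply: cvg_at_left_filter; exact: cs.
- by move=> t _; rewrite derive1E; have [_ ->] := is_derive_rstep c r t.
Qed.

(** The kernel has integral 1, is bounded by C / r and is supported in the ball of radius 2 r around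
    c. That ball has length 4 r and the mean oscillation of g on it is below e / (4 C), so the total
    error is at most e. *)
Lemma cvg_kernel (g : R -> R) (N c e : R) :
  measurable_fun setT (g : measurableTypeR R -> R) -> (forall t, `|g t| <= N) ->
  lebesgue_pt g c -> 0 < e ->
  exists2 rho, 0 < rho & forall r, 0 < r -> r < rho ->
    `|\int[lam]_t (drstep c r t * g t) - g c| <= e.
Proof.
move=> mg gN lg e0; have [C C0 HC] := dstep_bounded.
have e4 : 0 < e / (4 * C) by rewrite divr_gt0// mulr_gt0.
have := cvge0_lt lg e4.
move=> [rho /= rho0 Hrho]; exists (rho / 2); first by rewrite divr_gt0.
move=> r r0 rrho.
have r2 : 0 < 2 * r by rewrite mulr_gt0.
have {Hrho} : (davg g c (2 * r) < (e / (4 * C))%:E)%E.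
  apply: Hrho => //=; rewrite sub0r normrN gtr0_norm//.
  by rewrite mulrC -ltr_pdivlMr.
rewrite /davg /iavg (lebesgue_measure_ball c (ltW r2)) => Hd.
have kint : lam.-integrable setT (EFin \o (drstep c r)).
  have := @integrable_smooth_itv (drstep c r) (cst 1) c (c + r) 1 (smooth1_drstep c r)
   (fun t H => drstep_out r0 H) (measurable_cst _).
  rewrite (_ : (fun t => drstep c r t * cst 1 t) = drstep c r); last first.
    by apply/funext => t; rewrite /= mulr1.
  by apply => t; rewrite normr1.
have kgint := @integrable_smooth_itv (drstep c r) g c (c + r) N (smooth1_drstep c r)
   (fun t H => drstep_out r0 H) mg gN.
have kdint := @integrable_smooth_itv (drstep c r) (fun t => g t - g c) c (c + r) (N + N) (smooth1_drstep c r)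
   (fun t H => drstep_out r0 H) (measurable_funB mg (measurable_cst _)).
have {}kdint : lam.-integrable setT (EFin \o (fun t => drstep c r t * (g t - g c))).
  by apply: kdint => t; rewrite (le_trans (ler_normB _ _))// lerD.
have -> : g c = \int[lam]_t (drstep c r t * g c).
  by rewrite RintegralZr// integral_drstep// mul1r.
rewrite -RintegralB//; last first.
  have := integrableZr measurableT (g c) kint.
  by apply: eq_integrable => // t _.
under eq_Rintegral do rewrite -mulrBr.
apply: (le_trans (le_normr_Rintegral measurableT kdint)).
have mball : measurable (ball c (2 * r)) by exact: measurable_ball.
have mgc : measurable_fun setT (fun t : measurableTypeR R => `|g t - g c|%:E).
  apply/measurable_EFinP; apply: measurableT_comp => //.
  by apply: measurable_funB => //; exact: measurable_cst.
have I1 : (\int[lam]_t `|drstep c r t * (g t - g c)|%:E <=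
    (C / r)%:E * \int[lam]_(t in ball c (2 * r)) `|g t - g c|%:E)%E.
  have Cr0 : 0 <= C / r by rewrite divr_ge0// ltW.
  pose u := ((fun t : measurableTypeR R => `|g t - g c|%:E) \_ (ball c (2 * r))).
  have mu_ : measurable_fun setT u.
    by apply/(measurable_restrictT _ mball); exact: measurable_funTS.
  have u0 t : (0 <= u t)%E by rewrite /u patchE; case: ifPn.
  have Cr0' : (0 <= (C / r)%:E)%E by rewrite lee_fin.
  rewrite [X in (_ <= _ * X)%E]integral_mkcond -/u.
  rewrite -ge0_integralZl//.
  apply: ge0_le_integral => //.
  - apply/measurable_EFinP; apply: measurableT_comp => //; apply: measurable_funM.
      exact: measurable_smooth1 (smooth1_drstep c r).
    by apply: measurable_funB => //; exact: measurable_cst.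
  - exact: measurable_funeM.
  move=> t _; rewrite normrM /u patchE; case: ifPn => [_|/negP nb].
    rewrite -EFinM lee_fin ler_wpM2r// /drstep normrM mulrC ler_pM//.
    by rewrite gtr0_norm// invr_gt0.
  rewrite mule0 drstep_out// ?normr0 ?mul0r//.
  apply/orP; rewrite -[_ || _]negbK negb_or -!leNgt; apply/negP => /andP[h1 h2].
  by apply: nb; rewrite inE /ball /= distrC ltr_norml; apply/andP; split; lra.
have r22 : 0 < 2 * r *+ 2 by rewrite pmulrn_lgt0.
have I2 : (\int[lam]_(t in ball c (2 * r)) `|g t - g c|%:E <= (2 * r *+ 2 * (e / (4 * C)))%:E)%E.
  move: Hd; rewrite inver gt_eqF// lte_pdivrMl// -EFinM => /ltW; apply: le_trans.
  by rewrite le_eqVlt; apply/orP; left; apply/eqP; apply: eq_integral.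
have I3 : (\int[lam]_t `|drstep c r t * (g t - g c)|%:E <= e%:E)%E.
  apply: (le_trans I1); apply: (@le_trans _ _ ((C / r)%:E * (2 * r *+ 2 * (e / (4 * C)))%:E)%E).
    by rewrite lee_wpmul2l// lee_fin divr_ge0// ltW.
  rewrite -EFinM lee_fin le_eqVlt; apply/orP; left; apply/eqP.
  by rewrite -mulr_natr; field; rewrite !lt0r_neq0.
rewrite /Rintegral -lee_fin fineK// ge0_fin_numE.
  by apply: (le_lt_trans I3); rewrite ltry.
by apply: integral_ge0 => t _; rewrite lee_fin.
Qed.

End step_kernel.

(** * Test fields with a horizontal and a vertical component *)

Section field.
Context {R : realType}.

Lemma lift_eq_max n (i : 'I_n) : (lift ord_max i == ord_max) = false.
Proof. by rewrite eq_sym (negbTE (neq_lift _ _)). Qed.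

Lemma pol_rinit n (f : 'rV[R]_n -> R) : pol f -> pol (fun x : 'rV[R]_n.+1 => f (rinit x)).
Proof.
elim => {f} [i f sf|c|f g _ pf _ pg|f g _ pf _ pg].
- apply: (pol_eq (pol_coord (lift ord_max i) sf)) => x; by rewrite mxE.
- exact: pol_cst.
- exact: (polD pf pg).
- exact: (polM pf pg).
Qed.

Lemma derive_rinit n (f : 'rV[R]_n -> R) (x : 'rV[R]_n.+1) :
  'D_(delta_mx 0 ord_max) (fun x => f (rinit x)) x = 0.
Proof.
have E : (fun h : R => h^-1 *: (((fun x => f (rinit x)) \o shift x)
    (h *: (delta_mx 0 ord_max : 'rV[R]_n.+1)) - f (rinit x))) = cst 0.
  apply/funext => h /=; rewrite (_ : rinit _ = rinit x) ?subrr ?scaler0//.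
  by apply/rowP => i; rewrite !mxE lift_eq_max andbF mulr0 add0r.
by rewrite /derive E; apply/cvg_lim => //; exact: cvg_cst.
Qed.

Lemma derive_pol2 m (f g : 'rV[R]_m -> R) (c d : R) (u x : 'rV[R]_m) : pol f -> pol g ->
  'D_u (fun x => f x * c + g x * d) x = c * 'D_u f x + d * 'D_u g x.
Proof.
move=> pf pg.
have -> : (fun x => f x * c + g x * d) = (c *: f + d *: g).
  by apply/funext => y; rewrite [f y * c]mulrC [g y * d]mulrC.
have df : derivable f x u by exact: derivable_pol.
have dg : derivable g x u by exact: derivable_pol.
by rewrite deriveD ?deriveZ//; exact: derivableZ.
Qed.

(** The field f (w, 0) + g e, where w is a constant horizontal vector and e is the vertical unit
    vector. *)
Definition mixfield n (f g : 'rV[R]_n.+1 -> R) (w : 'rV[R]_n) (x : 'rV[R]_n.+1) :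
    'rV[R]_n.+1 :=
  \row_i (f x * snoc_rV (w, 0) 0 i + g x * (delta_mx 0 ord_max : 'rV[R]_n.+1) 0 i).

Lemma divergence_mixfield n (f g : 'rV[R]_n.+1 -> R) (w : 'rV[R]_n) x :
  pol f -> pol g ->
  divergence (mixfield f g w) x =
  'D_(snoc_rV (w, 0)) f x + 'D_(delta_mx 0 ord_max) g x.
Proof.
move=> pf pg; rewrite /divergence.
rewrite (derive_sum_coord x (snoc_rV (w, 0)) pf).
rewrite (derive_sum_coord x (delta_mx 0 ord_max) pg) -big_split /=.
apply: eq_bigr => i _; rewrite -derive_pol2//.
by congr ('D_ _ _ x); apply/funext => y; rewrite mxE.
Qed.

Lemma enorm_mixfield n (f g : 'rV[R]_n.+1 -> R) (w : 'rV[R]_n) x (D : R) :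
  enorm w <= D -> f x ^+ 2 * D ^+ 2 + g x ^+ 2 <= 1 -> enorm (mixfield f g w x) <= 1.
Proof.
move=> wD fg; rewrite /enorm -sqrtr1 ler_wsqrtr//; apply: le_trans fg.
rewrite big_ord_recr /=.
have wD2 : \sum_i w 0 i ^+ 2 <= D ^+ 2.
  rewrite -(@sqr_sqrtr _ (\sum_i _)); last by apply: sumr_ge0 => i _; exact: sqr_ge0.
  by rewrite ler_pXn2r// ?nnegrE ?sqrtr_ge0// (le_trans _ wD)// sqrtr_ge0.
rewrite lerD//.
  rewrite (le_trans _ (ler_wpM2l (sqr_ge0 _) wD2))// mulr_sumr.
  apply: ler_sum => i _.
  have -> : widen_ord (leqnSn n) i = lift ord_max i.
    by apply: val_inj; rewrite /= /bump leqNgt ltn_ord.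
  by rewrite mxE snoc_rV_lift mxE lift_eq_max andbF mulr0 addr0 exprMn.
by rewrite mxE snoc_rV_last mxE !eqxx /= mulr0 add0r mulr1.
Qed.

Lemma enorm_box n (w : 'rV[R]_n) (c : R) : 0 <= c -> box c w -> enorm w <= n.+1%:R * c.
Proof.
move=> c0 bw; have Dge0 : 0 <= n.+1%:R * c by rewrite mulr_ge0.
rewrite -[leRHS]ger0_norm// -sqrtr_sqr /enorm ler_wsqrtr//.
apply: (@le_trans _ _ (\sum_(i < n) c ^+ 2)).
  apply: ler_sum => i _; rewrite -[w 0 i ^+ 2]real_normK ?num_real// ler_pXn2r ?nnegrE//.
rewrite sumr_const card_ord -[leLHS]mulr_natl exprMn ler_wpM2r ?sqr_ge0//.
rewrite expr2 -natrM ler_nat (@leq_trans n.+1)// leq_pmulr//.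
Qed.

End field.

(** * The inequality obtained from one mixed field *)

Section field_bound.
Context {R : realType}.
Variables (n : nat) (K : set 'rV[R]_n).
Hypothesis K_body : convex_body K.
Variable M : R.
Hypotheses (M0 : 0 < M) (KM : K `<=` box M).
Variable B : set (borel_rV R n.+1).
Hypotheses (mB : measurable B) (BK : B `<=` cyl K° setT).
Variable P : R.
Hypothesis HP : forall xi, test_field (cyl K setT)° xi ->
  (\int[leb n.+1]_(x in B) (divergence xi x)%:E <= P%:E)%E.
Local Notation lam := (@lebesgue_measure R).

Let cK : compact K. Proof. by case: K_body. Qed.

(** A bound for the Euclidean norm of the vectors of [box (2 * M)], by [enorm_box]. *)
Let D := n.+1%:R * (2 * M).

Let D0 : 0 < D. Proof. by rewrite mulr_gt0// mulr_gt0. Qed.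

(** Dividing by [D] makes the horizontal component at most b in norm. On the support of phi the
    vertical component is at most |gam|, so gam^2 + b^2 <= 1 bounds the field; elsewhere only the
    vertical component is present. *)
Lemma mixfield_test (w : 'rV[R]_n) phi chi a (p q P0 P1 gam b : R) :
  box (2 * M) w -> testf (cyl K° `]p, q[) phi -> testf K° chi ->
  smooth1 a -> (forall t, t < P0 \/ P1 < t -> a t = 0) ->
  (forall t, `|a t| <= 1) -> (forall t, p < t < q -> a t = gam) ->
  0 <= b -> gam ^+ 2 + b ^+ 2 <= 1 ->
  test_field (cyl K setT)° (mixfield (fun x => b / D * phi x)
    (fun x => chi (rinit x) * a (rlast x)) w).
Proof.
move=> bw [pphi phi01 [Q [cQ QU HQ]]] [pchi chi01 [S [cS SU HS]]] sa a0 a1 agam b0 gb.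
have p1 : pol (fun x => b / D * phi x) by exact: polZ.
have p2 : pol (fun x : 'rV[R]_n.+1 => chi (rinit x) * a (rlast x)).
  by apply: polM; [exact: pol_rinit|exact: (pol_coord ord_max sa)].
pose T := Q `|` cyl S `[P0, P1].
have cT : compact T by apply: compactU => //; apply: compact_cyl => //; exact: segment_compact.
have TU : T `<=` cyl K° setT.
  move=> x [/QU|]; first by rewrite !cylE => -[].
  by rewrite !cylE => -[/SU].
have supp : closure [set x | mixfield (fun x => b / D * phi x)
    (fun x => chi (rinit x) * a (rlast x)) w x != 0] `<=` T.
  have clT : closed T by apply: compact_closed => //; exact: norm_hausdorff.
  rewrite [X in _ `<=` X](proj1 (closure_id T) clT); apply: closure_subset => x /=.
  apply: contraNP => nT; apply/eqP/rowP => i; rewrite !mxE.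
  have -> : phi x = 0 by apply: HQ => Qx; apply: nT; left.
  rewrite mulr0 mul0r add0r.
  have [Sx|nSx] := pselect (S (rinit x)); last by rewrite HS// mul0r mul0r.
  rewrite a0 ?mulr0 ?mul0r//; apply/orP; rewrite -[_ || _]negbK negb_or -!leNgt.
  by apply/negP => H; apply: nT; right; rewrite cylE; split => //=; rewrite in_itv.
split.
- move=> i; apply: smooth_pol.
  apply: (@pol_eq _ _ (fun x => (snoc_rV (w, 0) 0 i) * (b / D * phi x) +
    ((delta_mx 0 ord_max : 'rV[R]_n.+1) 0 i) * (chi (rinit x) * a (rlast x)))).
    by apply: polD; exact: polZ.
  by move=> x; rewrite [RHS]mxE; congr (_ + _); exact: mulrC.
- exact: subclosed_compact (@closed_closure _ _) cT supp.
- apply: (subset_trans supp); apply: (subset_trans TU).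
  have oC : open (cyl K° setT) by apply: open_cyl; [exact: open_interior|exact: openT].
  rewrite -open_subsetE// !cylE => x [/interior_subset Kx _]; by split.
- move=> x; apply: (@enorm_mixfield _ _ _ _ _ _ D); first by apply: enorm_box => //; rewrite mulr_ge0// ltW.
  have /andP[h0 h1] := phi01 x; have /andP[c0 c1] := chi01 (rinit x).
  rewrite exprMn expr_div_n mulrAC divfK ?sqrf_eq0 ?lt0r_neq0// exprMn.
  have chi1 : chi (rinit x) ^+ 2 <= 1 by rewrite expr_le1.
  have phi1 : phi x ^+ 2 <= 1 by rewrite expr_le1.
  have aa : a (rlast x) ^+ 2 <= 1.
    by rewrite -real_normK ?num_real// expr_le1.
  (* Off the support of phi only chi a remains; on it the height lies in ]p, q[, where a equals
     gam. *)
  have [Qx|nQx] := pselect (Q x); last first.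
    by rewrite (HQ x nQx) expr0n /= mulr0 add0r (le_trans _ chi1)// ler_piMr// sqr_ge0.
  have := QU x Qx; rewrite cylE => -[_]; rewrite /= in_itv /= => /agam ->.
  rewrite addrC; apply: le_trans gb; apply: lerD; first by rewrite ler_piMl// sqr_ge0.
  by rewrite ler_piMr// sqr_ge0.
Qed.

Lemma integrable_cyl_support (f : borel_rV R n.+1 -> R) (P0 P1 C : R) :
  measurable_fun setT f -> (forall x, `|f x| <= C) ->
  (forall x : 'rV[R]_n.+1, ~ (K° (rinit x) /\ P0 <= rlast x <= P1) -> f x = 0) ->
  (leb n.+1).-integrable setT (EFin \o f).
Proof.
move=> mf fC f0.
have cC := compact_cyl cK (@segment_compact R P0 P1).
apply: (integrable_bounded_support (M := C) mf (compact_measurable_rV cC)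
  (leb_compact_fin cC) fC).
move=> x nx; apply: f0 => -[/interior_subset Kx px]; apply: nx.
by rewrite cylE; split => //=; rewrite in_itv.
Qed.

Lemma measurable_rlast_comp (a : R -> R) : smooth1 a ->
  measurable_fun setT (fun x : borel_rV R n.+1 => a (rlast x)).
Proof. by move=> sa; apply: measurable_pol; exact: (pol_coord ord_max sa). Qed.

Lemma field_bound (w : 'rV[R]_n) phi chi a a' (p q P0 P1 gam b : R) :
  box (2 * M) w -> testf (cyl K° `]p, q[) phi -> testf K° chi ->
  smooth1 a -> (forall t : R, is_derive t 1 a (a' t)) ->
  (forall t, t < P0 \/ P1 < t -> a t = 0) ->
  (forall t, t < P0 \/ P1 < t -> a' t = 0) ->
  (forall t, `|a t| <= 1) -> (forall t, p < t < q -> a t = gam) ->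
  0 <= b -> gam ^+ 2 + b ^+ 2 <= 1 ->
  b / D * (\int[leb n.+1]_(x in B) 'D_(snoc_rV (w, 0)) phi x) +
  \int[leb n.+1]_(x in B) (chi (rinit x) * a' (rlast x)) <= P.
Proof.
move=> bw tphi tchi sa da a0 a'0 a1 agam b0 gb.
have HT := HP (mixfield_test bw tphi tchi sa a0 a1 agam b0 gb).
have [pphi phi01 [Q [cQ QU HQ]]] := tphi.
have [pchi chi01 [S [cS SU HS]]] := tchi.
have sa' : smooth1 a'.
  have [f df sf] := smooth1_derivative sa.
  have -> // : a' = f by apply/funext => t; exact: is_derive_uniq (da t) (df t).
have p2 : pol (fun x : 'rV[R]_n.+1 => chi (rinit x) * a (rlast x)).
  by apply: polM; [exact: pol_rinit|exact: (pol_coord ord_max sa)].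
have divE x : divergence (mixfield (fun x => b / D * phi x)
    (fun x => chi (rinit x) * a (rlast x)) w) x =
    b / D * 'D_(snoc_rV (w, 0)) phi x + chi (rinit x) * a' (rlast x).
  rewrite divergence_mixfield//; last exact: polZ.
  congr (_ + _).
    transitivity ('D_(snoc_rV (w, 0)) (b / D *: phi) x); first by [].
    by rewrite deriveZ//; exact: derivable_pol.
  transitivity ('D_(delta_mx 0 ord_max) ((fun x : 'rV[R]_n.+1 => chi (rinit x)) *
     (fun x : 'rV[R]_n.+1 => a (rlast x))) x); first by [].
  rewrite deriveM; last 2 first.
  - by apply: derivable_pol; exact: pol_rinit.
  - by apply: derivable_pol; exact: (pol_coord ord_max sa).
  rewrite derive_rinit scaler0 addr0 (derive_coord _ _ _ da).
  by rewrite mxE !eqxx mulr1.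
have pD := pol_derive (snoc_rV (w, 0)) pphi.
have i1 : (leb n.+1).-integrable setT
    (EFin \o (fun x : borel_rV R n.+1 => 'D_(snoc_rV (w, 0)) phi x)).
  have DQ x : ~ Q x -> 'D_(snoc_rV (w, 0)) phi x = 0.
    by apply: (derive0_out _ (compact_closed _ cQ)) => //; exact: norm_hausdorff.
  have [C C0 HC] := compact_support_bounded (continuous_pol pD) cQ DQ.
  exact: (integrable_bounded_support (M := C) (measurable_pol pD)
    (compact_measurable_rV cQ) (leb_compact_fin cQ) HC DQ).
have i2 : (leb n.+1).-integrable setT
    (EFin \o (fun x : borel_rV R n.+1 => chi (rinit x) * a' (rlast x))).
  have [C C0 HC] := bounded_compact_itv P0 P1 (continuous_smooth1 sa').
  apply: (@integrable_cyl_support _ P0 P1 C).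
  - apply: measurable_funM; last exact: measurable_rlast_comp.
    by apply: measurable_pol; exact: pol_rinit.
  - move=> x; have /andP[c0 c1] := chi01 (rinit x).
    rewrite normrM ger0_norm//; case: (ltP (rlast x) P0) => t0.
      by rewrite a'0 ?normr0 ?mulr0 ?ltW//; left.
    case: (ltP P1 (rlast x)) => t1; first by rewrite a'0 ?normr0 ?mulr0 ?ltW//; right.
    by rewrite -[C]mul1r ler_pM// HC// t0.
  - move=> x nx; have [Kx|nKx] := pselect (K° (rinit x)); last first.
      by rewrite (testf_out tchi nKx) mul0r.
    rewrite a'0 ?mulr0//; apply/orP; rewrite -[_ || _]negbK negb_or -!leNgt.
    by apply/negP => H; apply: nx.
rewrite -RintegralZl//; last exact: integrableS i1.
rewrite -RintegralD//; last 2 first.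
- have := integrableZl measurableT (b / D) i1 => /(@integrableS _ _ _ _ setT B) H.
  exact: H.
- exact: integrableS i2.
rewrite -lee_fin; apply: le_trans HT; rewrite /Rintegral.
under [leRHS]eq_integral do rewrite divE.
rewrite fineK//; apply: integrable_fin_num => //.
apply: (@integrableS _ _ _ _ setT) => //.
have := integrableD measurableT (integrableZl measurableT (b / D) i1) i2.
by apply: eq_integrable => // x _.
Qed.

End field_bound.

(** * Passing from fields to the slice volume function *)

Section one_field.
Context {R : realType}.
Variables (n : nat) (K : set 'rV[R]_n).
Hypothesis K_body : convex_body K.
Variable M : R.
Hypotheses (M0 : 0 < M) (KM : K `<=` box M).
Variable B : set (borel_rV R n.+1).
Hypotheses (mB : measurable B) (BK : B `<=` cyl K° setT).
Local Notation lam := (@lebesgue_measure R).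

Definition slice_vol (t : R) : R := fine (leb n (slice B t)).
Let g := slice_vol.
Let kap := fine (leb n K°).

Let cK : compact K. Proof. by case: K_body. Qed.

Let mK : measurable (K° : set (borel_rV R n)) := open_measurable_rV (@open_interior _ K).

Let finK : leb n K° \is a fin_num.
Proof. by rewrite leb_convex_interior// ge0_fin_numE ?measure_ge0// leb_compact_fin. Qed.

Lemma slice_subset t : slice B t `<=` K°.
Proof. by move=> y /BK; rewrite cylE /= rinit_snoc => -[]. Qed.

Lemma leb_slice_le t : (leb n (slice B t) <= leb n K°)%E.
Proof.
by apply: le_measure; rewrite ?inE//; [exact: measurable_slice|exact: slice_subset].
Qed.

Lemma leb_sliceE t : leb n (slice B t) = (g t)%:E.
Proof.
rewrite /g /slice_vol fineK// ge0_fin_numE ?measure_ge0//.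
by apply: (le_lt_trans (leb_slice_le t)); rewrite -ge0_fin_numE ?measure_ge0.
Qed.

Lemma slice_vol_ge0 t : 0 <= g t.
Proof. by rewrite -lee_fin -leb_sliceE. Qed.

Lemma slice_vol_le t : g t <= kap.
Proof. by rewrite -lee_fin -leb_sliceE /kap fineK// leb_slice_le. Qed.

Lemma leb_sliceD t : leb n (K° `\` slice B t) = (kap - g t)%:E.
Proof.
rewrite (measureD (mu := leb n))//; [|exact: measurable_slice|by rewrite -ge0_fin_numE ?measure_ge0].
rewrite (setIidr (@slice_subset t)) [X in (_ - X)%E]leb_sliceE EFinB.
by congr (_ - _)%E; rewrite /kap fineK.
Qed.

Lemma measurable_slice_vol : measurable_fun setT (g : measurableTypeR R -> R).
Proof.
apply/measurable_EFinP; have := measurable_leb_slice mB.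
by congr measurable_fun; apply/funext => t; exact: leb_sliceE.
Qed.

Let ggk (t : R) : R := g t * (kap - g t).

Let mggk : measurable_fun setT (ggk : measurableTypeR R -> R).
Proof.
by apply: measurable_funM; [|apply: measurable_funB => //]; exact: measurable_slice_vol.
Qed.

(** The integrand vanishes exactly when the slice is negligible or fills K up to a null set, so this
    measures how far B is from being a union of full slices. *)
Definition mixing (p q : R) : R := \int[lam]_(t in `]p, q[) ggk t.

Lemma ggk_bound t : 0 <= ggk t <= kap ^+ 2.
Proof.
have g0 := slice_vol_ge0 t; have gk := slice_vol_le t.
rewrite /ggk mulr_ge0 ?subr_ge0//= expr2 ler_pM ?subr_ge0// gerBl//.
Qed.

Lemma integrable_ggk (p q : R) : lam.-integrable `]p, q[ (EFin \o ggk).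
Proof.
apply: measurable_bounded_integrable => //.
- exact: lebesgue_measure_itv_fin.
- exact: measurable_funTS.
- exists (kap ^+ 2); split; first exact: num_real.
  move=> x kx t _ /=; have /andP[h0 h1] := ggk_bound t.
  by rewrite ger0_norm// (le_trans h1)// ltW.
Qed.

Lemma mixingE p q : (\int[lam]_(t in `]p, q[)
    (leb n (slice B t) * leb n (K° `\` slice B t)) = (mixing p q)%:E)%E.
Proof.
rewrite /mixing /Rintegral fineK; last exact: integrable_fin_num (integrable_ggk p q).
by apply: eq_integral => t _; rewrite leb_sliceE leb_sliceD -EFinM.
Qed.

Variable P : R.
Hypothesis HP : forall xi, test_field (cyl K setT)° xi ->
  (\int[leb n.+1]_(x in B) (divergence xi x)%:E <= P%:E)%E.

Let D := n.+1%:R * (2 * M).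
Let D0 : 0 < D. Proof. by rewrite mulr_gt0// mulr_gt0. Qed.
Let W := fine (leb n (box (2 * M))).

Let WE : leb n (box (2 * M)) = W%:E.
Proof. by rewrite /W fineK// ge0_fin_numE ?measure_ge0// leb_box_fin. Qed.

Lemma leb_bigbox_gt0 : 0 < W.
Proof.
rewrite -lte_fin -WE.
have [_ _ [x0 Kx0]] := K_body.
apply: lt_le_trans (leb_open_gt0 (@open_interior _ K) Kx0) _.
apply: le_measure; rewrite ?inE//; first exact: measurable_box.
move=> x /interior_subset/KM Hx i; apply: le_trans (Hx i) _.
by rewrite mulr_natl mulr2n lerDl ltW.
Qed.

Lemma integral_cyl_vert (a' : R -> R) (P0 P1 : R) : smooth1 a' ->
  (forall t, t < P0 \/ P1 < t -> a' t = 0) ->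
  (leb n.+1).-integrable setT (EFin \o (fun x : borel_rV R n.+1 => \1_B x * a' (rlast x))) /\
  \int[leb n.+1]_x (\1_B x * a' (rlast x)) = \int[lam]_t (a' t * g t).
Proof.
move=> sa' a'0.
have [C C0 HC] := bounded_compact_itv P0 P1 (continuous_smooth1 sa').
have i1 : (leb n.+1).-integrable setT
    (EFin \o (fun x : borel_rV R n.+1 => \1_B x * a' (rlast x))).
  apply: (@integrable_cyl_support _ _ _ K_body _ P0 P1 C).
  - apply: measurable_funM; first exact: measurable_indic.
    exact: measurable_rlast_comp.
  - move=> x; rewrite normrM indicE.
    have a'C : `|a' (rlast x)| <= C.
      case: (ltP (rlast x) P0) => t0; first by rewrite a'0 ?normr0 ?ltW//; left.
      case: (ltP P1 (rlast x)) => t1; first by rewrite a'0 ?normr0 ?ltW//; right.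
      by apply: HC; rewrite t0.
    by case: (_ \in _); rewrite /= ?normr1 ?mul1r// normr0 mul0r ltW.
  - move=> x nx; have [Bx|nBx] := pselect (B x); last by rewrite indicE memNset// mul0r.
    rewrite a'0 ?mulr0//; apply/orP; rewrite -[_ || _]negbK negb_or -!leNgt.
    apply/negP => H; apply: nx; split => //.
    by have := BK Bx; rewrite cylE => -[].
split => //; rewrite /Rintegral; congr fine; rewrite (fubini_snoc i1).
apply: eq_integral => t _ /=.
under eq_integral do rewrite rlast_snoc mulrC EFinM.
have mS := measurable_slice t mB.
transitivity (\int[leb n]_y ((a' t)%:E * (\1_(slice B t) y : R)%:E))%E; first by [].
rewrite integralZl//; first by rewrite integral_indicT// [X in (_ * X)%E]leb_sliceE -EFinM.
apply: integrable_indic_fin => //.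
by rewrite [X in (X < _)%E]leb_sliceE ltry.
Qed.

(** The horizontal part of the field contributes a fixed multiple of [mixing] by [horizontal_field].
    The vertical part is computed slice by slice once the cutoff chi is sent to the indicator of the
    interior of K. *)
Lemma one_field a a' (p q P0 P1 gam b : R) : p < q ->
  smooth1 a -> (forall t : R, is_derive t 1 a (a' t)) ->
  (forall t, t < P0 \/ P1 < t -> a t = 0) ->
  (forall t, t < P0 \/ P1 < t -> a' t = 0) ->
  (forall t, `|a t| <= 1) -> (forall t, p < t < q -> a t = gam) ->
  0 <= b -> gam ^+ 2 + b ^+ 2 <= 1 ->
  \int[lam]_t (a' t * g t) + b * ((4 * W * D)^-1 * mixing p q) <= P.
Proof.
move=> pq sa da a0 a'0 a1 agam b0 gb.
have W0 := leb_bigbox_gt0.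
have [w [phi [bw tphi]]] := horizontal_field K_body M0 KM mB BK p q.
rewrite mixingE WE -!EFinM lee_fin => HG.
have sa' : smooth1 a'.
  have [f df sf] := smooth1_derivative sa.
  have -> // : a' = f by apply/funext => t; exact: is_derive_uniq (da t) (df t).
have [i1 <-] := integral_cyl_vert sa' a'0.
have [C C0 HC] := bounded_compact_itv P0 P1 (continuous_smooth1 sa').
have a'C t : `|a' t| <= C * \1_(`[P0, P1]%classic) t.
  rewrite indicE; case: (boolP (t \in _)) => [|/negP nt].
    by rewrite inE /= in_itv /= mulr1; exact: HC.
  rewrite mulr0 a'0 ?normr0//; apply/orP; rewrite -[_ || _]negbK negb_or -!leNgt.
  by apply/negP => H; apply: nt; rewrite inE /= in_itv.
set J := \int[leb n.+1]_(x in B) 'D_(snoc_rV (w, 0)) phi x in HG.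
have HJ : b * ((4 * W * D)^-1 * mixing p q) <= b / D * J.
  rewrite -[leRHS]mulrA ler_wpM2l// ler_pdivrMl ?mulr_gt0//.
  by apply: (le_trans HG); rewrite le_eqVlt; apply/orP; left; apply/eqP; field; rewrite lt0r_neq0.
apply/ler_addgt0Pr => e e0.
pose L := `|P1 - P0|.
have L0 : 0 <= L by exact: normr_ge0.
have finK' : (leb n K° < +oo)%E by rewrite -ge0_fin_numE ?measure_ge0.
have [_ _ HA] := approx_open (@open_interior _ K) finK' (@open_interior _ K)
  (@subset_refl _ _).
(* Dropping the cutoff chi costs at most C times the length of [P0, P1] times the L^1 distance from
   chi to the indicator of the interior of K; with this choice the cost is at most e. The 1 added to
   L keeps the denominator positive. *)
have e' : 0 < e / (C * (L + 1)) by rewrite divr_gt0// mulr_gt0// ltr_wpDl.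
have [chi tchi Ichi] := HA _ e'.
have [pchi chi01 _] := tchi.
have := field_bound K_body M0 mB HP bw tphi tchi sa da a0 a'0 a1 agam b0 gb.
rewrite -/D -/J => HF.
suff HD : \int[leb n.+1]_x (\1_B x * a' (rlast x)) <=
   \int[leb n.+1]_(x in B) (chi (rinit x) * a' (rlast x)) + e.
  by rewrite (le_trans (lerD HD HJ))// addrAC lerD2r addrC.
have mI : measurable (`[P0, P1]%classic : set (measurableTypeR R)) by exact: measurable_itv.
have mI1 : measurable_fun setT (\1_(`[P0, P1]%classic) : measurableTypeR R -> R).
  exact: measurable_indic.
pose u (x : borel_rV R n.+1) : \bar R :=
  ((C * \1_(`[P0, P1]%classic) (rlast x))%:E * `|\1_K° (rinit x) - chi (rinit x)|%:E)%E.
have mu1 : measurable_fun setT (fun x : borel_rV R n.+1 => (rlast x : measurableTypeR R)).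
  exact: (@measurable_coord R n.+1 ord_max).
have mu2 : measurable_fun setT (fun x : borel_rV R n.+1 => (rinit x : borel_rV R n)).
  apply: measurable_fun_rV => // i; under eq_fun do rewrite mxE.
  exact: measurable_coord.
have mdiff : measurable_fun setT (fun y : borel_rV R n => `|(\1_K° y : R) - chi y|%:E).
  apply/measurable_EFinP; apply: measurableT_comp => //.
  by apply: measurable_funB; [exact: measurable_indic|exact: measurable_pol].
have mu_ : measurable_fun setT u.
  apply: emeasurable_funM.
    apply/measurable_EFinP; apply: measurable_funM => //.
    exact: (measurableT_comp mI1 mu1).
  exact: (measurableT_comp mdiff mu2).
have u0 x : (0 <= u x)%E by rewrite mule_ge0// lee_fin// mulr_ge0// ltW.
have Iu : (\int[leb n.+1]_x u x <= e%:E)%E.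
  rewrite (tonelli_snoc mu_ u0).
  have E t : (\int[leb n]_y u (snoc_rV (y, t)) = (C * \1_(`[P0, P1]%classic) t)%:E *
      \int[leb n]_y `|(\1_K° y : R) - chi y|%:E)%E.
    rewrite -ge0_integralZl//.
      by apply: eq_integral => y _; rewrite /u rlast_snoc rinit_snoc.
    by rewrite lee_fin mulr_ge0// ltW.
  under eq_integral do rewrite E.
  rewrite ge0_integralZr//; last 3 first.
  - by apply/measurable_EFinP; apply: measurable_funM => //; exact: measurable_indic.
  - by move=> t _; rewrite lee_fin mulr_ge0// ltW.
  - by apply: integral_ge0 => y _; rewrite lee_fin.
  have -> : (\int[lam]_t (C * \1_(`[P0, P1]%classic) t)%:E = C%:E * lam `[P0, P1]%classic)%E.
    under eq_integral do rewrite EFinM.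
    rewrite ge0_integralZl//; first by rewrite integral_indicT.
    - by apply/measurable_EFinP; exact: measurable_indic.
    - by rewrite lee_fin ltW.
  have lL : (lam `[P0, P1]%classic <= (L + 1)%:E)%E.
    rewrite lebesgue_measure_itv /= lte_fin; case: ifP => _; last first.
      by rewrite lee_fin addr_ge0.
    by rewrite -EFinB lee_fin (le_trans (ler_norm _))// lerDl.
  apply: (@le_trans _ _ ((C%:E * (L + 1)%:E) * (e / (C * (L + 1)))%:E)%E).
    apply: lee_pmul => //.
    - by rewrite mule_ge0// lee_fin ltW.
    - by apply: integral_ge0 => y _; rewrite lee_fin.
    - by rewrite lee_wpmul2l// lee_fin ltW.
    - exact: ltW.
  rewrite -!EFinM lee_fin le_eqVlt; apply/orP; left; apply/eqP.
  by field; rewrite !lt0r_neq0// ltr_wpDl.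
have iu : (leb n.+1).-integrable setT u.
  apply/integrableP; split => //; under eq_integral do rewrite gee0_abs//.
  by apply: (le_lt_trans Iu); rewrite ltry.
have key x : (`|\1_B x * a' (rlast x) - \1_B x * (chi (rinit x) * a' (rlast x))|%:E <= u x)%E.
  rewrite -mulrBr normrM /u -EFinM lee_fin.
  have [Bx|nBx] := pselect (B x); last first.
    by rewrite indicE (memNset nBx) normr0 mul0r mulr_ge0// mulr_ge0// ltW.
  have Kx : K° (rinit x) by have := BK Bx; rewrite cylE => -[].
  rewrite indicE (mem_set Bx) normr1 mul1r [\1_K° _]indicE (mem_set Kx) /=.
  rewrite -[X in X - _]mul1r -mulrBl normrM mulrC ler_wpM2r//.
have i2 : (leb n.+1).-integrable setT
    (EFin \o (fun x : borel_rV R n.+1 => \1_B x * (chi (rinit x) * a' (rlast x)))).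
  have -> : (fun x : borel_rV R n.+1 => \1_B x * (chi (rinit x) * a' (rlast x))) =
     (fun x : borel_rV R n.+1 => chi (rinit x) * (\1_B x * a' (rlast x))).
    by apply/funext => x; rewrite mulrCA.
  apply: (le_integrable measurableT _ _ i1).
    apply/measurable_EFinP; apply: measurable_funM.
      by apply: measurable_pol; exact: pol_rinit.
    by apply: measurable_funM; [exact: measurable_indic|exact: measurable_rlast_comp].
  move=> x _ /=; have /andP[c0 c1] := chi01 (rinit x).
  by rewrite lee_fin normrM ler_piMl// ger0_norm.
rewrite [X in _ <= X + _]Rintegral_indicl -lerBlDl -RintegralB//.
have i12 := integrableB measurableT i1 i2.
apply: (le_trans (ler_norm _)); apply: (le_trans (le_normr_Rintegral measurableT i12)).
rewrite -lee_fin /Rintegral fineK.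
  apply: le_trans Iu; apply: ge0_le_integral => //.
  have [/measurable_EFinP m12 _] := integrableP _ _ _ i12.
  by apply/measurable_EFinP; exact: measurableT_comp.
exact: integrable_fin_num (integrable_norm i12).
Qed.

End one_field.

(** * A four-point inequality for the slice volumes *)

Section four_point.
Context {R : realType}.
Local Notation lam := (@lebesgue_measure R).
Variables (g : R -> R) (kap cc P : R).
Hypothesis mg : measurable_fun setT (g : measurableTypeR R -> R).
Hypothesis g0 : forall t, 0 <= g t.
Hypothesis gk : forall t, g t <= kap.
Hypothesis cc0 : 0 < cc.

(** The quantity [mixing] for an abstract profile g: from here on the argument concerns functions of
    one real variable only. *)
Definition mix (p q : R) : R := \int[lam]_(t in `]p, q[) (g t * (kap - g t)).

Hypothesis OF : forall a a' (p q P0 P1 gam b : R), p < q ->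
  smooth1 a -> (forall t : R, is_derive t 1 a (a' t)) ->
  (forall t, t < P0 \/ P1 < t -> a t = 0) ->
  (forall t, t < P0 \/ P1 < t -> a' t = 0) ->
  (forall t, `|a t| <= 1) -> (forall t, p < t < q -> a t = gam) ->
  0 <= b -> gam ^+ 2 + b ^+ 2 <= 1 ->
  \int[lam]_t (a' t * g t) + b * (cc * mix p q) <= P.

Let ggk (t : R) : R := g t * (kap - g t).

Let kap0 : 0 <= kap. Proof. exact: le_trans (g0 0) (gk 0). Qed.

Lemma mix_bound t : 0 <= ggk t <= kap ^+ 2.
Proof.
by rewrite /ggk mulr_ge0 ?subr_ge0//= expr2 ler_pM ?subr_ge0// gerBl.
Qed.

Let mggk : measurable_fun setT (ggk : measurableTypeR R -> R).
Proof. by apply: measurable_funM; [|apply: measurable_funB => //]. Qed.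

Lemma integrable_mix (S : set (measurableTypeR R)) : measurable S -> (lam S < +oo)%E ->
  lam.-integrable S (EFin \o ggk).
Proof.
move=> mS fS; apply: measurable_bounded_integrable => //.
- exact: measurable_funTS.
- exists (kap ^+ 2); split; first exact: num_real.
  move=> x kx t _ /=; have /andP[h0 h1] := mix_bound t.
  by rewrite ger0_norm// (le_trans h1)// ltW.
Qed.

Lemma integrable_mix_itv b1 b2 p q :
  lam.-integrable [set` Interval (BSide b1 p) (BSide b2 q)] (EFin \o ggk).
Proof.
by apply: integrable_mix => //; exact: lebesgue_measure_itv_fin.
Qed.

Lemma mix_ge0 p q : 0 <= mix p q.
Proof. by apply: Rintegral_ge0 => t _; case/andP: (mix_bound t). Qed.

Lemma mix_split p q s : p < s -> s < q -> mix p q = mix p s + mix s q.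
Proof.
move=> ps sq; rewrite /mix -/ggk.
have -> : `]p, q[%classic = `]p, s]%classic `|` `]s, q[%classic :> set R.
  by rewrite -itv_bndbnd_setU// bnd_simp ltW.
rewrite Rintegral_setU//=; last 2 first.
- rewrite -itv_bndbnd_setU ?bnd_simp ?ltW//; exact: integrable_mix_itv.
- apply/disj_setPS => t [] /=; rewrite !in_itv /= => /andP[_ h1] /andP[h2 _].
  by move: (le_lt_trans h1 h2); rewrite ltxx.
congr (_ + _); rewrite -Rintegral_itv_bndo_bndc//.
exact: integrable_mix_itv.
Qed.

Lemma mix_le p q s r : p <= s -> r <= q -> mix s r <= mix p q.
Proof.
move=> ps rq; rewrite /mix -/ggk.
rewrite /Rintegral fine_le//.
- exact: integrable_fin_num (integrable_mix_itv _ _ _ _).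
- exact: integrable_fin_num (integrable_mix_itv _ _ _ _).
apply: ge0_subset_integral => //.
- by apply/measurable_EFinP; exact: measurable_funTS.
- by move=> t _; rewrite lee_fin; case/andP: (mix_bound t).
- by apply: subset_itv; rewrite bnd_simp.
Qed.

Lemma mix_small p r : 0 < r -> mix p (p + r) <= kap ^+ 2 * r.
Proof.
move=> r0; have pr : p < p + r by rewrite ltrDl.
rewrite /mix -/ggk -lee_fin /Rintegral fineK; last first.
  exact: integrable_fin_num (integrable_mix_itv _ _ _ _).
apply: (@le_trans _ _ (\int[lam]_(t in `]p, (p + r)%R[) (kap ^+ 2)%:E)%E).
  apply: ge0_le_integral => //.
  - by move=> t _; rewrite lee_fin; case/andP: (mix_bound t).
  - by apply/measurable_EFinP; exact: measurable_funTS.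
  - by move=> t _; rewrite lee_fin; case/andP: (mix_bound t).
rewrite integral_cst//= lebesgue_measure_itv /= lte_fin pr -EFinB -EFinM lee_fin.
by rewrite addrAC subrr add0r.
Qed.

Lemma norm_conv_le1 (x y s : R) : `|x| <= 1 -> `|y| <= 1 -> 0 <= s <= 1 ->
  `|x + (y - x) * s| <= 1.
Proof.
rewrite !ler_norml => /andP[x0 x1] /andP[y0 y1] /andP[s0 s1].
have -> : x + (y - x) * s = (1 - s) * x + s * y by ring.
by apply/andP; split; nra.
Qed.

Lemma Rintegral_comb4 (u0 u1 u2 u3 : R -> R) (c0 c1 c2 c3 : R) :
  lam.-integrable setT (EFin \o u0) -> lam.-integrable setT (EFin \o u1) ->
  lam.-integrable setT (EFin \o u2) -> lam.-integrable setT (EFin \o u3) ->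
  \int[lam]_t (c0 * u0 t + c1 * u1 t + c2 * u2 t + c3 * u3 t) =
  c0 * \int[lam]_t u0 t + c1 * \int[lam]_t u1 t + c2 * \int[lam]_t u2 t +
  c3 * \int[lam]_t u3 t.
Proof.
move=> i0 i1 i2 i3.
have intZ c u : lam.-integrable setT (EFin \o u) ->
    lam.-integrable setT (EFin \o (fun t => c * u t)).
  by move=> iu; have := integrableZl measurableT c iu; apply: eq_integrable => // t _.
have intD (u v : R -> R) : lam.-integrable setT (EFin \o u) -> lam.-integrable setT (EFin \o v) ->
    lam.-integrable setT (EFin \o (fun t => u t + v t)).
  by move=> iu iv; have := integrableD measurableT iu iv; apply: eq_integrable => // t _.
have i01 := intD _ _ (intZ c0 _ i0) (intZ c1 _ i1).
have i012 := intD _ _ i01 (intZ c2 _ i2).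
rewrite (RintegralD measurableT i012 (intZ c3 _ i3)).
rewrite (RintegralD measurableT i01 (intZ c2 _ i2)).
rewrite (RintegralD measurableT (intZ c0 _ i0) (intZ c1 _ i1)).
by rewrite !RintegralZl.
Qed.

(** The 6 is 1 + 2 + 2 + 1, the sum of the bounds on the coefficients, which are the sizes of the
    jumps of a function with values in [-1, 1] vanishing at both ends. *)
Lemma comb4_le (c0 c1 c2 c3 e I0 I1 I2 I3 y0 y1 y2 y3 : R) :
  `|c0| <= 1 -> `|c1| <= 2 -> `|c2| <= 2 -> `|c3| <= 1 ->
  `|I0 - y0| <= e -> `|I1 - y1| <= e -> `|I2 - y2| <= e -> `|I3 - y3| <= e ->
  c0 * y0 + c1 * y1 + c2 * y2 + c3 * y3 <=
  c0 * I0 + c1 * I1 + c2 * I2 + c3 * I3 + 6 * e.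
Proof.
move=> C0 C1 C2 C3 E0 E1 E2 E3.
have est c N (x y : R) : `|c| <= N -> `|y - x| <= e -> c * x <= c * y + N * e.
  move=> cN xy; rewrite -lerBlDl -mulrBr (le_trans (ler_norm _))// normrM distrC.
  by rewrite ler_pM.
have F0 := est _ _ _ _ C0 E0; have F1 := est _ _ _ _ C1 E1.
have F2 := est _ _ _ _ C2 E2; have F3 := est _ _ _ _ C3 E3.
lra.
Qed.

(** Apply the one-field inequality to a smoothed step function with successive values 0, gam1, gam2,
    gam3, 0 and jumps at the p_i. Each smoothed jump picks up the value of g at a Lebesgue point. *)
Lemma four_point (p0 p1 p2 p3 gam1 gam2 gam3 b : R) : p0 < p1 -> p1 < p2 -> p2 < p3 ->
  lebesgue_pt g p0 -> lebesgue_pt g p1 -> lebesgue_pt g p2 -> lebesgue_pt g p3 ->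
  `|gam1| <= 1 -> `|gam3| <= 1 -> 0 <= b -> gam2 ^+ 2 + b ^+ 2 <= 1 ->
  gam1 * g p0 + (gam2 - gam1) * g p1 + (gam3 - gam2) * g p2 - gam3 * g p3 +
  b * (cc * mix p1 p2) <= P.
Proof.
move=> p01 p12 p23 l0 l1 l2 l3 G1 G3 b0 gb.
have G2 : `|gam2| <= 1.
  by rewrite -(@expr_le1 _ 2)// real_normK ?num_real// (le_trans _ gb)// lerDl sqr_ge0.
apply/ler_addgt0Pr => e e0.
(* Six parts for the four smoothed jumps, one for the strip next to p1 on which the transition takes
   place. *)
pose e' := e / 7.
have e'0 : 0 < e' by rewrite divr_gt0.
have gN t : `|g t| <= kap by rewrite ger0_norm.
have [r0 r00 H0] := cvg_kernel mg gN l0 e'0.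
have [r1 r10 H1] := cvg_kernel mg gN l1 e'0.
have [r2 r20 H2] := cvg_kernel mg gN l2 e'0.
have [r3 r30 H3] := cvg_kernel mg gN l3 e'0.
pose z := 1 + b * (cc * kap ^+ 2).
have z0 : 0 < z by rewrite ltr_pwDl// mulr_ge0// mulr_ge0 ?sqr_ge0// ltW.
(* The width r must be small enough for each kernel estimate, shorter than the gaps so that
   transitions do not overlap, and below e' / z so that the strip ]p1, p1 + r[ carries a mixing term
   of at most e'. *)
have [r [[rp a0 a1 a2 a3] [b1 b2 b3 b4]]] : exists r : R,
    [/\ 0 < r, r < r0, r < r1, r < r2 & r < r3] /\
    [/\ r < p1 - p0, r < p2 - p1, r < p3 - p2 & r < e' / z].
  have nl (y : R) : 0 < y -> \forall r \near ((0 : R)^'+), r < y by exact: nbhs_right_lt.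
  near ((0 : R)^'+) => r; exists r.
  split; split; near: r; (try exact: nbhs_right_gt); apply: nl; rewrite ?subr_gt0 ?divr_gt0 //.
pose a t := gam1 * rstep p0 r t + (gam2 - gam1) * rstep p1 r t +
  (gam3 - gam2) * rstep p2 r t + (- gam3) * rstep p3 r t.
pose a' t := gam1 * drstep p0 r t + (gam2 - gam1) * drstep p1 r t +
  (gam3 - gam2) * drstep p2 r t + (- gam3) * drstep p3 r t.
have sa : smooth1 a.
  by do 3? apply: smooth1D; apply: (@smooth1M _ (cst _)); solve [exact: smooth1_cst|exact: smooth1_rstep].
have da (t : R) : is_derive t 1 a (a' t).
  have dZ (c q : R) : is_derive t 1 (fun t => c * rstep q r t) (c * drstep q r t).
    exact: (@is_deriveZ _ R^o R^o (rstep q r) c (t : R^o) (1 : R^o) _ (is_derive_rstep q r t)).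
  exact: (is_deriveD (is_deriveD (is_deriveD (dZ _ _) (dZ _ _)) (dZ _ _)) (dZ _ _)).
have p02 := lt_trans p01 p12; have p13 := lt_trans p12 p23; have p03 := lt_trans p01 p13.
have out t : t < p0 \/ p3 + r < t -> a t = 0 /\ a' t = 0.
  case=> ht.
    have rE q : p0 <= q -> rstep q r t = 0 by move=> pq; apply: rstep_le; lra.
    have dE q : p0 <= q -> drstep q r t = 0 by move=> pq; apply: drstep_out => //; left; lra.
    by rewrite /a /a' (rE p0 (lexx _)) (rE p1 (ltW p01)) (rE p2 (ltW p02)) (rE p3 (ltW p03)) (dE p0 (lexx _)) (dE p1 (ltW p01)) (dE p2 (ltW p02)) (dE p3 (ltW p03)) !(mulr0, mulr1, addr0).
  have rE q : q <= p3 -> rstep q r t = 1 by move=> pq; apply: rstep_ge => //; lra.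
  have dE q : q <= p3 -> drstep q r t = 0 by move=> pq; apply: drstep_out => //; right; lra.
  rewrite /a /a' (rE p0 (ltW p03)) (rE p1 (ltW p13)) (rE p2 (ltW p23)) (rE p3 (lexx _)) (dE p0 (ltW p03)) (dE p1 (ltW p13)) (dE p2 (ltW p23)) (dE p3 (lexx _)) !(mulr0, mulr1, addr0); split=> //; ring.
have a1' t : `|a t| <= 1.
  rewrite /a; case: (leP t p1) => t1.
    rewrite (rstep_le (c := p1))// (rstep_le (c := p2))//; last by lra.
    rewrite (rstep_le (c := p3))//; last by lra.
    have -> : gam1 * rstep p0 r t + (gam2 - gam1) * 0 + (gam3 - gam2) * 0 + - gam3 * 0 =
      0 + (gam1 - 0) * rstep p0 r t by ring.
    by apply: norm_conv_le1; rewrite ?normr0//; exact: rstep01.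
  rewrite (rstep_ge (c := p0))//; last by lra.
  case: (leP t p2) => t2.
    rewrite (rstep_le (c := p2))// (rstep_le (c := p3))//; last by lra.
    have -> : gam1 * 1 + (gam2 - gam1) * rstep p1 r t + (gam3 - gam2) * 0 + - gam3 * 0 =
      gam1 + (gam2 - gam1) * rstep p1 r t by ring.
    by apply: norm_conv_le1 => //; exact: rstep01.
  rewrite (rstep_ge (c := p1))//; last by lra.
  case: (leP t p3) => t3.
    rewrite (rstep_le (c := p3))//.
    have -> : gam1 * 1 + (gam2 - gam1) * 1 + (gam3 - gam2) * rstep p2 r t + - gam3 * 0 =
      gam2 + (gam3 - gam2) * rstep p2 r t by ring.
    by apply: norm_conv_le1 => //; exact: rstep01.
  rewrite (rstep_ge (c := p2))//; last by lra.
  have -> : gam1 * 1 + (gam2 - gam1) * 1 + (gam3 - gam2) * 1 + - gam3 * rstep p3 r t =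
      gam3 + (0 - gam3) * rstep p3 r t by ring.
  by apply: norm_conv_le1; rewrite ?normr0//; exact: rstep01.
have amid t : p1 + r < t < p2 -> a t = gam2.
  move=> /andP[t1 t2]; rewrite /a (rstep_ge (c := p0))//; last by lra.
  rewrite (rstep_ge (c := p1))//; last by lra.
  rewrite (rstep_le (c := p2))//; last by lra.
  rewrite (rstep_le (c := p3))//; last by lra.
  ring.
(* The horizontal component is placed on ]p1 + r, p2[, where the smoothed step is constantly
   gam2. *)
have p1r : p1 + r < p2 by lra.
have HF := OF p1r sa da (fun t ht => proj1 (out t ht)) (fun t ht => proj2 (out t ht)) a1' amid b0 gb.
have int1 q : lam.-integrable setT (EFin \o (fun t => drstep q r t * g t)).
  exact: (@integrable_smooth_itv _ (drstep q r) g q (q + r) kap (smooth1_drstep q r)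
   (fun t H => drstep_out rp H) mg gN).
have IE : \int[lam]_t (a' t * g t) =
   gam1 * \int[lam]_t (drstep p0 r t * g t) + (gam2 - gam1) * \int[lam]_t (drstep p1 r t * g t) +
   (gam3 - gam2) * \int[lam]_t (drstep p2 r t * g t) + (- gam3) * \int[lam]_t (drstep p3 r t * g t).
  rewrite -(Rintegral_comb4 _ _ _ _ (int1 p0) (int1 p1) (int1 p2) (int1 p3)).
  by congr Rintegral; apply/funext => t; rewrite /a' !mulrDl !mulrA.
rewrite IE in HF.
have mixr : mix p1 p2 <= kap ^+ 2 * r + mix (p1 + r) p2.
  by rewrite (@mix_split p1 p2 (p1 + r)) ?ltrDl// lerD2r mix_small.
have bm : b * (cc * mix p1 p2) <= b * (cc * mix (p1 + r) p2) + e'.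
  apply: (@le_trans _ _ (b * (cc * (kap ^+ 2 * r + mix (p1 + r) p2)))).
    by rewrite ler_wpM2l// ler_pM2l.
  rewrite mulrDr mulrDr addrC lerD2l.
  have : z * r <= e' by rewrite mulrC -ler_pdivlMr// ltW.
  apply: le_trans; rewrite /z; have -> : b * (cc * (kap ^+ 2 * r)) = b * (cc * kap ^+ 2) * r by ring.
  by rewrite ler_wpM2r ?lerDr ?ler01 // ltW.
have N2 (x y : R) : `|x| <= 1 -> `|y| <= 1 -> `|x - y| <= 2.
  by move=> x1 y1; rewrite (le_trans (ler_normB _ _))// -[2%:R]/(1 + 1 : R) lerD.
have G3' : `|- gam3| <= 1 by rewrite normrN.
have CL := comb4_le G1 (N2 _ _ G2 G1) (N2 _ _ G3 G2) G3' (H0 r rp a0) (H1 r rp a1)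
  (H2 r rp a2) (H3 r rp a3).
have e7 : e = 6 * e' + e' by rewrite /e'; field.
rewrite e7 -mulNr; apply: le_trans (lerD CL bm) _.
by rewrite addrACA lerD2r.
Unshelve. all: by end_near. Qed.

End four_point.

(** * Geometric growth of the deficit away from an almost fullest slice *)

Section growth.
Context {R : realType}.

(* With x = c J / (2 h) when this is at most 1, and x = 1 otherwise. *)
Lemma square_le_of_linear (cJ h del : R) : 0 <= cJ -> 0 < del -> del <= h ->
  (forall x, 0 <= x <= 1 -> x * cJ <= 4 * del + x ^+ 2 * h) ->
  cJ ^+ 2 <= 64 * del * h.
Proof.
move=> J0 d0 dh H; have h0 : 0 < h by exact: lt_le_trans dh.
have [le1|gt1] := leP cJ (2 * h); last first.
  have h1 : 0 <= (1 : R) <= 1 by lra.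
  by have := H 1 h1; nra.
pose x := cJ / (2 * h); have x01 : 0 <= x <= 1.
  by rewrite /x divr_ge0 ?ler_pdivrMr ?mul1r ?mulr_gt0//= mulr_ge0// ltW.
have xE : cJ = 2 * h * x by rewrite /x mulrC divfK// gt_eqF// mulr_gt0.
have := H x x01; rewrite xE => Hx.
have : x ^+ 2 * h <= 4 * del by nra.
by move=> Hd; have := ler_wpM2r (ltW h0) Hd; nra.
Qed.

(** Here [rho] is the distance to the base point on one side, [h] the deficit kap - g, [J] the
    mixing integral from the base point to t, and [tau s] the measure of A within distance s. If h
    is large on A beyond s then J is large, and [square_le_of_linear] turns this into a larger h.
    The iteration makes h exceed kap unless [tau] stays below 2 T, a bound in which del does not
    appear. *)
Lemma growth (X : Type) (L A : set X) (rho h J : X -> R) (tau : R -> R)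
    (kap c del : R) :
  A `<=` L -> continuous tau -> tau 0 = 0 -> {homo tau : s t / s <= t} ->
  0 < kap -> 0 < c -> 0 < del ->
  (forall t, L t -> del <= h t <= kap) ->
  (forall t s H, L t -> 0 <= s < rho t -> 0 <= H ->
    (forall u, A u -> s <= rho u < rho t -> H <= h u) ->
    kap / 2 * H * (tau (rho t) - tau s) <= J t) ->
  (forall t, L t -> 0 < rho t -> forall x, 0 <= x <= 1 ->
    x * (c * J t) <= 4 * del + x ^+ 2 * h t) ->
  forall t, L t -> 0 < rho t -> tau (rho t) < 128 / (c * kap).
Proof.
move=> AL ctau tau0 tau_mono k0 c0 d0 Hh HJ Hx.
pose T := 64 / (c * kap); have T0 : 0 < T by rewrite divr_gt0 ?mulr_gt0.
have cT : c * kap * T = 64 by rewrite /T mulrC divfK// gt_eqF// mulr_gt0.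
have J0 t : L t -> 0 < rho t -> 0 <= J t.
  move=> Lt rt; have := HJ t 0 0 Lt; rewrite lexx rt mulr0 mul0r; apply => //.
  by move=> u Au _; have /andP[+ _] := Hh u (AL u Au); apply: le_trans; exact: ltW.
(* The thresholds T (2 - 2^-j) increase to 2 T while the lower bound del 4^j on the deficit is
   unbounded. *)
have claim j t : L t -> 0 < rho t -> T * (2 - (2 ^+ j)^-1) <= tau (rho t) ->
    del * (2 ^+ j) ^+ 2 <= h t.
  elim: j t => [|j IH] t Lt rt taut.
    by rewrite expr0 expr1n mulr1; case/andP: (Hh t Lt).
  set y := 2 ^+ j in IH; have y0 : 0 < y by rewrite exprn_gt0.
  have y1 : 1 <= y by rewrite exprn_ege1// ler1n.
  have yV1 : y^-1 <= 1 by rewrite invf_le1.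
  have yV0 : 0 < y^-1 by rewrite invr_gt0.
  have yS : (2 ^+ j.+1 : R) = 2 * y by rewrite exprS.
  move: taut; rewrite yS invfM => taut.
  (* By continuity of tau, s is the distance at which the previous threshold is reached; the
     induction hypothesis applies to every point of A beyond it. *)
  have [s /[!in_itv]/= /andP[s0 st] sE] : exists2 s, s \in `[0, rho t] &
      tau s = T * (2 - y^-1).
    apply: IVT; first exact: ltW.
      exact: continuous_subspaceT.
    rewrite tau0 min_l ?max_r ?tau_mono//; try exact: tau_mono (ltW rt).
    - apply/andP; split; first by rewrite mulr_ge0 ?subr_ge0//; lra.
      by apply: le_trans taut; rewrite ler_pM2l//; lra.
    - by rewrite -tau0 tau_mono// ltW.
    - by rewrite -tau0 tau_mono// ltW.
  have s0' : 0 < s.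
    rewrite lt_neqAle s0 andbT; apply/eqP => sz; move: sE; rewrite -sz tau0.
    by move/esym/eqP; rewrite gt_eqF// mulr_gt0//; lra.
  have st' : s < rho t.
    rewrite lt_neqAle st andbT; apply/eqP => sz; move: taut; rewrite -sz sE.
    by rewrite ler_pM2l//; lra.
  have sst : 0 <= s < rho t by rewrite s0 st'.
  have H0 : 0 <= del * y ^+ 2 by rewrite mulr_ge0 ?sqr_ge0// ltW.
  have := HJ t s (del * y ^+ 2) Lt sst H0.
  have HA u : A u -> s <= rho u < rho t -> del * y ^+ 2 <= h u.
    move=> Au /andP[su _]; apply: IH; [exact: AL|exact: lt_le_trans su|].
    by rewrite -sE tau_mono.
  move=> /(_ HA) JL; have Jt := J0 t Lt rt.
  have /andP[dh _] := Hh t Lt.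
  have cJ0 : 0 <= c * J t by rewrite mulr_ge0// ltW.
  have SQ := square_le_of_linear cJ0 d0 dh (Hx t Lt rt).
  have dtau : T / (2 * y) <= tau (rho t) - tau s.
    by rewrite sE invfM; lra.
  have J1 : kap / 2 * (del * y ^+ 2) * (T / (2 * y)) <= J t.
    by apply: le_trans JL; rewrite ler_wpM2l// mulr_ge0// divr_ge0// ltW.
  (* The constant 64 in T is chosen so that c J >= 16 del 2^j; squaring and comparing with 64 del h
     gives h >= del 4^(j + 1). *)
  have J2 : 16 * (del * y) <= c * J t.
    have -> : 16 * (del * y) = c * (kap / 2 * (del * y ^+ 2) * (T / (2 * y))).
      have -> : c * (kap / 2 * (del * y ^+ 2) * (T / (2 * y))) =
        (c * kap * T) * del * y * (y * y^-1) / 4.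
        by field; rewrite gt_eqF.
      by rewrite cT divff ?gt_eqF//; field.
    by rewrite ler_pM2l.
  have dy0 : 0 <= 16 * (del * y) by rewrite !mulr_ge0// ltW.
  have : (16 * (del * y)) ^+ 2 <= 64 * del * h t.
    by apply: le_trans SQ; rewrite ler_sqr// nnegrE.
  have -> : (16 * (del * y)) ^+ 2 = 64 * del * (del * (2 * y) ^+ 2) by ring.
  by rewrite ler_pM2l// mulr_gt0.
move=> t Lt rt; rewrite ltNge; apply/negP => ht.
have [_ hk] := andP (Hh t Lt).
(* With j > kap / del the claim gives del 4^j <= kap, against 4^j >= j. *)
pose j := (Num.truncn (kap / del)).+1.
have : kap / del < j%:R by exact: truncnS_gt.
rewrite ltNge => /negP; apply.
have := claim j t Lt rt.
have -> : T * (2 - (2 ^+ j)^-1) <= tau (rho t).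
  apply: le_trans ht; have -> : 128 / (c * kap) = T * 2 by rewrite /T; field; rewrite !gt_eqF.
  by rewrite ler_pM2l// gerBl invr_ge0 exprn_ge0.
move=> /(_ isT) hj.
rewrite ler_pdivlMr//; apply: le_trans hk; apply: le_trans hj.
rewrite mulrC ler_pM2l// -exprM -natrX ler_nat.
by apply: leq_trans (ltnW (ltn_expl j (isT : 1 < 2)%N)) _; rewrite leq_exp2l// leq_pmulr.
Qed.

End growth.

(** * The high set on one side of the base point *)

Section one_side.
Context {R : realType}.
Local Notation lam := (@lebesgue_measure R).
Variables (g : R -> R) (kap c del : R) (L A : set (measurableTypeR R))
  (rho : measurableTypeR R -> R).
Hypothesis mg : measurable_fun setT (g : measurableTypeR R -> R).
Hypothesis g0 : forall t, 0 <= g t.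
Hypothesis gk : forall t, g t <= kap.
Hypotheses (kap0 : 0 < kap) (c0 : 0 < c) (del0 : 0 < del).
Hypotheses (mA : measurable A) (AL : A `<=` L) (finA : (lam A < +oo)%E).
Hypothesis Ag : forall t, A t -> kap / 2 <= g t.
Hypothesis Ldel : forall t, L t -> del <= kap - g t.
Hypothesis mrho : measurable_fun setT rho.
Hypothesis rho_len : forall s s', s <= s' ->
  (lam [set t | (s <= rho t < s')%R] <= (s' - s)%:E)%E.
Hypothesis rho_far : forall M, exists2 t, L t & M < rho t.

Definition sublevel s : set (measurableTypeR R) := [set t | 0 < rho t < s].

Hypothesis Hx : forall t, L t -> 0 < rho t -> forall x, 0 <= x <= 1 ->
  x * (c * \int[lam]_(u in sublevel (rho t)) (g u * (kap - g u))) <=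
  4 * del + x ^+ 2 * (kap - g t).

Let mlvl s s' : measurable [set t | s <= rho t < s'].
Proof.
rewrite (_ : [set t | _] = rho @^-1` `[s, s'[%classic).
  by rewrite -[_ @^-1` _]setTI; exact: mrho.
by apply/seteqP; split => t /=; rewrite in_itv.
Qed.

Lemma measurable_sublevel s : measurable (sublevel s).
Proof.
rewrite (_ : sublevel s = rho @^-1` `]0, s[%classic).
  by rewrite -[_ @^-1` _]setTI; exact: mrho.
by apply/seteqP; split => t /=; rewrite in_itv.
Qed.

Let mD := measurable_sublevel.

Let finD s : (lam (sublevel s) < +oo)%E.
Proof.
case: (leP 0 s) => s0.
  apply: (@le_lt_trans _ _ (s - 0)%:E); last exact: ltry.
  apply: le_trans (rho_len s0); apply: le_measure; rewrite ?inE//.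
  by move=> t /andP[t0 ts] /=; rewrite ltW.
rewrite (_ : sublevel s = set0) ?measure0//.
by apply/seteqP; split => // t /andP[t0 ts]; move: (lt_trans t0 ts); rewrite ltNge ltW.
Qed.

Let tau s := fine (lam (A `&` sublevel s)).

Let mAD s : measurable (A `&` sublevel s). Proof. exact: measurableI. Qed.

Let finAD s : lam (A `&` sublevel s) \is a fin_num.
Proof.
rewrite ge0_fin_numE//; apply: le_lt_trans finA.
by apply: le_measure; rewrite ?inE//; exact: subIsetl.
Qed.

Let tau_diff s s' : s <= s' ->
  lam (A `&` (sublevel s' `\` sublevel s)) = (tau s' - tau s)%:E.
Proof.
move=> ss; have -> : A `&` (sublevel s' `\` sublevel s) =
    (A `&` sublevel s') `\` (A `&` sublevel s).
  apply/seteqP; split => t /=; first by move=> [At [h1 h2]]; split => // -[].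
  by move=> [[At h1] h2]; split => //; split => // h3; apply: h2.
have fs : (lam (A `&` sublevel s') < +oo)%E by rewrite -ge0_fin_numE.
rewrite (measureD (mAD s') (mAD s) fs).
have -> : A `&` sublevel s' `&` (A `&` sublevel s) = A `&` sublevel s.
  apply/seteqP; split => t /=; first by move=> [_ ?].
  by move=> [At /andP[h1 h2]]; rewrite /sublevel /= h1 h2 (lt_le_trans h2).
by rewrite EFinB !fineK.
Qed.

Let tau_mono : {homo tau : s t / s <= t}.
Proof.
by move=> s t st; rewrite -subr_ge0 -lee_fin -tau_diff.
Qed.

Let tau_lip s s' : s <= s' -> tau s' - tau s <= s' - s.
Proof.
move=> ss; rewrite -lee_fin -tau_diff//; apply: le_trans (rho_len ss).
apply: le_measure; rewrite ?inE//; first by apply: measurableI => //; exact: measurableD.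
move=> t [_ [/andP[t0 ts] nt]] /=; rewrite ts andbT leNgt; apply/negP => h.
by apply: nt; rewrite /sublevel /= t0.
Qed.

Let ctau : continuous tau.
Proof.
have lip s s' : `|tau s - tau s'| <= `|s - s'|.
  case: (leP s s') => [|/ltW] h.
    by rewrite distrC (distrC s) !ger0_norm ?subr_ge0 ?tau_mono// tau_lip.
  by rewrite !ger0_norm ?subr_ge0 ?tau_mono// tau_lip.
move=> s; apply/cvgrPdist_lt => e e0; near=> s'.
by apply: le_lt_trans (lip _ _) _; near: s'; exact: cvgr_dist_lt.
Unshelve. all: by end_near. Qed.

Let gh t := g t * (kap - g t).

Let gh0 t : 0 <= gh t. Proof. by rewrite mulr_ge0// subr_ge0. Qed.

Let mgh : measurable_fun setT (gh : measurableTypeR R -> R).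
Proof. by apply: measurable_funM; [|apply: measurable_funB => //]. Qed.

Let igh s : lam.-integrable (sublevel s) (EFin \o gh).
Proof.
apply: measurable_bounded_integrable => //.
- exact: finD.
- exact: measurable_funTS.
- exists (kap ^+ 2); split; first exact: num_real.
  move=> x kx t _ /=; rewrite ger0_norm//.
  by rewrite (le_trans _ (ltW kx))// expr2 ler_pM ?subr_ge0// gerBl.
Qed.

(** The function [rho] is left abstract so that t - t0 and t0 - t are handled at once. The length
    condition on its level sets makes [tau] 1-Lipschitz, hence continuous as [growth] demands. *)
Lemma one_side : (lam (A `&` [set t | (0 < rho t)%R]) <= (128 / (c * kap))%:E)%E.
Proof.
pose J t := \int[lam]_(u in sublevel (rho t)) gh u.
have G : forall t, L t -> 0 < rho t -> tau (rho t) < 128 / (c * kap).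
  apply: (@growth R (measurableTypeR R) L A rho (fun t => kap - g t) J tau kap c del) => //.
  - rewrite /tau (_ : sublevel 0 = set0) ?setI0 ?measure0//.
    by apply/seteqP; split => // t /andP[h1 h2]; move: (lt_trans h1 h2); rewrite ltxx.
  - by move=> t Lt; rewrite Ldel//= gerBl.
  - move=> t s H Lt /andP[s0 st] H0 HH.
    pose S := A `&` (sublevel (rho t) `\` sublevel s).
    have mS : measurable S by apply: measurableI => //; exact: measurableD.
    rewrite -lee_fin /J /Rintegral fineK; last exact: integrable_fin_num (igh _).
    apply: (@le_trans _ _ (\int[lam]_(u in S) (gh u)%:E)%E); last first.
      apply: ge0_subset_integral => //.
      - exact/measurable_EFinP/measurable_funTS.
      - by move=> u _; rewrite lee_fin.
      - by move=> u [_ []].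
    rewrite EFinM -(tau_diff (ltW st)) -integral_cst//.
    apply: ge0_le_integral => //.
    - by move=> u _; rewrite lee_fin mulr_ge0// divr_ge0// ltW.
    - exact/measurable_EFinP/measurable_funTS.
    move=> u [Au [/andP[u0 ut] nu]]; rewrite lee_fin /gh ler_pM ?divr_ge0 ?Ag ?(ltW kap0)//.
    apply: HH => //; rewrite ut andbT leNgt; apply/negP => us.
    by apply: nu; rewrite /sublevel /= u0.
(* The bound holds at distances reached by points of L, and these are arbitrarily large; continuity
   from below extends it to the whole side. *)
have cv : lam (A `&` sublevel m%:R) @[m --> \oo] -->
    lam (\bigcup_m (A `&` sublevel m%:R)).
  apply: (@nondecreasing_cvg_mu _ _ _ lam (fun m => A `&` sublevel m%:R)) => //.
    exact: bigcup_measurable.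
  move=> p q pq; apply/subsetPset => t [At /andP[h1 h2]]; split => //.
  by rewrite /sublevel /= h1 (lt_le_trans h2)// ler_nat.
have -> : A `&` [set t | 0 < rho t] = \bigcup_m (A `&` sublevel m%:R).
  apply/seteqP; split => t; last by move=> [m _ [At /andP[h1 h2]]].
  move=> [At rt]; exists (Num.truncn (rho t)).+1 => //; split => //.
  by rewrite /sublevel /= rt /=; exact: truncnS_gt.
rewrite -(cvg_lim _ cv)//; apply: lime_le; first by apply/cvg_ex; eexists; exact: cv.
near=> m; have [t Lt mt] := rho_far m%:R.
have rt : 0 < rho t by exact: le_lt_trans mt.
rewrite -(@fineK _ (lam _))// lee_fin; apply: le_trans (ltW (G t Lt rt)).
exact/tau_mono/ltW.
Unshelve. all: by end_near. Qed.

End one_side.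

Lemma full_meet {R : realType} (L I : set (measurableTypeR R)) :
  measurable L -> lebesgue_measure (~` L) = 0%E -> measurable I ->
  lebesgue_measure (L `&` I) = lebesgue_measure I.
Proof.
move=> mL L0 mI; apply/eqP; rewrite eq_le; apply/andP; split.
  by apply: le_measure; rewrite ?inE//; exact: measurableI.
rewrite -[X in (_ <= X)%E]adde0 -L0.
apply: (@le_trans _ _ (lebesgue_measure ((L `&` I) `|` ~` L))); last first.
  by apply: measureU2; [exact: measurableI|exact: measurableC].
apply: le_measure; rewrite ?inE//.
  by apply: measurableU; [exact: measurableI|exact: measurableC].
by move=> t It; case: (pselect (L t)) => Lt; [left|right].
Qed.

(** * Rigidity of the slice volume function *)

Section profile_rigidity.
Context {R : realType}.
Local Notation lam := (@lebesgue_measure R).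
Variables (g : R -> R) (kap cc P : R) (L : set (measurableTypeR R)).
Hypothesis mg : measurable_fun setT (g : measurableTypeR R -> R).
Hypothesis g0 : forall t, 0 <= g t.
Hypothesis gk : forall t, g t <= kap.
Hypotheses (kap0 : 0 < kap) (cc0 : 0 < cc).
Hypotheses (mL : measurable L) (L0 : lam (~` L) = 0%E).
Hypothesis gI : lam.-integrable setT (EFin \o g).
Hypothesis FP : forall p0 p1 p2 p3 gam1 gam2 gam3 b : R,
  p0 < p1 -> p1 < p2 -> p2 < p3 -> L p0 -> L p1 -> L p2 -> L p3 ->
  `|gam1| <= 1 -> `|gam3| <= 1 -> 0 <= b -> gam2 ^+ 2 + b ^+ 2 <= 1 ->
  gam1 * g p0 + (gam2 - gam1) * g p1 + (gam3 - gam2) * g p2 - gam3 * g p3 +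
  b * (cc * mix g kap p1 p2) <= P.
Hypothesis P_le : P <= 2 * kap.

Let gh t := g t * (kap - g t).

Let gh0 t : 0 <= gh t. Proof. by rewrite mulr_ge0// subr_ge0. Qed.

Let mgh : measurable_fun setT (gh : measurableTypeR R -> R).
Proof. by apply: measurable_funM; [|apply: measurable_funB => //]. Qed.

(** Otherwise g >= e on a set of infinite measure, against integrability. *)
Lemma exists_small (I : set (measurableTypeR R)) e : measurable I -> lam I = +oo%E ->
  0 < e -> exists t, [/\ L t, I t & g t < e].
Proof.
move=> mI I_oo e0; apply: contrapT => H.
have mLI := measurableI _ _ mL mI.
have : (\int[lam]_(t in L `&` I) (e%:E) <= \int[lam]_(t in setT) (g t)%:E)%E.
  apply: (@le_trans _ _ (\int[lam]_(t in L `&` I) (g t)%:E)%E); last first.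
    by apply: ge0_subset_integral => //; [exact/measurable_EFinP|move=> t _; rewrite lee_fin].
  apply: ge0_le_integral => //.
  - by move=> t _; rewrite lee_fin ltW.
  - exact/measurable_EFinP/measurable_funTS.
  by move=> t [Lt It]; rewrite lee_fin leNgt; apply/negP => gt; apply: H; exists t.
rewrite integral_cst//= (full_meet mL L0 mI) I_oo gt0_muley ?lte_fin// leye_eq => /eqP goo.
by have := integrable_fin_num measurableT gI; rewrite /= goo.
Qed.

Lemma exists_left m e : 0 < e -> exists t, [/\ L t, t < m & g t < e].
Proof.
move=> e0; have mI : measurable (`]-oo, m[%classic : set (measurableTypeR R)) by exact: measurable_itv.
have Ioo : lam (`]-oo, m[%classic) = +oo%E by rewrite lebesgue_measure_itv /= ?ltNyr ?ltry.
have [t [Lt It gt]] := exists_small mI Ioo e0.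
by exists t; split.
Qed.

Lemma exists_right m e : 0 < e -> exists t, [/\ L t, m < t & g t < e].
Proof.
move=> e0; have mI : measurable (`]m, +oo[%classic : set (measurableTypeR R)) by exact: measurable_itv.
have Ioo : lam (`]m, +oo[%classic) = +oo%E by rewrite lebesgue_measure_itv /= ?ltNyr ?ltry.
have [t [Lt It gt]] := exists_small mI Ioo e0.
by exists t; split => //; move: It; rewrite /= in_itv/= andbT.
Qed.

(* (gam1, gam2, gam3) = (-1, 1 - x^2, 1) if t0 < t1 and (-1, x^2 - 1, 1) otherwise. *)
Lemma two_point t0 t1 x : L t0 -> L t1 -> t0 != t1 -> 0 <= x <= 1 ->
  2 * kap - P + x * (cc * mix g kap (Num.min t0 t1) (Num.max t0 t1)) <=
  2 * (kap - g t0) + x ^+ 2 * (kap - g t1).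
Proof.
move=> L0' L1 t01 /andP[x0 x1]; apply/ler_addgt0Pr => e e0.
have e2 : 0 < e / 2 by rewrite divr_gt0.
have [p [Lp pm gp]] := exists_left (Num.min t0 t1) e2.
have [q [Lq qm gq]] := exists_right (Num.max t0 t1) e2.
have gt0 := g0 t0; have gt1 := g0 t1; have kt0 := gk t0; have kt1 := gk t1.
have gp0 := g0 p; have gq0 := g0 q.
have N1 : `|- 1 : R| <= 1 by rewrite normrN normr1.
have P1 : `|1 : R| <= 1 by rewrite normr1.
have xx : 0 <= x ^+ 2 <= 1 by rewrite sqr_ge0 expr_le1.
have xg : 0 <= x ^+ 2 * (kap - g t0) by rewrite mulr_ge0 ?subr_ge0//; case/andP: xx.
have s1 : (1 - x ^+ 2) ^+ 2 + x ^+ 2 <= 1.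
  by rewrite -subr_ge0 (_ : _ - _ = x ^+ 2 * (1 - x ^+ 2)); [rewrite mulr_ge0//; lra|ring].
case: (ltgtP t0 t1) t01 pm qm => // t01 _.
  move=> pm qm.
  by have := FP pm t01 qm Lp L0' L1 Lq N1 P1 x0 s1; lra.
move=> pm qm.
have s2 : (x ^+ 2 - 1) ^+ 2 + x ^+ 2 <= 1 by rewrite -sqrrN opprB.
by have := FP pm t01 qm Lp L1 L0' Lq N1 P1 x0 s2; lra.
Qed.

(** The two-point inequality at x = 1, with both deficits at most kap. *)
Lemma mix_le3 p q : L p -> L q -> p < q -> cc * mix g kap p q <= 3 * kap.
Proof.
move=> Lp Lq pq; have x1 : 0 <= (1 : R) <= 1 by lra.
have := two_point Lp Lq (negbT (lt_eqF pq)) x1.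
rewrite (min_l (ltW pq)) (max_r (ltW pq)) mul1r expr1n mul1r.
have := g0 p; have := g0 q; move: P_le; lra.
Qed.

Let A : set (measurableTypeR R) := L `&` [set t | kap / 2 <= g t].

Let mA : measurable A.
Proof.
apply: measurableI => //; rewrite (_ : [set t | _] = g @^-1` `[kap / 2, +oo[%classic).
  by rewrite -[_ @^-1` _]setTI; exact: mg.
by apply/seteqP; split => t /=; rewrite in_itv/= andbT.
Qed.

Let k2 : 0 < kap / 2. Proof. by rewrite divr_gt0. Qed.

Let finA : (lam A < +oo)%E.
Proof.
rewrite ltNge leye_eq; apply/negP => /eqP A_oo.
have [t [Lt [_ /= h1] h2]] := exists_small mA A_oo k2.
by move: (le_lt_trans h1 h2); rewrite ltxx.
Qed.

Lemma integral_mix_le C : (forall p q, L p -> L q -> p < q -> mix g kap p q <= C) ->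
  (\int[lam]_t (gh t)%:E <= C%:E)%E.
Proof.
move=> HC; pose F m : set (measurableTypeR R) := `]- m%:R, m%:R[%classic.
have mF m : measurable (F m) by exact: measurable_itv.
have FT : \bigcup_m F m = setT.
  apply/seteqP; split => // t _; exists (Num.truncn `|t|).+1 => //.
  by rewrite /F /= in_itv/= -ltr_norml truncnS_gt.
have cv : (\int[lam]_(t in F m) (gh t)%:E)%E @[m --> \oo] --> (\int[lam]_t (gh t)%:E)%E.
  rewrite -FT; apply: ge0_nondecreasing_set_cvg_integral => //.
  - move=> p q pq; apply/subsetPset; apply: subset_itv; rewrite bnd_simp ?lerN2 ler_nat//.
  - by move=> m; exact/measurable_EFinP/measurable_funTS.
  - by move=> m t _; rewrite lee_fin.
rewrite -(cvg_lim _ cv)//; apply: lime_le; first by apply/cvg_ex; eexists; exact: cv.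
near=> m.
have [p [Lp pm _]] := exists_left (- m%:R) kap0.
have [q [Lq qm _]] := exists_right m%:R kap0.
have pq : p < q.
  apply: lt_trans pm _; apply: le_lt_trans qm.
  by apply: (@le_trans _ _ 0); rewrite ?oppr_le0 ler0n.
have := HC p q Lp Lq pq; rewrite -lee_fin; apply: le_trans.
rewrite /mix /Rintegral fineK; last first.
  exact: (integrable_fin_num _ (integrable_mix_itv mg g0 gk _ _ _ _)).
apply: ge0_subset_integral => //.
- exact/measurable_EFinP/measurable_funTS.
- by move=> t _; rewrite lee_fin.
- by apply: subset_itv; rewrite bnd_simp ltW.
Unshelve. all: by end_near. Qed.

(** Where g < kap / 2 the deficit exceeds kap / 2, so g <= (2 / kap) g (kap - g), and the integral
    of g (kap - g) is at most 3 kap / cc by [mix_le3]. Elsewhere g <= kap. *)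
Lemma volume_le : (\int[lam]_t (g t)%:E <= kap%:E * lam A + (6 / cc)%:E)%E.
Proof.
have m1 : measurable_fun setT (fun t : measurableTypeR R => kap * \1_A t).
  by apply: measurable_funM => //; exact: measurable_indic.
have m2 : measurable_fun setT (fun t : measurableTypeR R => 2 / kap * gh t).
  by apply: measurable_funM.
have i0 t : 0 <= (\1_A t : R) by [].
have -> : (kap%:E * lam A = \int[lam]_t (kap * \1_A t)%:E)%E.
  under eq_integral do rewrite EFinM.
  rewrite ge0_integralZl//; [|exact/measurable_EFinP/measurable_indic|by rewrite lee_fin ltW].
  by rewrite integral_indic// setIT.
have le2 : (\int[lam]_t (2 / kap * gh t)%:E <= (6 / cc)%:E)%E.
  under eq_integral do rewrite EFinM.
  rewrite ge0_integralZl//; [|exact/measurable_EFinP|by move=> t _; rewrite lee_fin|].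
    have -> : 6 / cc = 2 / kap * (3 * kap / cc) by field; rewrite !gt_eqF.
    rewrite [X in (_ <= X)%E]EFinM; apply: lee_wpmul2l; [rewrite lee_fin divr_ge0// ltW//|apply: integral_mix_le].
    by move=> p q Lp Lq pq; rewrite ler_pdivlMr// [X in X <= _]mulrC; exact: mix_le3.
  by rewrite lee_fin divr_ge0// ltW.
apply: (le_trans _ (leeD (lexx _) le2)).
rewrite -ge0_integralD//; last 4 first.
- by move=> t _; rewrite lee_fin mulr_ge0// ltW.
- exact/measurable_EFinP.
- by move=> t _; rewrite lee_fin mulr_ge0// divr_ge0// ltW.
- exact/measurable_EFinP.
apply: ae_ge0_le_integral => //.
- by move=> t _; rewrite lee_fin.
- exact/measurable_EFinP.
- by move=> t _; rewrite -EFinD lee_fin addr_ge0// mulr_ge0// ?divr_ge0// ltW.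
- by apply/measurable_EFinP; exact: measurable_funD.
exists (~` L); split => //; first exact: measurableC.
move=> t /= H; apply: contra_not H => Lt _.
rewrite -EFinD lee_fin indicE; case: (leP (kap / 2) (g t)) => gt.
  rewrite mem_set//= mulr1 (le_trans (gk t))// lerDl.
  by rewrite mulr_ge0// divr_ge0// ltW.
rewrite memNset/=; last by move=> [_ /=]; rewrite leNgt gt.
rewrite mulr0 add0r /gh.
have -> : 2 / kap * (g t * (kap - g t)) = g t * (2 / kap * (kap - g t)) by ring.
rewrite ler_peMr// mulrC mulrA ler_pdivlMr// mul1r; lra.
Qed.


Let Dpos t : 0 <= kap - g t. Proof. by rewrite subr_ge0. Qed.

(** With P <= 2 kap and deficit at most 2 del at t0, the two-point inequality becomes the hypothesis
    of [one_side]. Each side of t0 contributes 128 / (cc kap). *)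
Lemma high_set_le del t0 : 0 < del -> (forall t, L t -> del <= kap - g t) ->
  L t0 -> kap - g t0 <= 2 * del -> (lam A <= (256 / (cc * kap))%:E)%E.
Proof.
move=> d0 Hd Lt0 ht0.
have AL : A `<=` L by exact: subIsetl.
have Ag t : A t -> kap / 2 <= g t by case.
have tp t x : L t -> t0 != t -> 0 <= x <= 1 ->
    x * (cc * mix g kap (Num.min t0 t) (Num.max t0 t)) <= 4 * del + x ^+ 2 * (kap - g t).
  by move=> Lt tt x01; have := two_point Lt0 Lt tt x01; move: P_le; lra.
have lenE s s' : s <= s' -> lam (`[s, s'[%classic) = (s' - s)%:E.
  rewrite lebesgue_measure_itv /= lte_fin le_eqVlt => /predU1P[->|->].
    by rewrite ltxx subrr.
  by rewrite EFinB.
have lenE' s s' : s <= s' -> lam (`]s, s'] : set R) = (s' - s)%:E.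
  rewrite lebesgue_measure_itv /= lte_fin le_eqVlt => /predU1P[->|->].
    by rewrite ltxx subrr.
  by rewrite EFinB.
have R1 : (lam (A `&` [set t | (0 < t - t0)%R]) <= (128 / (cc * kap))%:E)%E.
  apply: (@one_side _ g kap cc del L A (fun t => t - t0)) => //.
  - exact: measurable_funB.
  - move=> s s' ss; rewrite (_ : [set t | _] = `[t0 + s, t0 + s'[%classic).
      by rewrite lenE ?lerD2l// lee_fin; lra.
    by apply/seteqP; split => t /=; rewrite in_itv/= => /andP[h1 h2]; apply/andP; split; lra.
  - by move=> M; have [t [Lt ht _]] := exists_right (M + t0) kap0; exists t => //; rewrite ltrBrDr.
  move=> t Lt; rewrite subr_gt0 => tt x x01.
  have := tp t x Lt (negbT (lt_eqF tt)) x01.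
  rewrite (min_l (ltW tt)) (max_r (ltW tt)) /mix.
  rewrite (_ : sublevel _ _ = `]t0, t[%classic)//.
  by apply/seteqP; split => u; rewrite /sublevel /= in_itv/= => /andP[h1 h2]; apply/andP; split; lra.
have R2 : (lam (A `&` [set t | (0 < t0 - t)%R]) <= (128 / (cc * kap))%:E)%E.
  apply: (@one_side _ g kap cc del L A (fun t => t0 - t)) => //.
  - exact: measurable_funB.
  - move=> s s' ss; rewrite (_ : [set t | _] = `]t0 - s', t0 - s]%classic).
      by rewrite lenE' ?lerB// lee_fin; lra.
    by apply/seteqP; split => t /=; rewrite in_itv/= => /andP[h1 h2]; apply/andP; split; lra.
  - move=> M; have [t [Lt ht _]] := exists_left (t0 - M) kap0.
    by exists t => //; rewrite ltrBrDr addrC -ltrBrDr.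
  move=> t Lt; rewrite subr_gt0 => tt x x01.
  have := tp t x Lt (negbT (gt_eqF tt)) x01.
  rewrite (min_r (ltW tt)) (max_l (ltW tt)) /mix.
  rewrite (_ : sublevel _ _ = `]t, t0[%classic)//.
  by apply/seteqP; split => u; rewrite /sublevel /= in_itv/= => /andP[h1 h2]; apply/andP; split; lra.
have mO (f : R -> R) : measurable_fun setT (f : measurableTypeR R -> R) ->
    measurable (A `&` [set t | 0 < f t]).
  move=> mf; apply: measurableI => //; rewrite (_ : [set t | _] = f @^-1` `]0, +oo[%classic).
    by rewrite -[_ @^-1` _]setTI; exact: mf.
  by apply/seteqP; split => t /=; rewrite in_itv/= andbT.
pose U1 : set (measurableTypeR R) := A `&` [set t | 0 < t - t0].
pose U2 : set (measurableTypeR R) := A `&` [set t | 0 < t0 - t].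
pose U3 : set (measurableTypeR R) := [set t0].
have m1 : measurable U1 by apply: mO; exact: measurable_funB.
have m2 : measurable U2 by apply: mO; exact: measurable_funB.
have m3 : measurable U3 by exact: measurable_set1.
have l3 : lam U3 = 0%E by exact: lebesgue_measure_set1.
have -> : 256 / (cc * kap) = 128 / (cc * kap) + 128 / (cc * kap) by lra.
rewrite EFinD; apply: le_trans (leeD R1 R2).
apply: (@le_trans _ _ (lam (U1 `|` U2) + lam U3)%E); last first.
  by rewrite l3 adde0; exact: measureU2.
apply: (@le_trans _ _ (lam (U1 `|` U2 `|` U3))); last first.
  by apply: measureU2 => //; exact: measurableU.
apply: le_measure; rewrite ?inE//.
  by do 2? apply: measurableU.
move=> t At; rewrite /U1 /U2 /U3 /= !subr_gt0; case: (ltgtP t t0) => h; last by right.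
  by left; right.
by left; left.
Qed.

Hypothesis volume_gt : ((262 / cc)%:E < \int[lam]_t (g t)%:E)%E.

(** If the deficit stayed above e, its infimum over L would be a positive del, nearly attained at
    some t0. Then [high_set_le] and [volume_le] bound the volume by 256 / cc + 6 / cc, against
    [volume_gt]. *)
Lemma exists_near_full e : 0 < e -> exists2 t, L t & kap - g t < e.
Proof.
move=> e0; apply: contrapT => H.
pose S := [set kap - g t | t in L].
have He t : L t -> e <= kap - g t.
  by move=> Lt; rewrite leNgt; apply/negP => gt; apply: H; exists t.
have S0 : S !=set0.
  by have [t [Lt _ _]] := exists_left 0 kap0; exists (kap - g t), t.
have lbS : lbound S e by move=> _ [t Lt <-]; exact: He.
have d0 : 0 < inf S by apply: lt_le_trans e0 _; exact: lb_le_inf.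
have dS t : L t -> inf S <= kap - g t.
  by move=> Lt; apply: ge_inf; [exists e|exists t].
have [_ [t0 Lt0 <-] ht0] : exists2 y, S y & y < 2 * inf S.
  by apply: inf_lt => //; lra.
have Al := high_set_le d0 dS Lt0 (ltW ht0).
have : (\int[lam]_t (g t)%:E <= (262 / cc)%:E)%E.
  apply: (le_trans volume_le).
  have -> : 262 / cc = kap * (256 / (cc * kap)) + 6 / cc by field; rewrite !gt_eqF.
  by rewrite [X in (_ <= X)%E]EFinD leeD// EFinM; apply: lee_wpmul2l => //; rewrite lee_fin ltW.
by rewrite leNgt volume_gt.
Qed.

Lemma two_kap_le : 2 * kap <= P.
Proof.
apply/ler_addgt0Pr => e e0.
have e2 : 0 < e / 2 by rewrite divr_gt0.
have [t Lt ht] := exists_near_full e2.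
have [s [Ls ts _]] := exists_right t kap0.
have x0 : 0 <= (0 : R) <= 1 by rewrite lexx ler01.
have := two_point Lt Ls (negbT (lt_eqF ts)) x0.
by rewrite expr0n !mul0r addr0; lra.
Qed.

(** With an almost full slice as base point, the first-order gain x cc mix is bounded by a multiple
    of x^2; taking x small forces it to vanish. *)
Lemma mix_eq0 p q : L p -> L q -> p < q -> mix g kap p q <= 0.
Proof.
move=> Lp Lq pq.
have B u t x e : L u -> L t -> t != u -> 0 <= x <= 1 -> kap - g t < e ->
    x * (cc * mix g kap (Num.min t u) (Num.max t u)) <= 2 * e + x ^+ 2 * kap.
  move=> Lu Lt tu x01 te; have := two_point Lt Lu tu x01.
  have : x ^+ 2 * (kap - g u) <= x ^+ 2 * kap by rewrite ler_wpM2l ?sqr_ge0// gerBl.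
  by move: P_le; lra.
(* When the almost full height t falls between p and q, the interval is split there and both halves
   are estimated from t; hence the factor 2 and the choice e / 4. *)
have x_le x : 0 <= x <= 1 -> x * (cc * mix g kap p q) <= 2 * (x ^+ 2 * kap).
  move=> x01; apply/ler_addgt0Pr => e e0.
  have e4 : 0 < e / 4 by rewrite divr_gt0.
  have [t Lt ht] := exists_near_full e4.
  have [x0 x1] := andP x01.
  have xk : 0 <= x ^+ 2 * kap by rewrite mulr_ge0 ?sqr_ge0 ?ltW.
  have M s r s' r' : s <= s' -> r' <= r -> x * (cc * mix g kap s' r') <= x * (cc * mix g kap s r).
    by move=> ss rr; rewrite ler_wpM2l// ler_pM2l// mix_le.
  have [tp|pt] := leP t p.
    have tq : t < q by exact: le_lt_trans pq.
    have := B q t x _ Lq Lt (negbT (lt_eqF tq)) x01 ht; rewrite (min_l (ltW tq)) (max_r (ltW tq)).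
    by have := M t q p q tp (lexx _); lra.
  have [qt|tq] := leP q t.
    have := B p t x _ Lp Lt (negbT (gt_eqF pt)) x01 ht; rewrite (min_r (ltW pt)) (max_l (ltW pt)).
    by have := M p t p q (lexx _) qt; lra.
  have := B q t x _ Lq Lt (negbT (lt_eqF tq)) x01 ht; rewrite (min_l (ltW tq)) (max_r (ltW tq)).
  have := B p t x _ Lp Lt (negbT (gt_eqF pt)) x01 ht; rewrite (min_r (ltW pt)) (max_l (ltW pt)).
  by rewrite (mix_split mg g0 gk pt tq) !mulrDr; lra.
rewrite leNgt; apply/negP => m0.
pose m := cc * mix g kap p q; have mm0 : 0 < m by rewrite mulr_gt0.
have m3 := mix_le3 Lp Lq pq.
have k40 : 0 < 4 * kap by rewrite mulr_gt0.
have x0 : 0 < m / (4 * kap) by rewrite divr_gt0.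
(* For this x the right-hand side is x m / 2, less than x m; it is an admissible value since m <= 3
   kap. *)
have := x_le (m / (4 * kap)); rewrite (ltW x0) ler_pdivrMr// mul1r => /(_ _)/wrap[].
  by rewrite /=; move: m3 kap0; rewrite -/m; lra.
rewrite -/m; set x := m / _.
have -> : 2 * (x ^+ 2 * kap) = x * (m / 2) by rewrite /x; field; rewrite gt_eqF.
by rewrite ler_pM2l//; lra.
Qed.

(** The integral of g (kap - g) over the line is zero, so g is almost everywhere 0 or kap, and there
    is no gap between full slices. The interval is spanned by the infimum and the supremum of the
    full heights. *)
Lemma profile_slab : exists a b, a <= b /\
  {ae lam, forall t, g t = kap * \1_(`[a, b]%classic) t}.
Proof.
have I0 : (\int[lam]_t `|(EFin \o gh) t| = 0)%E.
  transitivity (\int[lam]_t (gh t)%:E)%E.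
    by apply: eq_integral => t _; rewrite /= ger0_norm.
  apply/eqP; rewrite eq_le; apply/andP; split.
    by apply: integral_mix_le => p q; exact: mix_eq0.
  by apply: integral_ge0 => t _; rewrite lee_fin.
have mEgh : measurable_fun setT (EFin \o gh : measurableTypeR R -> \bar R).
  exact/measurable_EFinP.
have [N [mN N0 HN]] := (ae_eq_integral_abs lam measurableT mEgh).1 I0.
have gh_eq0 t : ~ N t -> g t = 0 \/ g t = kap.
  move=> Nt; have : gh t = 0.
    by apply: contrapT => h; apply: Nt; apply: HN => /= H; apply: h; have [] := H I.
  rewrite /gh => /eqP; rewrite mulf_eq0 => /orP[/eqP->|]; first by left.
  by rewrite subr_eq0 => /eqP; right.
pose L1 : set (measurableTypeR R) := L `\` N.
have mL1 : measurable L1 by exact: measurableD.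
have L10 : lam (~` L1) = 0%E.
  apply/eqP; rewrite eq_le measure_ge0 andbT.
  rewrite -[X in (_ <= X)%E]adde0 -{1}L0 -N0.
  apply: (@le_trans _ _ (lam (~` L `|` N))); last first.
    by apply: measureU2 => //; exact: measurableC.
  apply: le_measure; rewrite ?inE//; first exact: measurableC.
    by apply: measurableU => //; exact: measurableC.
  by move=> t /=; rewrite /L1 => /not_andP[?|/contrapT ?]; [left|right].
(* The values -1, 1, -1 at heights s < p < q < r, with g s < kap, give 3 kap - g s <= P when g q =
   0, which contradicts P <= 2 kap. *)
have F1 p q r : L1 p -> L1 q -> L1 r -> p < q -> q < r -> g p = kap -> g r = kap -> g q = kap.
  move=> [Lp Np] [Lq Nq] [Lr Nr] pq qr gp gr.
  have [gq|//] := gh_eq0 q Nq.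
  have [s [Ls sp gs]] := exists_left p kap0.
  have N1 : `|- 1 : R| <= 1 by rewrite normrN normr1.
  have s1 : (1 : R) ^+ 2 + 0 ^+ 2 <= 1 by rewrite expr0n expr1n addr0.
  have := FP sp pq qr Ls Lp Lq Lr N1 N1 (lexx 0) s1.
  by rewrite gp gq gr; move: P_le gs; lra.
have k1 t : L1 t -> g t < kap -> g t = 0.
  by move=> [_ Nt] gt; have [//|gk'] := gh_eq0 t Nt; move: gt; rewrite gk' ltxx.
pose S := [set t | L1 t /\ g t = kap].
have [s [Ls gs]] : S !=set0.
  apply: contrapT => SE.
  have : (\int[lam]_t (g t)%:E = 0)%E.
    rewrite (ae_eq_integral (cst 0%E))//; [by rewrite integral0|exact/measurable_EFinP|].
    exists (~` L1); split => //; first exact: measurableC.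
    move=> t /= H Lt; apply: H => _; congr EFin.
    have [//|gt] := gh_eq0 t Lt.2.
    by exfalso; apply: SE; exists t.
  have v0 : 0 <= 262 / cc by rewrite divr_ge0// ltW.
  by move=> gE; move: volume_gt; rewrite gE lte_fin ltNge v0.
have infR : lam (L1 `&` `]s, +oo[%classic) = +oo%E.
  have mI : measurable (`]s, +oo[%classic : set (measurableTypeR R)) by exact: measurable_itv.
  by rewrite (full_meet mL1 L10 mI) lebesgue_measure_itv /= ltry.
have infL : lam (L1 `&` `]-oo, s[%classic) = +oo%E.
  have mI : measurable (`]-oo, s[%classic : set (measurableTypeR R)) by exact: measurable_itv.
  by rewrite (full_meet mL1 L10 mI) lebesgue_measure_itv /= ltNyr.
have mR : measurable (L1 `&` `]s, +oo[%classic).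
  by apply: measurableI => //; exact: measurable_itv.
have mLl : measurable (L1 `&` `]-oo, s[%classic).
  by apply: measurableI => //; exact: measurable_itv.
have [r [_ [Lr1 /= sr] gr]] := exists_small mR infR kap0.
have [l [_ [Ll1 /= ls] gl]] := exists_small mLl infL kap0.
rewrite in_itv/= andbT in sr; rewrite in_itv/= in ls.
have kapN0 : kap <> 0 by move=> k0; move: kap0; rewrite k0 ltxx.
have Sr t : S t -> t <= r.
  move=> [Lt gt]; rewrite leNgt; apply/negP => rt; apply: kapN0.
  by rewrite -(F1 s r t Ls Lr1 Lt sr rt gs gt) k1.
have Sl t : S t -> l <= t.
  move=> [Lt gt]; rewrite leNgt; apply/negP => tl; apply: kapN0.
  by rewrite -(F1 t l s Lt Ll1 Ls tl ls gt gs) k1.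
have Ss : S !=set0 by exists s.
have hub : has_ubound S by exists r => t /Sr.
have hlb : has_lbound S by exists l => t /Sl.
have inS t : S t -> inf S <= t <= sup S.
  by move=> St; rewrite ge_inf//= ub_le_sup.
exists (inf S), (sup S); split.
  by have /andP[] := inS s (conj Ls gs); exact: le_trans.
(* The two endpoints join the exceptional null set: every other point of the interval lies strictly
   between two full heights. *)
exists (~` L1 `|` ([set inf S] `|` [set sup S])); split.
- by apply: measurableU; [exact: measurableC|apply: measurableU].
- rewrite measureU0//; [exact: measurableC|by apply: measurableU|].
  by rewrite measureU0//; exact: lebesgue_measure_set1.
move=> t /= H; apply: contrapT => /not_orP[/contrapT Lt /not_orP[ta tb]]; apply: H.
rewrite indicE; have [gt|gt] := gh_eq0 t Lt.2; last first.
  by rewrite mem_set ?mulr1//= in_itv/= inS.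
rewrite memNset ?mulr0//= in_itv/= => /andP[at_ tb'].
have [p [Lp gp] pt] : exists2 p, S p & p < t.
  by apply: inf_lt => //; rewrite lt_neqAle at_ andbT; apply/eqP => e; apply: ta.
have [q [Lq gq] qt] : exists2 q, S q & t < q.
  by apply: sup_gt => //; rewrite lt_neqAle tb' andbT; apply/eqP => e; apply: tb.
by apply: kapN0; rewrite -(F1 p t q Lp Lt Lq pt qt gp gq).
Qed.

End profile_rigidity.

(** * Perimeter of a slab *)

Lemma continuous_bounded_on {R : realType} m (f : 'rV[R]_m -> R) (Q : set 'rV[R]_m) :
  continuous f -> compact Q -> exists M, forall x, Q x -> `|f x| <= M.
Proof.
move=> cf cQ; have : compact (f @` Q).
  by apply: continuous_compact => //; exact: continuous_subspaceT.
move=> /compact_bounded[M [_ HM]]; exists (`|M| + 1) => x Qx.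
by apply: (HM (`|M| + 1)); [rewrite ltr_pwDr// ler_norm|exists x].
Qed.

Lemma integrable_continuous_compact {R : realType} m (f : 'rV[R]_m -> R)
    (Q : set (borel_rV R m)) :
  continuous f -> compact (Q : set 'rV[R]_m) -> (leb m).-integrable Q (EFin \o f).
Proof.
move=> cf cQ; have [M HM] := continuous_bounded_on cf cQ.
apply: measurable_bounded_integrable.
- exact: compact_measurable_rV.
- exact: leb_compact_fin.
- apply: measurable_funTS; exact: continuous_measurable_rV.
- exists M; split; first exact: num_real.
  by move=> x Mx t Qt; apply: le_trans (HM t Qt) (ltW Mx).
Qed.

Section slab.
Context {R : realType}.
Local Notation lam := (@lebesgue_measure R).
Variables (n : nat) (K : set 'rV[R]_n) (phi : 'rV[R]_n.+1 -> R) (a b : R).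
Hypotheses (cK : compact K) (cphi : continuous phi) (ab : a < b).

Let slab : set 'rV[R]_n.+1 := cyl K `[a, b].

Let cslab : compact slab.
Proof. by apply: compact_cyl => //; exact: segment_compact. Qed.

Let mslab : measurable (slab : set (borel_rV R n.+1)).
Proof. exact: compact_measurable_rV. Qed.

Let mK : measurable (K : set (borel_rV R n)).
Proof. exact: compact_measurable_rV. Qed.

Section vertical.
Local Notation e := (delta_mx 0 ord_max : 'rV[R]_n.+1).
Hypotheses (dphi : forall x, derivable phi x e) (cD : continuous (fun x => 'D_e phi x)).
Hypothesis phi1 : forall x, `|phi x| <= 1.

Let snoc_e (y : 'rV[R]_n) t : snoc_rV (y, t) = snoc_rV (y, 0) + t *: e.
Proof.
have -> : e = snoc_rV (0, 1).
  apply/rowP => i; rewrite [LHS]mxE eqxx; case: (unliftP ord_max i) => [j|] ->.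
    by rewrite snoc_rV_lift mxE eq_sym (negbTE (neq_lift _ _)).
  by rewrite snoc_rV_last eqxx.
by rewrite snoc_rVZ snoc_rVD scaler0 addr0 mulr1 add0r.
Qed.

Let line_integral (y : 'rV[R]_n) :
  (\int[lam]_(t in `[a, b]) ('D_e phi (snoc_rV (y, t)))%:E =
   (phi (snoc_rV (y, b)) - phi (snoc_rV (y, a)))%:E)%E.
Proof.
have dF (t : R) : is_derive t 1 (fun t => phi (snoc_rV (y, t))) ('D_e phi (snoc_rV (y, t))).
  have := is_derive_along dphi (snoc_rV (y, 0)) t; rewrite -snoc_e.
  by congr is_derive; apply/funext => s; rewrite -snoc_e.
have csn : continuous (fun t : R => snoc_rV (y, t)).
  apply: continuous_rV => j; case: (unliftP ord_max j) => [k|] -> t.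
    rewrite (_ : (fun _ => _) = cst (y 0 k)); first exact: cst_continuous.
    by apply/funext => s; rewrite snoc_rV_lift.
  rewrite (_ : (fun _ => _) = id); first exact: cvg_id.
  by apply/funext => s; rewrite snoc_rV_last.
rewrite EFinB; apply: (@continuous_FTC2 R (fun t => 'D_e phi (snoc_rV (y, t))) (fun t => phi (snoc_rV (y, t))) a b ab).
- apply: continuous_subspaceT => t.
  by apply: (@continuous_comp _ _ _ (fun t : R => snoc_rV (y, t)) (fun x => 'D_e phi x)); [exact: csn|exact: cD].
- have cF : continuous (fun t : R => phi (snoc_rV (y, t))).
    move=> t; apply: (@continuous_comp _ _ _ (fun t : R => snoc_rV (y, t)) phi); first exact: csn.
    exact: cphi.
  split.
  + by move=> t _; have [] := dF t.
  + by apply: cvg_at_right_filter; exact: cF.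
  + by apply: cvg_at_left_filter; exact: cF.
by move=> t _; rewrite derive1E; have [_ ->] := dF t.
Qed.

(** Integrated along a generator, the vertical derivative is the difference of phi at the two ends,
    hence at most 2. *)
Lemma slab_vertical : (\int[leb n.+1]_(x in slab) ('D_e phi x)%:E <= 2%:E * leb n K)%E.
Proof.
have iD := integrable_continuous_compact cD cslab.
have iD' : (leb n.+1).-integrable setT ((fun x => ('D_e phi x)%:E) \_ slab).
  by apply/(integrable_mkcond _ mslab).
rewrite (integral_mkcond (slab : set (borel_rV R n.+1))) (fubini_snoc1 iD').
pose F (y : borel_rV R n) : R := phi (snoc_rV (y, b)) - phi (snoc_rV (y, a)).
have cF : continuous (F : 'rV[R]_n -> R).
  have cs t : continuous (fun y : 'rV[R]_n => phi (snoc_rV (y, t))).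
    move=> y; apply: (@continuous_comp _ _ _ (fun y : 'rV[R]_n => snoc_rV (y, t)) phi); last exact: cphi.
    move: y; apply: continuous_rV => j; case: (unliftP ord_max j) => [k|] -> y.
      rewrite (_ : (fun _ => _) = (fun y : 'rV[R]_n => y 0 k)); first exact: coord_continuous.
      by apply/funext => s; rewrite snoc_rV_lift.
    rewrite (_ : (fun _ => _) = cst t); first exact: cst_continuous.
    by apply/funext => s; rewrite snoc_rV_last.
  by move=> y; exact: (continuousB (cs b y) (cs a y)).
have -> : (\int[leb n]_y \int[lam]_t ((fun x => ('D_e phi x)%:E) \_ slab) (snoc_rV (y, t)) =
    \int[leb n]_(y in K) (F y)%:E)%E.
  rewrite [RHS]integral_mkcond; apply: eq_integral => y _; rewrite [RHS]patchE.
  case: ifPn => [/set_mem Ky|/negP nKy].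
    rewrite /F -line_integral [RHS]integral_mkcond; apply: eq_integral => t _.
    rewrite !patchE; congr (if _ then _ else _); rewrite /slab.
    apply/idP/idP => /set_mem; rewrite ?cylE /= ?rinit_snoc ?rlast_snoc => h; apply/mem_set.
      by case: h.
    by split; rewrite ?rinit_snoc ?rlast_snoc.
  rewrite integral0_eq// => t _; rewrite patchE ifN//; apply/negP => /set_mem.
  by rewrite /slab cylE /= rinit_snoc => -[Ky _]; apply: nKy; exact: mem_set.
rewrite -integral_cst//; apply: le_integral => //.
- exact: integrable_continuous_compact.
- apply/integrableP; split; first exact: measurable_cst.
  by under eq_integral do rewrite /= normr_nat; rewrite integral_cst// lte_mul_pinfty ?lee_fin// leb_compact_fin.
move=> y _; rewrite lee_fin (le_trans (ler_norm _))// (le_trans (ler_normB _ _))//.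
by rewrite -[2%:R]/(1 + 1 : R) lerD.
Qed.

End vertical.

Section horizontal.
Variables (i : 'I_n) (Q : set 'rV[R]_n.+1).
Local Notation e := (delta_mx 0 (lift ord_max i) : 'rV[R]_n.+1).
Hypotheses (dphi : forall x, derivable phi x e) (cD : continuous (fun x => 'D_e phi x)).
Hypotheses (cQ : compact Q) (phiQ : forall x, ~ Q x -> phi x = 0) (QC : Q `<=` cyl K setT).

(** The integral over R^n x [a, b] is invariant under horizontal translation, so its derivative
    along a horizontal direction is zero. *)
Lemma slab_horizontal : (\int[leb n.+1]_(x in slab) ('D_e phi x)%:E = 0)%E.
Proof.
pose B : set (borel_rV R n.+1) := [set x | `[a, b]%classic (rlast x)].
have mB : measurable B.
  by rewrite -[B]setTI; apply: (@measurable_coord R n.+1 ord_max) => //; exact: measurable_itv.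
have DQ x : ~ Q x -> 'D_e phi x = 0.
  by apply: (derive0_out _ (compact_closed _ cQ)) => //; exact: norm_hausdorff.
(* Since the support of phi lies over K, the slab may be replaced by R^n x [a, b], which horizontal
   translations preserve. *)
have -> : (\int[leb n.+1]_(x in slab) ('D_e phi x)%:E =
    \int[leb n.+1]_(x in B) ('D_e phi x)%:E)%E.
  rewrite integral_mkcond [RHS]integral_mkcond; apply: eq_integral => x _.
  rewrite !patchE; have [Qx|nQx] := pselect (Q x); last by rewrite DQ//; do 2 case: ifPn.
  congr (if _ then _ else _); apply/idP/idP => /set_mem h; apply/mem_set.
    by move: h; rewrite /slab cylE => -[].
  by rewrite /slab cylE; split => //; have := QC Qx; rewrite cylE => -[].
pose J (s : R) := \int[leb n.+1]_(x in B) phi ((x : 'rV[R]_n.+1) - s *: e).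
have dJ : is_derive (0 : R) 1 J (- \int[leb n.+1]_(x in B) 'D_e phi ((x : 'rV[R]_n.+1) - 0 *: e)).
  exact: (is_derive_integral_line cphi dphi cD cQ phiQ 0 mB).
have JE s : J s = J 0.
  rewrite /J [LHS]Rintegral_indicl [RHS]Rintegral_indicl; congr fine.
  pose f (x : borel_rV R n.+1) : \bar R := (\1_B x * phi (x : 'rV[R]_n.+1))%:E.
  have fi : (leb n.+1).-integrable setT f.
    apply: integrable_indicl => //.
    have := integrable_line 0 cphi cQ phiQ 0 measurableT.
    by apply: eq_integrable => // x _ /=; rewrite scaler0 subr0.
  transitivity (\int[leb n.+1]_x f x)%E; last first.
    by apply: eq_integral => x _; rewrite /f scale0r subr0.
  rewrite -(integral_translate (- (s *: e)) fi); apply: eq_integral => x _.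
  rewrite /f !indicE; congr (_ * _)%:E; congr ((_ : bool)%:R).
  have re : rlast ((x : 'rV[R]_n.+1) - s *: e) = rlast x.
    by rewrite /rlast !mxE (negbTE (neq_lift _ _)) andbF mulr0 subr0.
  by apply/idP/idP => /set_mem h; apply/mem_set; move: h; rewrite /B /= re.
have d0 : is_derive (0 : R) 1 J 0.
  have -> : J = cst (J 0) by apply/funext => s; exact: JE.
  exact: is_derive_cst.
have := is_derive_uniq dJ d0 => /eqP; rewrite oppr_eq0 => /eqP IE.
have iD : (leb n.+1).-integrable B (fun x => ('D_e phi x)%:E).
  apply: (@integrableS _ _ _ _ setT) => //.
  have := integrable_line 0 cD cQ DQ 0 measurableT.
  by apply: eq_integrable => // x _ /=; rewrite scaler0 subr0.
rewrite -[LHS]fineK; last exact: integrable_fin_num iD.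
congr EFin; rewrite -[RHS]IE; congr fine; apply: eq_integral => x _.
by rewrite scale0r subr0.
Qed.

End horizontal.
End slab.

Lemma coord_le_enorm {R : realType} m (x : 'rV[R]_m) i : `|x 0 i| <= enorm x.
Proof.
rewrite /enorm -sqrtr_sqr ler_wsqrtr// (bigD1 i)//= lerDl.
by apply: sumr_ge0 => j _; exact: sqr_ge0.
Qed.

(** Split the divergence: the last coordinate is handled by [slab_vertical], all others by
    [slab_horizontal]. *)
Lemma perimeter_slab {R : realType} n (K : set 'rV[R]_n) (a b : R) : compact K -> a < b ->
  (perimeter (cyl K setT) (cyl K `[a, b]) <= 2%:E * lebesgue_rV R n K)%E.
Proof.
move=> cK ab; have cS : compact (cyl K `[a, b]%classic).
  by apply: compact_cyl => //; exact: segment_compact.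
have mS : measurable (cyl K `[a, b] : set (borel_rV R n.+1)) by exact: compact_measurable_rV.
rewrite lebesgue_rV_leb; last exact: compact_measurable_rV.
apply: ge_ereal_sup => _ [xi [sxi cQ QU xi1] <-].
set Q := closure _ in cQ QU.
have xiQ j x : ~ Q x -> xi x 0 j = 0.
  move=> nQ; have /eqP-> : xi x == 0; last by rewrite mxE.
  by apply: contrapT => /negP h; apply: nQ; exact: subset_closure.
have QC : Q `<=` cyl K setT by move=> x /QU; exact: interior_subset.
have cx j : continuous (fun x => xi x 0 j) by case: (sxi j 0%N).
have dx j x : derivable (fun x => xi x 0 j) x (delta_mx 0 j).
  by have [_ /(_ j) [+ _]] := sxi j 1%N; apply.
have cDx j : continuous (fun x => 'D_(delta_mx 0 j) (fun y => xi y 0 j) x).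
  by have [_ /(_ j) [_ []]] := sxi j 1%N.
have mdiv : measurable_fun setT (fun x : borel_rV R n.+1 => (divergence xi x)%:E).
  apply/measurable_EFinP; rewrite /divergence; apply: measurable_sum => j.
  exact: continuous_measurable_rV.
have intD j : (leb n.+1).-integrable (cyl K `[a, b] : set (borel_rV R n.+1))
    (fun x => ('D_(delta_mx 0 j) (fun y => xi y 0 j) x)%:E).
  exact: integrable_continuous_compact.
rewrite integral_lebesgue_rV//; last exact: measurable_funTS.
rewrite /divergence; under eq_integral do rewrite -sumEFin.
rewrite integral_sum// big_ord_recr /= big1 ?add0e.
  apply: slab_vertical => // x; apply: le_trans (coord_le_enorm _ _) (xi1 x).
move=> j _.
have -> : widen_ord (leqnSn n) j = lift ord_max j by apply/val_inj; rewrite /= /bump leqNgt ltn_ord.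
exact: (slab_horizontal a b (cx _) (dx _) (cDx _) cQ (xiQ _) QC).
Qed.

(** * Rigidity for Borel sets of large volume *)

Section borel_rigidity.
Context {R : realType}.
Local Notation lam := (@lebesgue_measure R).
Variables (n : nat) (K : set 'rV[R]_n).
Hypothesis K_body : convex_body K.

Let kap : R := fine (leb n K°).

Let cK : compact K. Proof. by case: K_body. Qed.

Lemma leb_bodyE : leb n K = kap%:E.
Proof.
by rewrite -leb_convex_interior// fineK// ge0_fin_numE// leb_convex_interior// leb_compact_fin.
Qed.

Lemma leb_body_gt0 : 0 < kap.
Proof.
rewrite -lte_fin -leb_bodyE -leb_convex_interior//.
by have [_ _ [x Kx]] := K_body; apply: leb_open_gt0 Kx; exact: open_interior.
Qed.

Let mK : measurable (K : set (borel_rV R n)).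
Proof. exact: compact_measurable_rV. Qed.

Lemma compact_slab a b : compact (cyl K `[a, b]%classic).
Proof. by apply: compact_cyl => //; exact: segment_compact. Qed.

Lemma measurable_slab a b : measurable (cyl K `[a, b] : set (borel_rV R n.+1)).
Proof. apply: compact_measurable_rV; exact: compact_slab. Qed.

Lemma slice_slab a b t :
  slice (cyl K `[a, b] : set (borel_rV R n.+1)) t = if t \in `[a, b] then K else set0.
Proof.
rewrite /slice cylE; apply/seteqP; split => y /=; rewrite rinit_snoc rlast_snoc.
  by move=> [Ky ->].
by case: ifPn.
Qed.

Lemma leb_slab a b : a <= b -> leb n.+1 (cyl K `[a, b]) = ((b - a) * kap)%:E.
Proof.
move=> ab; rewrite (leb_slice (measurable_slab a b)).
transitivity (\int[lam]_(t in `[a, b]) kap%:E)%E.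
  rewrite [RHS]integral_mkcond; apply: eq_integral => t _.
  rewrite patchE slice_slab mem_setE; case: ifPn => _; first exact: leb_bodyE.
  exact: measure0.
rewrite integral_cst; last exact: measurable_itv.
rewrite [X in (_ * X)%E]lebesgue_measure_itv /= lte_fin mulrC; move: ab; rewrite le_eqVlt => /predU1P[->|->].
  by rewrite ltxx subrr mulr0 mule0.
by rewrite -EFinB -EFinM.
Qed.

(** The threshold V is the constant 262 / cc of the one-dimensional analysis and depends only on K.
    P is any real bound for the test integrals, so the statement yields both the lower bound on the
    perimeter and the case of equality. *)
Lemma borel_rigidity : exists2 V : R, 0 <= V &
  forall (B : set (borel_rV R n.+1)) P, measurable B -> B `<=` cyl K° setT ->
    (forall xi, test_field (cyl K setT)° xi ->
      (\int[leb n.+1]_(x in B) (divergence xi x)%:E <= P%:E)%E) ->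
    leb n.+1 B \is a fin_num -> (V%:E < leb n.+1 B)%E -> P <= 2 * kap ->
    2 * kap <= P /\
    exists a b, a <= b /\ leb n.+1 (B `+` cyl K `[a, b]) = 0%E.
Proof.
have [M M0 KM] := compact_box cK.
pose cc : R := (4 * fine (leb n (box (2 * M))) * (n.+1%:R * (2 * M)))^-1.
have cc0 : 0 < cc by rewrite invr_gt0 !mulr_gt0// (leb_bigbox_gt0 K_body M0 KM).
exists (262 / cc); first by rewrite divr_ge0// ltW.
move=> B P mB BK HP finB VB Pk.
pose g := slice_vol B.
have mg : measurable_fun setT (g : measurableTypeR R -> R) by exact: measurable_slice_vol BK.
have g0 t : 0 <= g t by exact: (slice_vol_ge0 K_body mB BK).
have gk t : g t <= kap by exact: (slice_vol_le K_body mB BK).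
have gE : leb n.+1 B = (\int[lam]_t (g t)%:E)%E.
  rewrite (leb_slice mB); apply: eq_integral => t _.
  exact: (leb_sliceE K_body mB BK).
have gI : lam.-integrable setT (EFin \o g).
  apply/integrableP; split; first exact/measurable_EFinP.
  apply: (@le_lt_trans _ _ (leb n.+1 B)); last by rewrite -ge0_fin_numE.
  by rewrite gE; apply: ge0_le_integral => //; [exact/measurable_EFinP/measurableT_comp|exact/measurable_EFinP|move=> t _; rewrite /= ger0_norm].
have gL : locally_integrable setT g.
  split => //; first exact: openT.
  move=> Q _ cQ; have /integrableP[_] := gI; apply: le_lt_trans.
  apply: ge0_subset_integral => //.
    exact: compact_measurable.
  by apply/measurable_EFinP; exact: measurableT_comp.
(* The one-dimensional analysis is run on the complement of N, a set of full measure made of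
   Lebesgue points of g. *)
have [N [mN N0 HN]] := lebesgue_differentiation gL.
have LN t : (~` N) t -> lebesgue_pt g t by move=> Nt; apply: contrapT => h; apply: Nt; exact: HN.
have mL : measurable (~` N) by exact: measurableC.
have L0 : lam (~` (~` N)) = 0%E by rewrite setCK.
have OF := one_field K_body M0 KM mB BK HP.
have FP p0 p1 p2 p3 gam1 gam2 gam3 b : p0 < p1 -> p1 < p2 -> p2 < p3 ->
    (~` N) p0 -> (~` N) p1 -> (~` N) p2 -> (~` N) p3 ->
    `|gam1| <= 1 -> `|gam3| <= 1 -> 0 <= b -> gam2 ^+ 2 + b ^+ 2 <= 1 ->
    gam1 * g p0 + (gam2 - gam1) * g p1 + (gam3 - gam2) * g p2 - gam3 * g p3 +
    b * (cc * mix g kap p1 p2) <= P.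
  move=> p01 p12 p23 /LN l0 /LN l1 /LN l2 /LN l3.
  exact: (four_point mg g0 gk cc0 OF p01 p12 p23 l0 l1 l2 l3).
have k0 := leb_body_gt0.
rewrite gE in VB.
split; first exact: (two_kap_le mg g0 gk k0 cc0 mL L0 gI FP Pk VB).
have [a [b [ab gab]]] := profile_slab mg g0 gk k0 cc0 mL L0 gI FP Pk VB.
exists a, b; split => //.
have mS := measurable_slab a b.
have mBS : measurable (B `+` cyl K `[a, b] : set (borel_rV R n.+1)).
  by apply: measurableU; exact: measurableD.
(* Compare slice by slice: at almost every height the slice of B has measure 0 or kap, exactly as
   the slice of the slab does, so the two differ by a null set. *)
rewrite (leb_slice mBS) (ae_eq_integral (cst 0%E))//; first by rewrite integral0.
  exact: measurable_leb_slice.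
have [N1 [mN1 N10 HN1]] := gab; exists N1; split; [exact: mN1|exact: N10|].
move=> t ht; apply: HN1 => gt; apply: ht => _ /=.
have -> : slice (B `+` cyl K `[a, b] : set (borel_rV R n.+1)) t =
    slice B t `+` slice (cyl K `[a, b] : set (borel_rV R n.+1)) t by [].
have lB := leb_sliceE K_body mB BK t; rewrite -/g gt in lB.
rewrite slice_slab; move: lB; rewrite indicE mem_setE; case: ifPn => tab lB.
  have BKt : slice B t `<=` K by move=> y /(slice_subset BK); exact: interior_subset.
  have -> : slice B t `+` K = K `\` slice B t.
    by apply/seteqP; split => y; [move=> [[/BKt By /(_ By)]|]|right].
  rewrite (measureD mK (measurable_slice t mB)) ?leb_compact_fin// (setIidr BKt).
  by rewrite [X in (_ - X)%E]lB [X in (X - _)%E]leb_bodyE mulr1 subee.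
rewrite setY0.
by rewrite [LHS]lB mulr0.
Qed.

End borel_rigidity.

(** * From Lebesgue measurable sets to Borel sets over the interior of K *)

Section competitor.
Context {R : realType}.
Variables (n : nat) (K : set 'rV[R]_n).
Hypothesis K_body : convex_body K.

Let cK : compact K. Proof. by case: K_body. Qed.

Lemma lebesgue_rV_setY_trans m (A B D : set 'rV[R]_m) :
  lebesgue_rV R m (A `+` B) = 0%E -> lebesgue_rV R m (B `+` D) = 0%E ->
  lebesgue_rV R m (A `+` D) = 0%E.
Proof.
move=> AB BD; apply/eqP; rewrite eq_le lebesgue_rV_ge0 andbT.
apply: (@le_trans _ _ (lebesgue_rV R m ((A `+` B) `|` (B `+` D)))).
  apply: lebesgue_rV_le => x [[Ax nDx]|[Dx nAx]].
    by have [Bx|nBx] := pselect (B x); [right; left|left; left].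
  by have [Bx|nBx] := pselect (B x); [left; right|right; right].
by apply: le_trans (lebesgue_rVU_le _ _) _; rewrite AB BD adde0.
Qed.

Lemma lebesgue_rV_setY m (A B : set 'rV[R]_m) : lebesgue_rV R m (A `+` B) = 0%E ->
  lebesgue_rV R m A = lebesgue_rV R m B.
Proof.
have H A' B' : lebesgue_rV R m (A' `+` B') = 0%E -> (lebesgue_rV R m A' <= lebesgue_rV R m B')%E.
  move=> AB; apply: (@le_trans _ _ (lebesgue_rV R m (B' `|` (A' `+` B')))).
    by apply: lebesgue_rV_le => x Ax; have [Bx|nBx] := pselect (B' x); [left|right; left].
  by apply: le_trans (lebesgue_rVU_le _ _) _; rewrite AB adde0.
by move=> AB; apply/eqP; rewrite eq_le !H// setYC.
Qed.

(** Take a Borel hull and remove the lateral boundary of the cylinder, which is null because the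
    boundary of K is. Integrals of divergences over the set are unchanged. *)
Lemma borel_competitor (E : set 'rV[R]_n.+1) : lebesgue_measurable E ->
    E `<=` cyl K setT -> lebesgue_rV R n.+1 E \is a fin_num ->
  exists B : set (borel_rV R n.+1), [/\ measurable B, B `<=` cyl K° setT,
    leb n.+1 B = lebesgue_rV R n.+1 E, lebesgue_rV R n.+1 (E `+` B) = 0%E &
    forall xi, test_field (cyl K setT)° xi ->
      (\int[leb n.+1]_(x in B) (divergence xi x)%:E =
       \int[lebesgue_rV R n.+1]_(x in E) (divergence xi x)%:E)%E].
Proof.
move=> mE EC finE; have [B0 [mB0 EB0 lB0 nB0]] := lebesgue_rV_borel mE finE.
have mKi : measurable (K° : set (borel_rV R n)) by apply: open_measurable_rV; exact: open_interior.
have mK : measurable (K : set (borel_rV R n)) by exact: compact_measurable_rV.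
pose S : set (borel_rV R n.+1) := cyl (K `\` K°) setT.
have mrinit : measurable_fun setT (@rinit R n : borel_rV R n.+1 -> borel_rV R n).
  apply: measurable_fun_rV => // i.
  rewrite (_ : (fun _ => _) = (fun x : borel_rV R n.+1 => (x : 'rV[R]_n.+1) 0 (lift ord_max i))).
    exact: measurable_coord.
  by apply/funext => x; rewrite mxE.
have cylmE (A : set 'rV[R]_n) : measurable (A : set (borel_rV R n)) ->
    measurable (cyl A setT : set (borel_rV R n.+1)).
  move=> mA; have -> : cyl A setT = @rinit R n @^-1` A.
    by rewrite cylE; apply/seteqP; split => x //= -[].
  by rewrite -[X in measurable X]setTI; exact: mrinit.
have mS : measurable S by apply: cylmE; exact: measurableD.
have S0 : lebesgue_rV R n.+1 S = 0%E.
  rewrite lebesgue_rV_leb// (leb_slice mS) integral0_eq// => t _.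
  have -> : slice S t = K `\` K°.
    by rewrite /slice /S cylE; apply/seteqP; split => y /=; rewrite rinit_snoc => // -[].
  rewrite measureD// ?leb_compact_fin// (setIidr (@interior_subset _ K)).
  rewrite [X in (_ - X)%E](leb_convex_interior K_body) subee//.
  by rewrite ge0_fin_numE// leb_compact_fin.
pose B : set (borel_rV R n.+1) := B0 `&` cyl K° setT.
have mCi : measurable (cyl K° setT : set (borel_rV R n.+1)) by exact: cylmE.
have mB : measurable B by exact: measurableI.
have EB : lebesgue_rV R n.+1 (E `+` B) = 0%E.
  apply/eqP; rewrite eq_le lebesgue_rV_ge0 andbT.
  apply: (@le_trans _ _ (lebesgue_rV R n.+1 ((B0 `\` E) `|` S))).
    apply: lebesgue_rV_le => x [[Ex nBx]|[[B0x _] nEx]]; last by left.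
    right; rewrite /S cylE; have := EC x Ex; rewrite cylE => -[Kx _]; split => //; split => //.
    by move=> Kix; apply: nBx; split; [exact: EB0|rewrite cylE].
  by apply: le_trans (lebesgue_rVU_le _ _) _; rewrite nB0 S0 adde0.
exists B; split => //.
- by move=> x [].
- exact: (etrans (esym (lebesgue_rV_leb mB)) (esym (lebesgue_rV_setY EB))).
move=> xi [sxi _ _ _].
have mdiv : measurable_fun setT (fun x : borel_rV R n.+1 => (divergence xi x)%:E).
  apply/measurable_EFinP; rewrite /divergence; apply: measurable_sum => j.
  apply: continuous_measurable_rV.
  by have [_ /(_ j) [_ []]] := sxi j 1%N.
rewrite -(integral_lebesgue_rV mB (measurable_funTS mdiv)).
apply/esym; apply: integral_lebesgue_rV_null => //.
exact: lebesgue_measurable_borel.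
Qed.

End competitor.

(** * Conclusion: slabs against arbitrary competitors *)

Theorem theorem3p9 (R : realType) (n : nat) (n_ge1 : (1 <= n)%N)
    (K : set 'rV[R]_n) (K_body : convex_body K) :
  let C : set 'rV[R]_n.+1 := cyl K setT in
  exists2 v0 : R, 0 < v0 &
  [/\ forall a b : R, a <= b ->
        (v0%:E <= lebesgue_rV R n.+1 (cyl K `[a, b]))%E ->
        isoperimetric_region C (cyl K `[a, b]),
      forall E : set 'rV[R]_n.+1, isoperimetric_region C E ->
        (v0%:E <= lebesgue_rV R n.+1 E)%E ->
        exists a b : R, a <= b /\
          lebesgue_rV R n.+1 (E `+` cyl K `[a, b]) = 0%E &
      forall v : R, v0 <= v -> profile C v = (2%:E * lebesgue_rV R n K)%E].
Proof.
move=> C; have cK : compact K by case: K_body.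
have [V V0 HV] := borel_rigidity K_body.
set kap := fine (leb n K°) in HV.
have k0 : 0 < kap := leb_body_gt0 K_body.
have KE : lebesgue_rV R n K = kap%:E.
  by rewrite lebesgue_rV_leb ?(leb_bodyE K_body)//; exact: compact_measurable_rV.
have mslab a b := measurable_slab K_body a b.
have slabE a b : a <= b -> lebesgue_rV R n.+1 (cyl K `[a, b]) = ((b - a) * kap)%:E.
  by move=> ab; rewrite lebesgue_rV_leb// (leb_slab K_body).
have slabC a b : cyl K `[a, b] `<=` C.
  by rewrite /C !cylE => x [].
have slab_le a b : a < b -> (perimeter C (cyl K `[a, b]) <= (2 * kap)%:E)%E.
  by move=> ab; rewrite EFinM -KE; exact: perimeter_slab.
have rigid E P : lebesgue_measurable E -> E `<=` C -> lebesgue_rV R n.+1 E \is a fin_num ->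
    (V%:E < lebesgue_rV R n.+1 E)%E -> (perimeter C E <= P%:E)%E -> P <= 2 * kap ->
    2 * kap <= P /\ exists a b, a <= b /\ lebesgue_rV R n.+1 (E `+` cyl K `[a, b]) = 0%E.
  move=> mE EC finE VE PE Pk.
  have [B [mB BK lB EB intB]] := borel_competitor K_body mE EC finE.
  have HP xi : test_field (cyl K setT)° xi ->
      (\int[leb n.+1]_(x in B) (divergence xi x)%:E <= P%:E)%E.
    move=> txi; rewrite intB//; apply: le_trans PE; apply: ereal_sup_ubound.
    by exists xi.
  rewrite -lB in finE VE.
  have [kP [a [b [ab BS]]]] := HV B P mB BK HP finE VE Pk.
  split => //; exists a, b; split => //.
  apply: lebesgue_rV_setY_trans EB _; rewrite lebesgue_rV_leb//.
  by apply: measurableU; exact: measurableD.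
have lower E : lebesgue_measurable E -> E `<=` C -> lebesgue_rV R n.+1 E \is a fin_num ->
    (V%:E < lebesgue_rV R n.+1 E)%E -> ((2 * kap)%:E <= perimeter C E)%E.
  move=> mE EC finE VE; rewrite leNgt; apply/negP => PE.
  (* A perimeter below 2 kap is bounded by a real P < 2 kap, with 0 covering the value -oo; rigidity
     applied to this P is contradictory. *)
  have [P PP Pk] : exists2 P : R, (perimeter C E <= P%:E)%E & P < 2 * kap.
    case: (perimeter C E) PE => [r||]//=.
      by rewrite lte_fin => h; exists r.
    by move=> _; exists 0; rewrite ?leNye// mulr_gt0.
  by have [] := rigid E P mE EC finE VE PP (ltW Pk); rewrite leNgt Pk.
have profileE v : V + 1 <= v -> profile C v = (2 * kap)%:E.
  move=> Vv; have Vv' : V < v by rewrite (lt_le_trans _ Vv)// ltrDl.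
  have v0 : 0 < v by exact: le_lt_trans Vv'.
  apply/eqP; rewrite eq_le; apply/andP; split.
    have vk : 0 < v / kap by rewrite divr_gt0.
    apply: le_trans (slab_le 0 (v / kap) vk); apply: ereal_inf_lbound.
    exists (cyl K `[0, v / kap]) => //; split => //.
    - exact: lebesgue_measurable_borel.
    - by rewrite slabE ?ltW// subr0 divfK// gt_eqF.
  apply: le_ereal_inf_tmp => _ [E [mE EC Ev] <-].
  by apply: lower => //; rewrite Ev// lte_fin.
(* Adding 1 makes the threshold positive and every admissible volume strictly larger than V. *)
exists (V + 1); first by rewrite ltr_wpDl.
split.
- move=> a b ab; rewrite slabE// lee_fin => hv.
  have ab' : a < b.
    rewrite lt_neqAle ab andbT; apply/eqP => e; move: hv; rewrite e subrr mul0r.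
    by rewrite leNgt ltr_wpDl.
  split => //; first exact: lebesgue_measurable_borel.
  exists ((b - a) * kap); first exact: slabE.
  apply/eqP; rewrite eq_le profileE// slab_le//=.
  apply: lower => //; [exact: lebesgue_measurable_borel|by rewrite slabE|].
  by rewrite slabE// lte_fin (lt_le_trans _ hv)// ltrDl.
- move=> E [mE EC [v Ev PE]]; rewrite Ev lee_fin => hv.
  (* An isoperimetric region has perimeter exactly 2 kap, so rigidity applies with P = 2 kap. *)
  have Pk : (perimeter C E <= (2 * kap)%:E)%E by rewrite PE profileE.
  have [||_ //] := rigid E (2 * kap) mE EC _ _ Pk (lexx _); rewrite Ev//.
  by rewrite lte_fin (lt_le_trans _ hv)// ltrDl.
- by move=> v hv; rewrite profileE// KE EFinM.
Qed.
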